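(* Let $0<\delta\le 1$ and let $g:\mathbb{R}\to\mathbb{R}$ be a continuous $1$-periodic function with Fourier expansion $g(x)=\sum_{k\in\mathbb{Z}}C_k e^{2\pi i kx}$ such that $\sum_{k=1}^{\infty}|C_k|\,k^{\frac{\varepsilon+\delta}{2}}<\infty$ for some $\varepsilon>0$. Define $G_\delta(x)=\sum_{n=1}^{\infty}\frac{g(n^2x)}{n^{1+\delta}}$. If there exists a positive square-free integer $d_0$ such that $$\sum_{\substack{k=m^{2}d_0\\ m\in\mathbb{N}^+}}C_k\,k^{\delta/2}\neq0,$$ then $$\underline{\dim}_{\mathrm{B}}\bigl(\mathrm{graph}(G_\delta)\bigr)\ge\frac74-\frac{\delta}{2}.$$
   Context: $\mathbb{N}^+$ denotes the positive integers. For a continuous function $f$ on $[0,1]$ (here the restriction of $G_\delta$ to $[0,1]$), $\mathrm{graph}(f)=\{(x,f(x)):x\in[0,1]\}$. For a positive integer $N$, $A_N(f)$ is the number of grid squares $[i/N,(i+1)/N]\times[j/N,(j+1)/N]$ ($i,j\in\mathbb{Z}$) of side length $1/N$ that intersect $\mathrm{graph}(f)$. The lower box dimension is $\underline{\dim}_{\mathrm{B}}(\mathrm{graph}(f))=\liminf_{N\to\infty}\frac{\log A_N(f)}{\log N}$. *)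

(* Defs.v *)
From Stdlib Require Import Reals ZArith Ensembles Finite_sets ClassicalEpsilon.
From Coquelicot Require Import Coquelicot.
Open Scope R_scope.

(* e(t) = exp (2 i pi t) *)
Definition cis (t : R) : C := (cos (2 * PI * t), sin (2 * PI * t)).

(* The series over all of Z converges pointwise in the sense of its symmetric
   partial sums, over -N <= k <= N with k = j - N. *)
Definition is_fourier_expansion (g : R -> C) (c : Z -> C) : Prop :=
  (forall k : Z, is_RInt (fun x => Cmult (g x) (cis (- IZR k * x))) 0 1 (c k)) /\
  (forall x : R,
     filterlim
       (fun N : nat =>
          sum_n (fun j : nat =>
                   let k := (Z.of_nat j - Z.of_nat N)%Z in
                   Cmult (c k) (cis (IZR k * x)))
                (2 * N))
       eventually (locally (g x))).

Definition square_free (d : nat) : Prop :=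
  forall m : nat, Nat.divide (m * m) d -> m = 1%nat.

(* The summation index n stands for the integer S n >= 1. *)
Definition G (delta : R) (g : R -> R) (x : R) : R :=
  Series (fun n : nat => g (INR (S n) ^ 2 * x) / Rpower (INR (S n)) (1 + delta)).

Definition graph (f : R -> R) : Ensemble (R * R) :=
  fun p => 0 <= fst p <= 1 /\ snd p = f (fst p).

Definition grid_square (N : nat) (ij : Z * Z) : Ensemble (R * R) :=
  fun p =>
    IZR (fst ij) / INR N <= fst p <= (IZR (fst ij) + 1) / INR N /\
    IZR (snd ij) / INR N <= snd p <= (IZR (snd ij) + 1) / INR N.

Definition squares_meeting (A : Ensemble (R * R)) (N : nat) : Ensemble (Z * Z) :=
  fun ij => Inhabited _ (Intersection _ (grid_square N ij) A).

(* The cardinality, which is unspecified if infinitely many squares meet A. *)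
Definition box_count (A : Ensemble (R * R)) (N : nat) : nat :=
  epsilon (inhabits 0%nat) (cardinal (Z * Z) (squares_meeting A N)).

(* The terms N = 0 and N = 1, where the quotient is meaningless, do not affect
   the lower limit. *)
Definition lower_box_dim (A : Ensemble (R * R)) : Rbar :=
  LimInf_seq (fun N : nat => ln (INR (box_count A N)) / ln (INR N)).

(* Main.v *)
Require Import Defs.
From Stdlib Require Import Reals ZArith Lra Lia Psatz ClassicalEpsilon Classical.
From Stdlib Require Import FunctionalExtensionality PropExtensionality.
From Stdlib Require List Ensembles Finite_sets.
From HB Require Import structures.
From mathcomp Require all_boot ssralg zmodp zify.
From Coquelicot Require Import Coquelicot.
Open Scope R_scope.

(** Write D_h(x) = G(x + h) + G(x - h) - 2 G(x).  The proof shows that D_h is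
    large at many rational points, and then that these points lie in distinct
    columns of the grid.

    Let q be a product of distinct odd primes and chi_q the product of their
    Legendre symbols, a character whose Gauss sum g_q has modulus sqrt q
    ([chiE_gauss]).  The mode e(k n^2 x) of G contributes to
    sum_(a < q) chi_q(a) D_h(a/q) a multiple of chi_q(k n^2), which is chi_q(k)
    if n is coprime to q and 0 otherwise.  Hence ([twisted_sumE],
    [twisted_G_close]) the sum equals
    - 2 g_q sum_(k <> 0) C_k chi_q(k) U_q(|k| h), where
    U_q(t) = sum_(n coprime to q) n^(-1-delta) (1 - cos (2 pi t n^2)).
    As t tends to 0, U_q(t) is asymptotic to I kappa_q t^(delta/2), where I is a
    positive integral and kappa_q = prod_(p | q) (1 - 1/p)
    ([coprime_sum_asymptotics]).  So the twisted sum is of size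
    sqrt q h^(delta/2) as soon as B(q) = sum_k C_k |k|^(delta/2) chi_q(k) stays
    away from 0.

    To achieve this, take q = l * prod E with l a large prime and E a subset of
    a fixed finite set Ps of primes.  The average over E of chi_q(d0) B(q) is
    sum_k C_k |k|^(delta/2) chi_l(d0 k) prod_(r in Ps) (1 + chi_r(d0 k)) / 2.
    The set Ps is chosen ([select_primes]) so that, in the relevant range,
    every k for which d0 k is not a square has some r in Ps with
    chi_r(d0 k) = -1.  Only the terms k = m^2 d0 survive, and the average is a
    partial sum of the series that is assumed to be non-zero; some E does at
    least as well as the average ([average_twist]).  The primes r exist because
    a non-square integer is a non-residue modulo arbitrarily large primes
    ([nonresidue_exists]), by a counting argument based on Thue's lemma.

    The outcome ([second_differences_large]) is that for every large prime l
    and small h some q with l | q | l Q, Q fixed, satisfies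
    sum |D_h(a/q)| >= c sqrt l h^(delta/2) over the reduced fractions a/q.
    With h = 1/N and l <= Y, where (Y Q)^2 <= N, these fractions lie in distinct
    columns of the grid, and N |D_h(a/q)| is at most a combination of the numbers
    of squares met in three adjacent columns.  Thus ([box_count_ge])
    4 A_N >= c N^(1 - delta/2) sum_(l <= Y) sqrt l, and Chebyshev's bound for the
    number of primes makes the right-hand side N^(7/4 - delta/2 - o(1)). *)

(** * Finite sums of real and complex numbers *)

Lemma functional_choice {A B : Type} {P : A -> B -> Prop} :
  (forall x, exists y, P x y) -> exists f : A -> B, forall x, P x (f x).
Proof.
  intros h; exists (fun x => proj1_sig (constructive_indefinite_description _ (h x))).
  intros x; apply proj2_sig.
Qed.

Module SumNotations.
Import all_boot.
Notation "\rsum_ ( i <- s ) F" := (\big[Rplus/(IZR 0)]_(i <- s) F)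
  (at level 41, F at level 41, i, s at level 50).
Notation "\csum_ ( i < n ) F" := (\big[Cplus/RtoC 0]_(i < n) F%C)
  (at level 41, F at level 41, i, n at level 50).
Notation "n %:Z" := (Z.of_nat n) (at level 2, format "n %:Z").
End SumNotations.

Section Sums.
Import all_boot SumNotations.
#[local] Set Implicit Arguments.
#[local] Unset Strict Implicit.

HB.instance Definition _ :=
  Monoid.isComLaw.Build R 0 Rplus (fun x y z => esym (Rplus_assoc x y z)) Rplus_comm Rplus_0_l.
HB.instance Definition _ :=
  Monoid.isComLaw.Build R 1 Rmult (fun x y z => esym (Rmult_assoc x y z)) Rmult_comm Rmult_1_l.
HB.instance Definition _ :=
  Monoid.isMulLaw.Build R 0 Rmult Rmult_0_l Rmult_0_r.
HB.instance Definition _ :=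
  Monoid.isAddLaw.Build R Rmult Rplus Rmult_plus_distr_r Rmult_plus_distr_l.

HB.instance Definition _ :=
  Monoid.isComLaw.Build C (RtoC 0) Cplus Cplus_assoc Cplus_comm Cplus_0_l.
HB.instance Definition _ :=
  Monoid.isComLaw.Build C (RtoC 1) Cmult Cmult_assoc Cmult_comm Cmult_1_l.
HB.instance Definition _ :=
  Monoid.isMulLaw.Build C (RtoC 0) Cmult Cmult_0_l Cmult_0_r.
HB.instance Definition _ :=
  Monoid.isAddLaw.Build C Cmult Cplus Cmult_plus_distr_r Cmult_plus_distr_l.

Lemma rsum_le (T : eqType) (s : seq T) (F H : T -> R) :
  (forall i, i \in s -> F i <= H i) -> \rsum_(i <- s) F i <= \rsum_(i <- s) H i.
Proof.
move=> h; rewrite big_seq [X in _ <= X]big_seq.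
by elim/big_ind2: _ => [|a b a' b' h1 h2|i /h //]; [lra | exact: Rplus_le_compat].
Qed.

Lemma rsum_const (T : Type) (s : seq T) (c : R) : \rsum_(i <- s) c = c * INR (size s).
Proof.
elim: s => [|x s IH]; first by rewrite big_nil /= Rmult_0_r.
by rewrite big_cons IH -[size (x :: s)]/((size s).+1) S_INR Rmult_plus_distr_l Rmult_1_r Rplus_comm.
Qed.

Lemma rsum_ge_const (T : eqType) (s : seq T) (F : T -> R) (c : R) :
  (forall i, i \in s -> c <= F i) -> c * INR (size s) <= \rsum_(i <- s) F i.
Proof. by move=> h; rewrite -rsum_const; apply: rsum_le. Qed.

Lemma rsum_le_const (T : eqType) (s : seq T) (F : T -> R) (c : R) :
  (forall i, i \in s -> F i <= c) -> \rsum_(i <- s) F i <= c * INR (size s).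
Proof. by move=> h; rewrite -rsum_const; apply: rsum_le. Qed.

Lemma rsum_scal (T : Type) (s : seq T) (c : R) (F : T -> R) :
  \rsum_(i <- s) (c * F i) = c * (\rsum_(i <- s) F i).
Proof. by rewrite big_distrr. Qed.

Lemma rsum_plus (T : Type) (s : seq T) (F H : T -> R) :
  \rsum_(i <- s) (F i + H i) = \rsum_(i <- s) F i + \rsum_(i <- s) H i.
Proof. exact: big_split. Qed.

Lemma INR_sum (T : Type) (s : seq T) (F : T -> nat) :
  INR (\sum_(i <- s) F i)%N = \rsum_(i <- s) INR (F i).
Proof. by elim: s => [|i s IH]; rewrite ?big_nil // !big_cons plus_INR IH. Qed.

Lemma INR_expn (a k : nat) : INR (a ^ k)%N = INR a ^ k.
Proof. by elim: k => //= k IH; rewrite expnS mult_INR IH. Qed.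

Lemma rsum_filter_le (T : eqType) (s : seq T) (P : pred T) (F : T -> R) :
  (forall i, i \in s -> 0 <= F i) -> \rsum_(i <- filter P s) F i <= \rsum_(i <- s) F i.
Proof.
elim: s => [|x s IH] h /=; first lra.
have h1 : 0 <= F x by apply: h; rewrite inE eqxx.
have h2 : \rsum_(i <- filter P s) F i <= \rsum_(i <- s) F i.
  by apply: IH => i si; apply: h; rewrite inE si orbT.
case: (P x); rewrite !big_cons; lra.
Qed.
End Sums.

(** * The Legendre symbol *)

(** The Legendre symbol, extended to all integers by 0 at multiples of p. *)
Definition chi (p : nat) (z : Z) : R :=
  if excluded_middle_informative (Z.divide (Z.of_nat p) z) then 0
  else if excluded_middle_informative
            (exists y : Z, Z.divide (Z.of_nat p) (y * y - z)) then 1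
  else -1.

Section Legendre.
Import all_boot ssralg zmodp zify.
Import GRing.Theory.
#[local] Set Implicit Arguments.
#[local] Unset Strict Implicit.
Local Open Scope ring_scope.
Local Open Scope R_scope.

Lemma dvd_natP (p a : nat) : Z.divide (Z.of_nat p) (Z.of_nat a) <-> (p %| a)%N.
Proof.
split.
  case=> z hz; apply/dvdnP; exists (Z.to_nat z); nia.
by case/dvdnP=> k ->; exists (Z.of_nat k); lia.
Qed.

(** Translates between divisibility in Z and equality in the prime field, where the squares are counted. *)
Lemma Fp_nat_eqP (p a b : nat) : prime p ->
  (a%:R = b%:R :> 'F_p)%R <-> Z.divide (Z.of_nat p) (Z.of_nat a - Z.of_nat b).
Proof.
move=> pp; have p0 := prime_gt0 pp.
have -> : (a%:R = b%:R :> 'F_p)%R <-> (a %% p = b %% p)%N.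
  split=> [h|h].
    by rewrite -!(val_Fp_nat pp) h.
  by apply: val_inj; rewrite /= !(val_Fp_nat pp).
split=> [h|[k hk]].
  exists (Z.of_nat (a %/ p) - Z.of_nat (b %/ p))%Z.
  have := divn_eq a p; have := divn_eq b p; rewrite h => h1 h2.
  by move: (b %% p)%N (a %/ p)%N (b %/ p)%N h1 h2 => r u v -> ->; nia.
have [k0|k0] := Z.le_gt_cases 0 k.
  have -> : a = (Z.to_nat k * p + b)%N by nia.
  by rewrite modnMDl.
have -> : b = (Z.to_nat (- k) * p + a)%N by nia.
by rewrite modnMDl.
Qed.

Lemma chi_periodic (p : nat) (z w : Z) :
  Z.divide (Z.of_nat p) (z - w) -> chi p z = chi p w.
Proof.
move=> d; rewrite /chi.
have h1 : Z.divide (Z.of_nat p) z <-> Z.divide (Z.of_nat p) w.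
  case: d => t ht; split; case=> s hs; [exists (s - t)%Z | exists (s + t)%Z]; lia.
have h2 : (exists y : Z, Z.divide (Z.of_nat p) (y * y - z)) <->
          (exists y : Z, Z.divide (Z.of_nat p) (y * y - w)).
  case: d => t ht; split; case=> y [s hs]; exists y; [exists (s + t)%Z | exists (s - t)%Z]; lia.
by repeat destruct (excluded_middle_informative _); tauto.
Qed.

Lemma Z_residue (p : nat) (z : Z) : (0 < p)%N ->
  exists2 a : nat, (a < p)%N & Z.divide (Z.of_nat p) (z - Z.of_nat a).
Proof.
move=> p0; exists (Z.to_nat (z mod Z.of_nat p)).
  have := Z.mod_pos_bound z (Z.of_nat p); lia.
have h := Z.mod_pos_bound z (Z.of_nat p).
rewrite Z2Nat.id; last lia.
exists (z / Z.of_nat p)%Z; have := Z.div_mod z (Z.of_nat p); lia.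
Qed.

Lemma chi_natE (p a : nat) : prime p ->
  chi p (Z.of_nat a) =
  if (a%:R == 0 :> 'F_p)%R then 0 else
  if [exists y : 'F_p, (y * y == a%:R)%R] then 1 else -1.
Proof.
move=> pp; rewrite /chi.
have h0 : Z.divide (Z.of_nat p) (Z.of_nat a) <-> (a%:R == 0 :> 'F_p)%R.
  have := Fp_nat_eqP a 0 pp; rewrite Z.sub_0_r => <-.
  by split=> [->|/eqP].
case: excluded_middle_informative => [/h0 -> //|hn].
case: ifP => [/h0 //|_].
have h1 : (exists y : Z, Z.divide (Z.of_nat p) (y * y - Z.of_nat a)) <->
   [exists y : 'F_p, (y * y == a%:R)%R].
  split.
    case=> y hy; have [b bp hb] := Z_residue y (prime_gt0 pp).
    apply/existsP; exists (b%:R)%R; rewrite -natrM; apply/eqP/(Fp_nat_eqP _ _ pp).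
    case: hy => s hs; case: hb => t ht.
    exists (s - t * (y + Z.of_nat b))%Z; nia.
  case/existsP=> y /eqP; rewrite -(natr_Zp y) -natrM => /(Fp_nat_eqP _ _ pp) h.
  by exists (Z.of_nat y); rewrite Nat2Z.inj_mul in h.
case: excluded_middle_informative => [/h1 -> //|hm].
by case: ifP => [/h1 //|].
Qed.

Section FpSquares.
Variable (p : nat) (pp : prime p) (p2 : (2 < p)%N).

Let sq : {set 'F_p} := [set (x * x)%R | x : 'F_p & x != 0%R].
Let ns : {set 'F_p} := [set x : 'F_p | (x != 0%R) && (x \notin sq)].

Let card_units : (#|[set x : 'F_p | x != 0%R]| = #|sq| + #|ns|)%N.
Proof.
rewrite -cardsUI.
have -> : sq :&: ns = set0.
  by apply/setP=> x; rewrite !inE; case: (x \in sq); rewrite ?andbF.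
rewrite cards0 addn0; congr #|pred_of_set _|; apply/setP=> x; rewrite !inE.
case hx: (x \in sq); rewrite ?andbT //=.
case/imsetP: hx => y; rewrite inE => y0 ->; by rewrite mulf_neq0.
Qed.

Let leq_ns_sq : (#|ns| <= #|sq|)%N.
Proof.
suff : (#|[set x : 'F_p | x != 0%R]| <= #|sq| * 2)%N by rewrite card_units; lia.
rewrite -sum1_card (partition_big (fun x : 'F_p => (x * x)%R) (mem sq)) /=; last first.
  by move=> x; rewrite inE => x0; apply/imsetP; exists x; rewrite ?inE.
rewrite -sum_nat_const; apply: leq_sum => y ysq.
case/imsetP: ysq => x; rewrite inE => x0 ->.
rewrite sum1_card.
apply: (@leq_trans #|[set x; (- x)%R]|); last by rewrite cards2; case: (_ != _).
apply: subset_leq_card; apply/subsetP => z; rewrite !inE unfold_in /= => /andP[_ h].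
by rewrite -!expr2 eqf_sqr in h.
Qed.

Lemma Fp_nonsq_mul (a b : 'F_p) : (a != 0 -> b != 0 ->
  ~~ [exists y : 'F_p, y * y == a] -> ~~ [exists y : 'F_p, y * y == b] ->
  [exists y : 'F_p, y * y == a * b])%R.
Proof.
move=> a0 b0 na nb.
have sqP x : (x != 0)%R -> (x \in sq) = [exists y : 'F_p, (y * y == x)%R].
  move=> x0; apply/imsetP/existsP.
    by case=> y _ ->; exists y.
  case=> y /eqP hy; exists y => //; rewrite inE.
  by apply: contraNneq x0 => y0; rewrite -hy y0 mulr0.
rewrite -sqP ?mulf_neq0 //.
(* Multiplication by a non-square maps the squares injectively into the
   non-squares, which are not more numerous, so it reaches all of them. *)
have ans : [set (a * x)%R | x in sq] = ns.
  apply/eqP; rewrite eqEcard; apply/andP; split; last first.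
    rewrite card_imset //; by apply: mulfI.
  apply/subsetP => z /imsetP[x xs ->].
  case/imsetP: xs => y; rewrite inE => y0 ->.
  rewrite inE mulf_neq0 ?mulf_neq0 //= sqP ?mulf_neq0 //.
  apply: contra na => /existsP[w /eqP hw]; apply/existsP; exists (w / y)%R.
  apply/eqP; rewrite mulrACA hw -mulrA -invfM mulfV ?mulr1 //; exact: mulf_neq0.
have : b \in ns by rewrite inE b0 sqP.
rewrite -ans => /imsetP[x xs ->].
case/imsetP: xs => y; rewrite inE => y0 ->.
rewrite mulrA mulrACA; apply/imsetP; exists (a * y)%R => //.
by rewrite inE mulf_neq0.
Qed.

Lemma Fp_nonsq_exists : exists2 u : 'F_p, (u != 0)%R & ~~ [exists y : 'F_p, (y * y == u)%R].
Proof.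
apply/exists_inP; apply: contraT; rewrite negb_exists_in => /forall_inP h.
have sur (u : 'F_p) : exists y, (y * y = u)%R.
  have [->|u0] := eqVneq u 0%R; first by exists 0%R; rewrite mulr0.
  by move/negPn/existsP: (h u u0) => [y /eqP hy]; exists y.
(* If every element were a square, squaring would be injective, but 1 and -1
   have the same square. *)
have : injective (fun y : 'F_p => (y * y)%R).
  have [g hg] : exists g : 'F_p -> 'F_p, cancel g (fun y => (y * y)%R).
    by have [g hg] := functional_choice sur; exists g.
  by case: (injF_bij (can_inj hg)) => f fg gf; apply: (can_inj (g := g)) => x /=; have := hg (f x); rewrite /= gf => ->; rewrite gf.
move/(_ 1%R (-1)%R); rewrite mulrNN => /(_ erefl) /eqP.
rewrite -subr_eq0 opprK -mulr2n.
by rewrite -(dvdn_pcharf (pchar_Fp pp)) => /dvdn_leq; lia.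
Qed.
End FpSquares.

Lemma chi_values (p : nat) (z : Z) :
  [\/ chi p z = 0 /\ Z.divide (Z.of_nat p) z,
      chi p z = 1 /\ ~ Z.divide (Z.of_nat p) z |
      chi p z = -1 /\ ~ Z.divide (Z.of_nat p) z].
Proof.
rewrite /chi; case: excluded_middle_informative => h; first by constructor 1.
by case: excluded_middle_informative => _; [constructor 2 | constructor 3].
Qed.

Lemma chi_sqr (p : nat) (z : Z) :
  ~ Z.divide (Z.of_nat p) (z * z) -> chi p (z * z) = 1.
Proof.
rewrite /chi => h; case: excluded_middle_informative => // _.
case: excluded_middle_informative => // -[]; exists z, 0%Z; lia.
Qed.

Lemma chi_mul (p : nat) (z w : Z) : prime p -> (2 < p)%N ->
  chi p (z * w) = chi p z * chi p w.
Proof.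
move=> pp p2.
have [a _ ha] := Z_residue z (prime_gt0 pp).
have [b _ hb] := Z_residue w (prime_gt0 pp).
rewrite (chi_periodic ha) (chi_periodic hb).
have -> : chi p (z * w) = chi p (Z.of_nat (a * b)).
  apply: chi_periodic; case: ha => s hs; case: hb => t ht.
  exists (s * w + t * Z.of_nat a)%Z; nia.
rewrite !chi_natE // natrM.
have [->|a0] := eqVneq (a%:R : 'F_p)%R 0%R; first by rewrite mul0r eqxx Rmult_0_l.
have [->|b0] := eqVneq (b%:R : 'F_p)%R 0%R; first by rewrite mulr0 eqxx Rmult_0_r.
rewrite (negbTE (mulf_neq0 a0 b0)).
case: ifP => [|/negbT] hab; case: ifP => [|/negbT] h1; case: ifP => [|/negbT] h2; try lra.
- case/negP: h2; case/existsP: hab => x /eqP hx; case/existsP: h1 => y /eqP hy.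
  apply/existsP; exists (x / y)%R.
  have y0 : (y != 0)%R by apply: contraNneq a0 => y0; rewrite -hy y0 mulr0.
  by rewrite mulrACA hx -invfM hy mulrAC mulfV ?mul1r.
- case/negP: h1; case/existsP: hab => x /eqP hx; case/existsP: h2 => y /eqP hy.
  apply/existsP; exists (x / y)%R.
  have y0 : (y != 0)%R by apply: contraNneq b0 => y0; rewrite -hy y0 mulr0.
  by rewrite mulrACA hx -invfM hy mulfK.
- case/negP: hab; case/existsP: h1 => x /eqP hx; case/existsP: h2 => y /eqP hy.
  by apply/existsP; exists (x * y)%R; rewrite mulrACA hx hy.
- by rewrite (Fp_nonsq_mul pp p2 a0 b0 h1 h2) in hab.
Qed.

Lemma chi_nonresidue_exists (p : nat) : prime p -> (2 < p)%N ->
  exists u : Z, chi p u = -1.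
Proof.
move=> pp p2; have [u u0 hu] := Fp_nonsq_exists pp p2.
by exists (Z.of_nat u); rewrite chi_natE // natr_Zp (negbTE u0) (negbTE hu).
Qed.

End Legendre.

(** * Gauss sums of products of Legendre symbols *)

(** The additive character z -> exp (2 i pi z / q) modulo q. *)
Definition e (z : Z) (q : nat) : C := cis (IZR z / INR q).

Lemma cis_add (s t : R) : cis (s + t) = Cmult (cis s) (cis t).
Proof.
  unfold cis, Cmult; simpl.
  rewrite Rmult_plus_distr_l, cos_plus, sin_plus.
  f_equal; ring.
Qed.

Lemma cis_int (k : Z) : cis (IZR k) = RtoC 1.
Proof.
  assert (h0 : sin (IZR k * PI) = 0) by (apply sin_eq_0_1; now exists k).
  unfold cis, RtoC.
  replace (2 * PI * IZR k) with (2 * (IZR k * PI)) by ring.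
  rewrite cos_2a_sin, sin_2a, h0; f_equal; ring.
Qed.

Lemma Cmod_cis (t : R) : Cmod (cis t) = 1.
Proof.
  unfold Cmod, cis; simpl; rewrite !Rmult_1_r.
  generalize (sin2_cos2 (2 * PI * t)); unfold Rsqr; intros h.
  replace (_ + _) with 1 by lra.
  apply sqrt_1.
Qed.

Lemma cis_opp (t : R) : cis (- t) = Cconj (cis t).
Proof.
  unfold cis, Cconj; simpl.
  now rewrite Ropp_mult_distr_r_reverse, cos_neg, sin_neg.
Qed.

Lemma cis_neq_1 (t : R) : (forall k : Z, t <> IZR k) -> cis t <> RtoC 1.
Proof.
  unfold cis, RtoC; intros h1 [= h2 _].
  replace (2 * PI * t) with (2 * (t * PI)) in h2 by ring.
  rewrite cos_2a_sin in h2.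
  assert (h3 : sin (t * PI) = 0) by nra.
  apply sin_eq_0_0 in h3; destruct h3 as [k hk].
  apply (h1 k); apply Rmult_eq_reg_r with PI; [exact hk | apply PI_neq0].
Qed.

Lemma e_add (z w : Z) (q : nat) : e (z + w) q = Cmult (e z q) (e w q).
Proof.
  unfold e; rewrite <- cis_add; f_equal; rewrite plus_IZR; unfold Rdiv; ring.
Qed.

Lemma e_opp (z : Z) (q : nat) : e (- z) q = Cconj (e z q).
Proof.
  unfold e; rewrite <- cis_opp; f_equal; rewrite opp_IZR; unfold Rdiv; ring.
Qed.

Lemma e_mult (q : nat) (z : Z) : (q <> 0)%nat -> e (z * Z.of_nat q) q = RtoC 1.
Proof.
  intros hq; unfold e; rewrite <- (cis_int z); f_equal.
  rewrite mult_IZR, <- INR_IZR_INZ; field; now apply not_0_INR.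
Qed.

Section GaussSums.
Import all_boot zify SumNotations.
#[local] Set Implicit Arguments.
#[local] Unset Strict Implicit.

Definition periodic (q : nat) (f : Z -> C) :=
  forall z w : Z, Z.divide q%:Z (z - w) -> f z = f w.

Lemma e_periodic (M : Z) (q : nat) : (0 < q)%N -> periodic q (fun a => e (M * a) q).
Proof.
move=> q0 z w [k hk].
have -> : (M * z = M * w + (M * k) * q%:Z)%Z by nia.
rewrite e_add e_mult ?Cmult_1_r //; lia.
Qed.

Lemma csum_mull (n : nat) (x : C) (F : nat -> C) :
  \csum_(a < n) (x * F a) = (x * (\csum_(a < n) F a))%C.
Proof. by rewrite big_distrr. Qed.

Lemma csum_mulr (n : nat) (x : C) (F : nat -> C) :
  \csum_(a < n) (F a * x) = ((\csum_(a < n) F a) * x)%C.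
Proof. by rewrite big_distrl. Qed.

(** A complete sum of a periodic function may be taken over any complete residue system. *)
Lemma csum_perm (q : nat) (f : Z -> C) (h : nat -> Z) :
  periodic q f ->
  (forall a b : nat, (a < q)%N -> (b < q)%N -> Z.divide q%:Z (h a - h b) -> a = b) ->
  \csum_(a < q) f (h a) = \csum_(a < q) f a%:Z.
Proof.
case: q => [|q] per inj; first by rewrite !big_ord0.
have ex (a : 'I_q.+1) : exists b : 'I_q.+1, Z.divide (q.+1)%:Z (h a - b%:Z).
  have [b bq hb] := Z_residue (h a) (ltn0Sn q).
  by exists (Ordinal bq).
have [s sP] := functional_choice ex.
have s_inj : injective s.
  move=> a b sab; apply: val_inj => /=; apply: inj => //.
  have [u hu] := sP a; have [v hv] := sP b; rewrite sab in hu.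
  by exists (u - v)%Z; lia.
rewrite [RHS](reindex_inj s_inj) /=; apply: eq_bigr => a _; exact: per.
Qed.

Lemma cancel_mod (q m x y : nat) : coprime q m -> (x < q)%N -> (y < q)%N ->
  Z.divide q%:Z ((x%:Z - y%:Z) * m%:Z) -> x = y.
Proof.
move=> cop xq yq [t ht].
wlog le_yx : x y t xq yq ht / (y <= x)%N.
  move=> wl; case/orP: (leq_total y x) => h; first exact: (wl x y t).
  by apply/esym/(wl y x (- t)%Z) => //; lia.
have : (q %| (x - y) * m)%N by apply/dvd_natP; exists t; nia.
rewrite Gauss_dvdl // => /dvdn_leq; lia.
Qed.

Lemma cancel_mod_prime (p x y : nat) (u : Z) : prime p -> ~ Z.divide p%:Z u ->
  (x < p)%N -> (y < p)%N -> Z.divide p%:Z (u * x%:Z - u * y%:Z) -> x = y.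
Proof.
move=> pp hu xp yp [t ht].
apply: (cancel_mod (q := p) (m := Z.abs_nat u)) => //.
  rewrite prime_coprime //; apply/negP => /dvd_natP h; apply: hu.
  by move: h; rewrite Zabs2Nat.id_abs => /Z.divide_abs_r.
rewrite Zabs2Nat.id_abs; case: (Z.abs_spec u) => -[_ ->].
  by exists t; lia.
by exists (- t)%Z; lia.
Qed.

(** By the Chinese remainder theorem, a q2 + b q1 runs over all residues modulo q1 q2. *)
Lemma csum_crt (q1 q2 : nat) (f : Z -> C) :
  periodic (q1 * q2) f -> (0 < q1)%N -> (0 < q2)%N -> coprime q1 q2 ->
  \csum_(c < q1 * q2) f c%:Z =
  \csum_(a < q1) \csum_(b < q2) f (a%:Z * q2%:Z + b%:Z * q1%:Z)%Z.
Proof.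
move=> per q10 q20 cop; rewrite pair_big /=.
have ex (u : 'I_q1 * 'I_q2) : exists c : 'I_(q1 * q2),
    Z.divide (q1 * q2)%:Z ((u.1 : nat)%:Z * q2%:Z + (u.2 : nat)%:Z * q1%:Z - c%:Z).
  have q0 : (0 < q1 * q2)%N by rewrite muln_gt0 q10.
  have [b bq hb] := Z_residue ((u.1 : nat)%:Z * q2%:Z + (u.2 : nat)%:Z * q1%:Z) q0.
  by exists (Ordinal bq).
have [s sP] := functional_choice ex.
have s_inj : injective s.
  move=> [a b] [a' b'] sab.
  have [u hu] := sP (a, b); have [v hv] := sP (a', b'); rewrite sab /= in hu hv.
  congr (_, _); apply: val_inj => /=.
    apply: (cancel_mod (q := q1) (m := q2)) => //; exists ((u - v) * q2%:Z - (b%:Z - b'%:Z))%Z.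
    by move: hu hv; rewrite Nat2Z.inj_mul; nia.
  apply: (cancel_mod (q := q2) (m := q1)) => //; first by rewrite coprime_sym.
  exists ((u - v) * q1%:Z - (a%:Z - a'%:Z))%Z.
  by move: hu hv; rewrite Nat2Z.inj_mul; nia.
have s_bij : bijective s.
  by apply: inj_card_bij s_inj _; rewrite card_prod !card_ord.
rewrite (reindex s) /=; last exact: onW_bij.
apply: eq_bigr => u _; apply: esym; exact: per.
Qed.

Lemma csum_e (p : nat) (M : Z) : (0 < p)%N ->
  \csum_(b < p) e (M * b%:Z) p =
  if excluded_middle_informative (Z.divide p%:Z M) then RtoC (INR p) else RtoC 0.
Proof.
move=> p0; case: excluded_middle_informative => [[k hk]|hM].
  rewrite (eq_bigr (fun=> RtoC 1)); last first.
    move=> b _; rewrite hk.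
    have -> : (k * p%:Z * (b : nat)%:Z = k * b%:Z * p%:Z)%Z by ring.
    rewrite e_mult //; lia.
  rewrite big_const card_ord.
  have it n : iter n (Cplus 1) (RtoC 0) = RtoC (INR n).
    by elim: n => [|n IH] //; rewrite iterS IH S_INR RtoC_plus Cplus_comm.
  exact: it.
(* Shifting the variable multiplies the sum by e(M/p), which is not 1. *)
have h1 : \csum_(b < p) e (M * (b%:Z + 1)) p = \csum_(b < p) e (M * b%:Z) p.
  apply: (csum_perm (f := fun z => e (M * z) p) (h := fun b : nat => (b%:Z + 1)%Z)).
    exact: e_periodic.
  move=> a b ap bp [k hk]; apply: (cancel_mod (m := 1) (coprimen1 p)) => //.
  by exists k; lia.
have h2 : (e M p - 1)%C <> RtoC 0.
  move=> h.
  have : e M p = RtoC 1.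
    by have -> : e M p = (e M p - 1 + 1)%C; [ring | rewrite h Cplus_0_l].
  apply: cis_neq_1 => k hk; apply: hM; exists k; apply: eq_IZR.
  rewrite mult_IZR -hk -INR_IZR_INZ; field; apply: not_0_INR; lia.
have h3 : ((e M p - 1) * (\csum_(b < p) e (M * b%:Z) p) = 0)%C.
    have h3 : \csum_(b < p) e (M * (b%:Z + 1)) p = (e M p * (\csum_(b < p) e (M * b%:Z) p))%C.
    rewrite big_distrr /=; apply: eq_bigr => b _.
    by rewrite Z.mul_add_distr_l e_add Z.mul_1_r Cmult_comm.
  have -> : forall x y : C, ((x - 1) * y = x * y - y)%C by move=> x y; ring.
  by rewrite -h3 h1 /Cminus Cplus_opp_r.
have [//|h4] := excluded_middle_informative (\csum_(b < p) e (M * b%:Z) p = RtoC 0).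
by case: (Cmult_neq_0 _ _ h2 h4).
Qed.

Lemma chiC_periodic (p : nat) : periodic p (fun z => RtoC (chi p z)).
Proof. by move=> z w h; rewrite (chi_periodic h). Qed.

Lemma periodicM (q : nat) (f f' : Z -> C) :
  periodic q f -> periodic q f' -> periodic q (fun z => f z * f' z)%C.
Proof. by move=> pf pf' z w h; rewrite (pf _ _ h) (pf' _ _ h). Qed.

Lemma csum_chi (p : nat) : prime p -> (2 < p)%N -> \csum_(a < p) chi p a%:Z = RtoC 0.
Proof.
move=> pp p2; have [u hu] := chi_nonresidue_exists pp p2.
(* Multiplying the variable by a non-residue u changes the sign of the sum. *)
have : \csum_(a < p) chi p (u * a%:Z) = \csum_(a < p) chi p a%:Z.
  apply: (csum_perm (f := fun z => RtoC (chi p z)) (h := fun a : nat => (u * a%:Z)%Z)).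
    exact: chiC_periodic.
  move=> a b; apply: cancel_mod_prime => //.
  by case: (chi_values p u) => -[h1 h2] //; rewrite h1 in hu; lra.
rewrite (eq_bigr (fun a : 'I_p => (RtoC (-1) * chi p a%:Z)%C)); last first.
  by move=> a _; rewrite chi_mul // hu -RtoC_mult.
rewrite -big_distrr /= => h.
have h2 : (RtoC 2 * (\csum_(a < p) chi p a%:Z) = 0)%C.
  have e2 : RtoC 2 = (1 + 1)%C by rewrite -RtoC_plus; congr RtoC; lra.
  have e1 : RtoC (-1) = (- (1))%C by rewrite -RtoC_opp.
  move: h; rewrite e1 e2; set x := (X in (_ * X)%C = _) => h.
  have -> : ((1 + 1) * x = x - (- (1)) * x)%C by ring.
  by rewrite h /Cminus Cplus_opp_r.
have [//|h4] := excluded_middle_informative (\csum_(a < p) chi p a%:Z = RtoC 0).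
have h5 : RtoC 2 <> RtoC 0 by move=> /RtoC_inj; lra.
by case: (Cmult_neq_0 _ _ h5 h4).
Qed.

(** The character chi_q of the modulus [prodl E]. *)
Definition chiE (E : seq nat) (z : Z) : R := foldr (fun p r => chi p z * r) 1 E.

Definition prodl (E : seq nat) : nat := foldr muln 1%N E.

Definition odd_primes (E : seq nat) := uniq E && all (fun p => prime p && (2 < p)%N) E.

(** The finite Fourier transform of [f] modulo q is g times [f] itself, as it is for a
    primitive real character with Gauss sum g. *)
Definition separates (q : nat) (f : Z -> R) (g : C) :=
  forall M : Z, \csum_(a < q) (f a%:Z * e (M * a%:Z) q) = (f M * g)%C.

Lemma chi1 (p : nat) : prime p -> chi p 1 = 1.
Proof.
move=> pp; apply: (chi_sqr (z := 1)) => -[k hk].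
have h : (p%:Z <= 1)%Z by apply: Z.divide_pos_le => //; exists k.
by have := prime_gt1 pp; lia.
Qed.

(** For M prime to p the substitution a -> M a takes chi(M) out of the sum.  The
    modulus comes from expanding g times its conjugate and summing over the
    variable in which only additive characters occur. *)
Lemma chi_gauss (p : nat) : prime p -> (2 < p)%N ->
  exists g : C, Cmod g = sqrt (INR p) /\ separates p (chi p) g.
Proof.
move=> pp p2; have p0 := prime_gt0 pp.
pose g := \csum_(a < p) (chi p a%:Z * e a%:Z p).
have chi0 : chi p 0 = 0.
  by case: (chi_values p 0) => -[] // _ []; exists 0%Z.
have sep : separates p (chi p) g.
  move=> M; have [[t ht]|ndM] := excluded_middle_informative (Z.divide p%:Z M).
    rewrite (chi_periodic (w := 0%Z)) ?chi0; last by exists t; lia.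
    rewrite Cmult_0_l -[RHS](csum_chi pp p2); apply: eq_bigr => a _.
    have -> : (M * (a : nat)%:Z = t * a%:Z * p%:Z)%Z by rewrite ht; ring.
    by rewrite e_mult ?Cmult_1_r //; lia.
  have -> : g = \csum_(a < p) (chi p (M * a%:Z) * e (M * a%:Z) p).
    apply/esym; apply: (csum_perm (f := fun z => (chi p z * e z p)%C)
      (h := fun a : nat => (M * a%:Z)%Z)).
      by apply: periodicM; [exact: chiC_periodic | move=> z w h; have := e_periodic 1 p0 h; rewrite !Z.mul_1_l].
    by move=> a b; apply: cancel_mod_prime.
  rewrite big_distrr /=; apply: eq_bigr => a _.
  rewrite Cmult_assoc -RtoC_mult chi_mul //; congr (RtoC _ * _)%C.
  by case: (chi_values p M) => -[-> d] //; lra.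
exists g; split=> //.
have gg : (g * Cconj g = INR p)%C.
  have -> : Cconj g = \csum_(b < p) (chi p b%:Z * e (- b%:Z) p).
    rewrite /g; elim/big_rec2: _ => [|b x y _ <-].
      by rewrite /Cconj /= Ropp_0.
    rewrite Cplus_conj Cmult_conj e_opp; congr (_ * _ + _)%C.
    by rewrite /Cconj /= Ropp_0.
  have -> : (g * \csum_(b < p) (chi p b%:Z * e (- b%:Z) p))%C =
    \csum_(b < p) \csum_(a < p) (chi p a%:Z * e ((a%:Z - 1) * b%:Z) p).
    rewrite big_distrr /=; apply: eq_bigr => b _.
    rewrite Cmult_comm -Cmult_assoc [(e _ _ * _)%C]Cmult_comm Cmult_assoc -sep.
    rewrite big_distrl /=; apply: eq_bigr => a _.
    rewrite -Cmult_assoc -e_add; congr (_ * e _ _)%C; ring.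
  rewrite exchange_big /=.
  have p1 : (1 < p)%N by apply: prime_gt1.
  have inner (a : 'I_p) : \csum_(b < p) (chi p a%:Z * e ((a%:Z - 1) * b%:Z) p) =
      if a == Ordinal p1 then RtoC (INR p) else RtoC 0.
    rewrite [LHS](csum_mull _ _ (fun b => e ((a%:Z - 1) * b%:Z) p)) csum_e //.
    case: (eqVneq a (Ordinal p1)) => [ha|/eqP ha].
      have a1 : (a : nat) = 1%N by rewrite ha.
      rewrite a1; case: excluded_middle_informative => [d0|[]]; last by exists 0%Z.
      have -> : chi p 1%:Z = 1 by exact: chi1.
      by rewrite Cmult_1_l.
    case: excluded_middle_informative => [[k hk]|nd] /=; last by rewrite Cmult_0_r.
    case: ha; apply: val_inj => /=.
    apply: (cancel_mod (q := p) (m := 1) (coprimen1 p)) => //.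
    by exists k; lia.
  rewrite (eq_bigr _ (fun a _ => inner a)) -big_mkcond.
  by rewrite big_pred1_eq.
apply: Rsqr_inj; [exact: Cmod_ge_0 | exact: sqrt_pos |].
rewrite Rsqr_sqrt; last exact: pos_INR.
apply: RtoC_inj; rewrite -gg -Cmod2_conj; congr RtoC; rewrite /Rsqr /=; ring.
Qed.

Lemma chiE_periodic (E : seq nat) : periodic (prodl E) (fun z => RtoC (chiE E z)).
Proof.
elim: E => [|p E IH] z w //= [k hk].
rewrite !RtoC_mult (IH z w); last by exists (k * p%:Z)%Z; move: hk; rewrite Nat2Z.inj_mul; nia.
by congr (RtoC _ * _)%C; apply: chi_periodic; exists (k * (prodl E)%:Z)%Z; move: hk; rewrite Nat2Z.inj_mul; nia.
Qed.

Lemma chiE_mul (E : seq nat) (z w : Z) : odd_primes E -> chiE E (z * w) = chiE E z * chiE E w.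
Proof.
case/andP=> _; elim: E => [|p E IH] /=; first by rewrite Rmult_1_l.
case/andP=> /andP[pp p2] /IH ->; rewrite chi_mul //; ring.
Qed.

Lemma odd_primes_cons (p : nat) (E : seq nat) : odd_primes (p :: E) ->
  [/\ prime p, (2 < p)%N, coprime p (prodl E) & odd_primes E].
Proof.
case/andP=> /= /andP[pE uE] /andP[/andP[pp p2] aE]; split=> //; last exact/andP.
elim: E pE aE {uE} => [|r E IH] /=; first by rewrite coprimen1.
rewrite inE negb_or => /andP[pr pE] /andP[/andP[rp r2] aE].
rewrite coprimeMr IH // andbT prime_coprime //.
by rewrite dvdn_prime2.
Qed.

Lemma prodl_gt0 (E : seq nat) : odd_primes E -> (0 < prodl E)%N.
Proof.
elim: E => //= p E IH /odd_primes_cons[pp _ _ /IH h].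
by rewrite muln_gt0 (prime_gt0 pp) h.
Qed.

Lemma chi_abs (p : nat) (z : Z) : Rabs (chi p z) <= 1.
Proof.
by case: (chi_values p z) => -[-> _]; split_Rabs; lra.
Qed.

Lemma chi_unit (p : nat) (z : Z) : ~ Z.divide p%:Z z -> Rabs (chi p z) = 1.
Proof.
by case: (chi_values p z) => -[-> d] nd //; split_Rabs; lra.
Qed.

Lemma chiE_abs (E : seq nat) (z : Z) : Rabs (chiE E z) <= 1.
Proof.
elim: E => [|p E IH] /=; first by rewrite Rabs_R1; lra.
rewrite Rabs_mult; have := chi_abs p z; have := Rabs_pos (chi p z); nra.
Qed.

(** By the Chinese remainder theorem the Gauss sum of a product is, up to sign,
    the product of the Gauss sums. *)
Lemma chiE_gauss (E : seq nat) : odd_primes E ->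
  exists g : C, Cmod g = sqrt (INR (prodl E)) /\ separates (prodl E) (chiE E) g.
Proof.
elim: E => [|p E IH] /= oE.
  exists (RtoC 1); split; first by rewrite sqrt_1 Cmod_1.
  move=> M; rewrite big_ord_recl big_ord0 /= Cplus_0_r; congr Cmult.
  rewrite -[RHS](e_mult 1 0) //; congr e; lia.
case/odd_primes_cons: (oE) => pp p2 cop oE'.
have [g1 [mg1 s1]] := chi_gauss pp p2.
have [g2 [mg2 s2]] := IH oE'.
set q := prodl E in cop s2 mg2 *.
have q0 : (0 < q)%N by apply: prodl_gt0.
have p0 := prime_gt0 pp.
exists (chi p q%:Z * chiE E p%:Z * (g1 * g2))%C; split.
  rewrite !Cmod_mult mg1 mg2 mult_INR sqrt_mult; try exact: pos_INR.
  rewrite !Cmod_R chi_unit; last by move/dvd_natP; apply/negP; rewrite -prime_coprime.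
  have -> : Rabs (chiE E p%:Z) = 1; last by ring.
  move: oE; clear -pp.
  case/andP=> /= /andP[pE _] /andP[_]; elim: E pE => [|r E IH] /=; first by rewrite Rabs_R1.
  rewrite inE negb_or => /andP[pr pE] /andP[/andP[rp r2] aE].
  rewrite Rabs_mult IH // chi_unit ?Rmult_1_r // => /dvd_natP.
  by rewrite dvdn_prime2 // eq_sym (negbTE pr).
move=> M.
rewrite [LHS](csum_crt (f := fun c => (RtoC (chiE (p :: E) c) * e (M * c) (p * q))%C)) //; last first.
  apply: periodicM; last by apply: e_periodic; rewrite muln_gt0 p0.
  exact: (@chiE_periodic (p :: E)).
transitivity (\csum_(a < p) \csum_(b < q) (chi p q%:Z * chiE E p%:Z *
   ((chi p a%:Z * e (M * a%:Z) p) * (chiE E b%:Z * e (M * b%:Z) q)))).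
  apply: eq_bigr => a _; apply: eq_bigr => b _.
  rewrite /= RtoC_mult.
  have -> : chi p (a%:Z * q%:Z + b%:Z * p%:Z) = chi p a%:Z * chi p q%:Z.
    rewrite -chi_mul //; apply: chi_periodic; exists (b%:Z); lia.
  have -> : chiE E (a%:Z * q%:Z + b%:Z * p%:Z) = chiE E b%:Z * chiE E p%:Z.
    rewrite -chiE_mul //; apply: RtoC_inj; apply: (chiE_periodic (E := E)); exists (a%:Z); rewrite -/q; lia.
  have -> : e (M * (a%:Z * q%:Z + b%:Z * p%:Z)) (p * q) = (e (M * a%:Z) p * e (M * b%:Z) q)%C.
    rewrite /e -cis_add; congr cis; rewrite !mult_IZR plus_IZR !mult_IZR mult_INR -!INR_IZR_INZ.
    field; split; apply: not_0_INR; lia.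
  rewrite !RtoC_mult; ring.
transitivity (\csum_(a < p) (chi p a%:Z * e (M * a%:Z) p *
    (chi p q%:Z * chiE E p%:Z * (chiE E M * g2)))).
  apply: eq_bigr => a _; rewrite -s2.
  rewrite [LHS](csum_mull _ _ (fun b => chi p a%:Z * e (M * a%:Z) p * (chiE E b%:Z * e (M * b%:Z) q))%C).
  rewrite [X in (_ * X = _)%C](csum_mull _ _ (fun b => (chiE E b%:Z * e (M * b%:Z) q)%C)); ring.
rewrite [LHS](csum_mulr _ _ (fun a => (chi p a%:Z * e (M * a%:Z) p)%C)) s1 /= !RtoC_mult; ring.
Qed.
End GaussSums.

(** * Lower bounds for the number of primes *)

Section Chebyshev.
Import all_boot zify SumNotations.
#[local] Set Implicit Arguments.
#[local] Unset Strict Implicit.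
Local Open Scope nat_scope.

Definition primes_upto (n : nat) : seq nat := [seq p <- iota 0 n.+1 | prime p].

Lemma bin_central_ge (n : nat) : 2 ^ n <= 'C(2 * n, n).
Proof.
elim: n => [|n IH]; first by rewrite bin0.
have -> : 2 * n.+1 = (2 * n).+2 by lia.
have h : 'C((2 * n).+1, n.+1) = 'C((2 * n).+1, n).
  rewrite -bin_sub; last lia.
  congr 'C(_, _); lia.
rewrite binS h addnn expnS -mul2n leq_mul2l /=.
apply: (leq_trans IH); case: n {IH h} => [|n]; first by rewrite !bin0.
rewrite [X in _ <= X]binS; exact: leq_addr.
Qed.

(** By the formula for the valuation of a factorial, each power p^k up to 2n
    contributes at most 1 to the valuation of the central binomial coefficient,
    because floor(2x) - 2 floor(x) <= 1. *)
Lemma pow_logn_bin_le (p n : nat) : prime p -> 0 < n ->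
  p ^ logn p 'C(2 * n, n) <= 2 * n.
Proof.
move=> pp n0; have p1 := prime_gt1 pp.
suff h : logn p 'C(2 * n, n) <= trunc_log p (2 * n).
  apply: (leq_trans (leq_pexp2l (prime_gt0 pp) h)).
  by apply: trunc_logP => //; lia.
have hb : 'C(2 * n, n) * (n`! * n`!) = (2 * n)`!.
  rewrite -(@bin_fact (2 * n) n); last lia.
  by congr (_ * (_ * _`!)); lia.
have b0 : 0 < 'C(2 * n, n) by rewrite bin_gt0; lia.
have := congr1 (logn p) hb.
rewrite !lognM ?muln_gt0 ?fact_gt0 // !logn_fact //.
have -> : \sum_(1 <= k < n.+1) n %/ p ^ k = \sum_(1 <= k < (2 * n).+1) n %/ p ^ k.
  rewrite [RHS](@big_cat_nat _ _ _ n.+1) //=; last lia.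
  rewrite [X in _ = _ + X]big_nat_cond [X in _ = _ + X]big1 ?addn0 // => k /andP[/andP[h1 h2] _].
  apply: divn_small; apply: (@leq_ltn_trans k); first lia.
  exact: ltn_expl.
rewrite -big_split /= => h.
have h2 : \sum_(1 <= k < (2 * n).+1) (2 * n) %/ p ^ k <=
    \sum_(1 <= k < (2 * n).+1) ((n %/ p ^ k + n %/ p ^ k) + (k <= trunc_log p (2 * n))).
  apply: leq_sum => k _.
  have pk : 0 < p ^ k by rewrite expn_gt0 prime_gt0.
  case: (leqP k (trunc_log p (2 * n))) => hk.
    have h1 := divn_eq n (p ^ k); have h2 := ltn_pmod n pk.
    rewrite -ltnS ltn_divLR //; nia.
  rewrite divn_small //.
  by apply: (leq_trans (trunc_log_ltn _ p1)); rewrite leq_exp2l.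
rewrite big_split /= -h in h2.
rewrite addnC leq_add2l in h2; apply: (leq_trans h2).
move: (trunc_log p (2 * n)) => t.
elim: (2 * n) => [|m IH]; first by rewrite big_geq.
rewrite big_nat_recr //=.
case: (leqP m.+1 t) => hm /=; last by rewrite addn0.
have : \sum_(1 <= k < m.+1) (k <= t) <= \sum_(1 <= k < m.+1) 1 by apply: leq_sum => k _; exact: leq_b1.
rewrite sum_nat_const_nat; lia.
Qed.

(** The central binomial coefficient is at least 2^n, and it is a product over the
    primes up to 2n of prime powers that are at most 2n. *)
Lemma chebyshev (n : nat) : 0 < n -> 2 ^ n <= (2 * n) ^ size (primes_upto (2 * n)).
Proof.
move=> n0; apply: (leq_trans (bin_central_ge n)).
set c := 'C(2 * n, n).
have c0 : 0 < c by rewrite bin_gt0; lia.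
rewrite -[X in X <= _](partnT c0) (@widen_partn (maxn c (2 * n))) ?leq_maxl //.
rewrite (@big_cat_nat _ _ _ (2 * n).+1) //=; last by rewrite ltnS leq_maxr.
rewrite [X in _ * X]big_nat_cond [X in _ * X]big1 ?muln1; last first.
  move=> p /andP[/andP[h1 _] _].
  case: (boolP (prime p)) => [pp|np]; last by rewrite lognE (negbTE np).
  have := pow_logn_bin_le pp n0; rewrite -/c.
  case: (logn p c) => [|k] //; rewrite expnS => h.
  have : 0 < p ^ k by rewrite expn_gt0 prime_gt0.
  nia.
rewrite /primes_upto size_filter -sum1_count expn_sum.
rewrite /index_iota subn0 [X in X <= _](bigID prime) /=.
rewrite [X in _ * X]big1 ?muln1; last first.
  by move=> p np; rewrite lognE (negbTE np).
elim/big_ind2: _ => // [a b a' b' h h'|p pp]; first exact: leq_mul.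
by rewrite expn1; apply: pow_logn_bin_le.
Qed.

Local Open Scope R_scope.

Lemma pow2_le_size_primes (j : nat) : (0 < j)%N ->
  (2 ^ j <= 2 * j * size (primes_upto (2 ^ j)))%N.
Proof.
case: j => // j _.
have := chebyshev (n := 2 ^ j); rewrite expn_gt0 /= -expnS => /(_ isT).
rewrite -expnM leq_exp2l // => h.
by rewrite [X in (X <= _)%N]expnS -mulnA leq_mul2l /=.
Qed.

Lemma primes_upto_cat (m n : nat) : (m <= n)%N ->
  primes_upto n = primes_upto m ++ [seq p <- iota m.+1 (n - m) | prime p].
Proof.
move=> mn; rewrite /primes_upto -filter_cat -[X in iota X (n - m)]add0n -iotaD.
by congr (filter _ (iota _ _)); lia.
Qed.

(** Partial summation over dyadic blocks: by [pow2_le_size_primes] the j-th block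
    contributes about 1/(4j), and these numbers sum to about ln j / 4.  The first
    term is the boundary term that makes the induction work. *)
Lemma sum_inv_primes_ge (j : nat) : (0 < j)%N ->
  INR (size (primes_upto (2 ^ j))) / 2 ^ j + ln (INR j) / 4 <=
  \rsum_(p <- primes_upto (2 ^ j)) / INR p.
Proof.
case: j => // j _; elim: j => [|j IH].
  have -> : primes_upto (2 ^ 1) = [:: 2%N] by [].
  rewrite big_cons big_nil ln_1 /=; lra.
rewrite (primes_upto_cat (m := 2 ^ j.+1)); last by rewrite leq_exp2l.
set s := filter _ _.
rewrite big_cat [X in _ <= X]/= size_cat plus_INR.
set S := \big[Rplus/0]_(p <- primes_upto (2 ^ j.+1)) / INR p in IH *.
set a := INR (size (primes_upto _)) in IH *.
have h1 : / 2 ^ j.+2 * INR (size s) <= \rsum_(p <- s) / INR p.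
  apply: rsum_ge_const => p; rewrite mem_filter mem_iota => /andP[pp /andP[p1 p2]].
  apply: Rinv_le_contravar; first by apply: lt_0_INR; have := prime_gt0 pp; lia.
  have -> : (2 ^ j.+2 = INR (2 ^ j.+2)%N) by rewrite INR_expn.
  by apply: le_INR; move: p2; rewrite addSn subnKC ?leq_exp2l //; lia.
have h2 : / (4 * INR j.+1) <= a / 2 ^ j.+2.
  have := pow2_le_size_primes (ltn0Sn j) => /leP /le_INR.
  rewrite !mult_INR -/a.
  have -> : (INR (2 ^ j.+1)%N = 2 ^ j.+1) by rewrite INR_expn.
  have p0 : 0 < 2 ^ j.+1 by apply: pow_lt; lra.
  have j0 : 0 < INR j.+1 by apply: lt_0_INR; lia.
  rewrite -[(2 ^ j.+2)]/(2 * 2 ^ j.+1) => h.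
  apply: (Rmult_le_reg_r (2 * (2 ^ j.+1) * (2 * INR j.+1))); first nra.
  have -> : / (4 * INR j.+1) * (2 * 2 ^ j.+1 * (2 * INR j.+1)) = 2 ^ j.+1 by field; lra.
  have -> : a / (2 * 2 ^ j.+1) * (2 * 2 ^ j.+1 * (2 * INR j.+1)) = 2 * INR j.+1 * a by field; lra.
  exact: h.
have h3 : ln (INR j.+2) - ln (INR j.+1) <= / INR j.+1.
  have j0 : 0 < INR j.+1 by apply: lt_0_INR; lia.
  rewrite -ln_div //; last by apply: lt_0_INR; lia.
  have -> : INR j.+2 / INR j.+1 = 1 + / INR j.+1 by rewrite (S_INR j.+1); field; lra.
  have i0 : 0 < / INR j.+1 by apply: Rinv_0_lt_compat.
  rewrite -[X in _ <= X]ln_exp; apply: ln_le; first lra.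
  by apply/Rlt_le/exp_ineq1; lra.
have h4 : / (4 * INR j.+1) = / INR j.+1 / 4.
  by field; apply: not_0_INR.
have h5 : (a + INR (size s)) / 2 ^ j.+2 = a / 2 ^ j.+2 + / 2 ^ j.+2 * INR (size s).
  by rewrite /Rdiv; ring.
have h6 : a / 2 ^ j.+1 = a / 2 ^ j.+2 + a / 2 ^ j.+2.
  have p0 : 0 < 2 ^ j.+1 by apply: pow_lt; lra.
  rewrite -[(2 ^ j.+2)]/(2 * 2 ^ j.+1); field; lra.
lra.
Qed.

Lemma sum_inv_primes_unbounded (B : nat) (T : R) :
  exists n : nat, T <= \rsum_(p <- [seq p <- primes_upto n | (B < p)%N]) / INR p.
Proof.
have [j hj] := INR_unbounded (exp (4 * (T + INR B.+1))).
have j0 : (0 < j)%N.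
  case: (posnP j) => // j0; exfalso; move: hj; rewrite j0 /=.
  have := exp_pos (4 * (T + INR B.+1)); rewrite /=; lra.
exists (2 ^ j)%N.
have h1 := sum_inv_primes_ge j0.
have h2 : 4 * (T + INR B.+1) <= ln (INR j).
  by rewrite -[X in X <= _]ln_exp; apply: ln_le; [exact: exp_pos | lra].
have h3 : 0 <= INR (size (primes_upto (2 ^ j))) / 2 ^ j.
  apply: Rmult_le_pos; first exact: pos_INR.
  by apply/Rlt_le/Rinv_0_lt_compat/pow_lt; lra.
have h4 : \rsum_(p <- primes_upto (2 ^ j)) / INR p =
   \rsum_(p <- [seq p <- primes_upto (2 ^ j) | (B < p)%N]) / INR p +
   \rsum_(p <- [seq p <- primes_upto (2 ^ j) | ~~ (B < p)%N]) / INR p.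
  by rewrite [LHS](bigID (fun p => (B < p)%N)) /= [X in _ = X + _]big_filter [X in _ = _ + X]big_filter.
have h5 : \rsum_(p <- [seq p <- primes_upto (2 ^ j) | ~~ (B < p)%N]) / INR p <= 1 * INR B.+1.
  apply: Rle_trans (rsum_le_const (c := 1) _) _.
    move=> p; rewrite !mem_filter => /and3P[_ pp _].
    rewrite -Rinv_1; apply: Rinv_le_contravar; first lra.
    by rewrite -[1]/(INR 1); apply: le_INR; have := prime_gt0 pp; lia.
  apply: Rmult_le_compat_l; first lra.
  apply: le_INR; apply/leP; rewrite -[X in (_ <= X)%N](size_iota 0).
  apply: uniq_leq_size; first by rewrite !filter_uniq ?iota_uniq.
  by move=> p; rewrite mem_filter => /andP[h _]; rewrite mem_iota; lia.
lra.
Qed.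
End Chebyshev.

(** * A non-square is a non-residue modulo arbitrarily large primes *)

Section Nonresidues.
Import all_boot zify SumNotations.
#[local] Set Implicit Arguments.
#[local] Unset Strict Implicit.

HB.instance Definition _ :=
  hasDecEq.Build Z (fun x y => Bool.iff_reflect _ _ (iff_sym (Z.eqb_eq x y))).

Definition int_range (k : nat) : seq Z := [seq (i%:Z - k%:Z)%Z | i <- iota 0 (2 * k + 1)].

Lemma mem_int_range (k : nat) (z : Z) : (Z.abs z <= k%:Z)%Z -> z \in int_range k.
Proof.
move=> h; apply/mapP; exists (Z.to_nat (z + k%:Z)); last by lia.
by rewrite mem_iota; lia.
Qed.

Lemma coprime_inverse (p m : nat) (z : Z) : prime p -> coprime p m ->
  exists t : Z, Z.divide p%:Z (m%:Z * t - z).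
Proof.
move=> pp cop.
have m0 : (0 < m)%N.
  by case: m cop => //; rewrite /coprime gcdn0 => /eqP p1; rewrite p1 in pp.
case: (egcdnP p m0) => km kn h _.
have g1 : gcdn m p = 1%N by rewrite gcdnC; apply/eqP.
exists (km%:Z * z)%Z; exists (kn%:Z * z)%Z.
have h' : (km%:Z * m%:Z = kn%:Z * p%:Z + 1)%Z by rewrite g1 in h; lia.
have -> : (m%:Z * (km%:Z * z) - z = (km%:Z * m%:Z - 1) * z)%Z by ring.
rewrite h'; ring.
Qed.

(** The Chinese remainder theorem for finitely many primes. *)
Lemma crt_primes (E : seq nat) (rho : nat -> Z) : uniq E -> all prime E ->
  exists a : Z, forall p : nat, p \in E -> Z.divide p%:Z (a - rho p).
Proof.
elim: E => [|p E IH] /=; first by exists 0%Z.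
case/andP=> pE uE /andP[pp aE]; have [a ha] := IH uE aE.
have cop : coprime p (prodl E).
  elim: E pE aE {IH uE ha} => [|r E IH] /=; first by rewrite coprimen1.
  rewrite inE negb_or => /andP[pr pE] /andP[rp aE].
  by rewrite coprimeMr IH // andbT prime_coprime // dvdn_prime2.
have [t ht] := coprime_inverse (rho p - a) pp cop.
exists (a + (prodl E)%:Z * t)%Z => r; rewrite inE => /orP[/eqP ->|rE].
  by case: ht => k hk; exists k; lia.
have [k hk] := ha r rE.
have /dvdnP[m hm] : (r %| prodl E)%N.
  elim: E rE {IH uE ha aE pE cop ht} => //= s E IH; rewrite inE => /orP[/eqP ->|/IH h].
    exact: dvdn_mulr.
  exact: dvdn_mull.
by exists (k + m%:Z * t)%Z; rewrite hm; nia.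
Qed.

(** Boolean form of square-freeness, tested on prime squares only. *)
Definition sqf (n : nat) : bool := all (fun p => ~~ (p * p %| n)%N) (primes n).

Lemma sqf_dvd (n : nat) (z : Z) : (0 < n)%N -> sqf n ->
  (forall p, prime p -> (p %| n)%N -> Z.divide p%:Z z) -> Z.divide n%:Z z.
Proof.
move=> n0 sn h; apply/Z.divide_abs_r.
rewrite -Zabs2Nat.id_abs; apply/dvd_natP/dvdn_partP => // p.
rewrite mem_primes => /and3P[pp _ pn].
have l1 : logn p n = 1%N.
  have := allP sn p; rewrite mem_primes pp n0 pn => /(_ isT).
  have : (0 < logn p n)%N by rewrite logn_gt0 mem_primes pp n0 pn.
  case: (logn p n) (pfactor_dvdn 2 pp n0) => [|[|k]] //=.
  by rewrite expnS expn1 => ->.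
rewrite p_part l1 expn1; apply/dvd_natP; rewrite Zabs2Nat.id_abs.
by apply/Z.divide_abs_r; apply: h.
Qed.

(** The pigeonhole principle applied to the (s+1)^2 > n pairs (x, y) and the
    residues of x - a y. *)
Lemma thue (n s : nat) (a : Z) : (0 < n)%N -> (n < s.+1 * s.+1)%N ->
  exists x y : Z, [/\ (Z.abs x <= s%:Z)%Z, (Z.abs y <= s%:Z)%Z,
     x <> 0%Z \/ y <> 0%Z & Z.divide n%:Z (x - a * y)].
Proof.
case: n => // n _ hn.
have ex (u : 'I_s.+1 * 'I_s.+1) : exists c : 'I_n.+1,
    Z.divide (n.+1)%:Z ((u.1 : nat)%:Z - a * (u.2 : nat)%:Z - (c : nat)%:Z).
  have [b bn hb] := Z_residue ((u.1 : nat)%:Z - a * (u.2 : nat)%:Z) (ltn0Sn n).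
  by exists (Ordinal bn).
have [f fP] := functional_choice ex.
have : ~~ injectiveb f.
  apply/negP => /injectiveP /leq_card; rewrite card_prod !card_ord leqNgt => /negP; exact.
case/injectivePn => -[x y] [[x' y']] ne fe.
exists (x%:Z - x'%:Z)%Z, (y%:Z - y'%:Z)%Z; split.
- have := ltn_ord x; have := ltn_ord x'; lia.
- have := ltn_ord y; have := ltn_ord y'; lia.
- have [e1|] := eqVneq x x'; last by move/eqP => e1; left => e2; apply: e1; apply: val_inj => /=; lia.
  have [e2|] := eqVneq y y'; last by move/eqP => e2; right => e3; apply: e2; apply: val_inj => /=; lia.
  by rewrite e1 e2 eqxx in ne.
have [k hk] := fP (x, y); have [k' hk'] := fP (x', y'); rewrite fe in hk.
by exists (k - k')%Z; rewrite /= in hk hk' *; lia.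
Qed.

Lemma count_progression (P q T : nat) : (0 < q)%N -> coprime q P ->
  (count (fun t => q %| 1 + P * t) (iota 0 T) <= T %/ q + 1)%N.
Proof.
move=> q0 cop; rewrite -size_filter addn1.
rewrite -(size_map (fun t => t %/ q)%N) -[X in (_ <= X)%N](size_iota 0).
apply: uniq_leq_size.
  rewrite map_inj_in_uniq ?filter_uniq ?iota_uniq // => t t'.
  rewrite !mem_filter => /andP[h _] /andP[h' _] e.
  suff : t %% q = t' %% q by move=> e2; rewrite (divn_eq t q) (divn_eq t' q) e e2.
  wlog tt' : t t' h h' {e} / (t' <= t)%N.
    by move=> wl; case/orP: (leq_total t t') => /wl; [move=> <- | apply].
  apply/eqP; rewrite eqn_mod_dvd //.
  have : (q %| P * (t - t'))%N.
    by rewrite mulnBr -(subnDl 1) dvdn_sub.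
  by rewrite Gauss_dvdr.
move=> k /mapP[t]; rewrite mem_filter mem_iota => /andP[_ ht] ->.
by rewrite mem_iota /= ltnS leq_div2r //; lia.
Qed.

(** A union bound. *)
Lemma count_has_le (T S : eqType) (l : seq T) (s : seq S) (a : S -> pred T) :
  (count (fun t => has (fun p => a p t) s) l <= \sum_(p <- s) count (a p) l)%N.
Proof.
elim: s => [|p s IH] /=; first by rewrite big_nil count_pred0.
rewrite big_cons; apply: leq_trans (leq_add (leqnn _) IH).
rewrite -count_predUI; exact: leq_addr.
Qed.

Lemma sum_inv_sqr_le (B k : nat) : (0 < B)%N ->
  \rsum_(p <- iota B.+1 k) / (INR p * INR p) <= / INR B - / INR (B + k).
Proof.
move=> B0; elim: k => [|k IH]; first by rewrite big_nil addn0; lra.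
have -> : iota B.+1 k.+1 = iota B.+1 k ++ [:: (B + k).+1].
  by rewrite -[k.+1]addn1 iotaD /= addSn.
rewrite big_cat [X in X <= _]/= big_cons big_nil addnS.
set S := \rsum_(p <- _) _ in IH *.
have h1 : 0 < INR (B + k) by apply: lt_0_INR; lia.
have h2 : / (INR (B + k).+1 * INR (B + k).+1) <= / INR (B + k) - / INR (B + k).+1.
  rewrite S_INR; set x := INR (B + k) in h1 *.
  have -> : / x - / (x + 1) = / (x * (x + 1)) by field; lra.
  apply: Rinv_le_contravar; nra.
lra.
Qed.

(** A relation x^2 = D y^2 with y <> 0 makes D the square of x/y, which is then an integer. *)
Lemma not_square_neq (D x y : Z) : (forall m : Z, (m * m)%Z <> D) ->
  x <> 0%Z \/ y <> 0%Z -> (x * x - D * (y * y))%Z <> 0%Z.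
Proof.
move=> hD xy0 h.
have [y0|y0] := Z.eq_dec y 0; first by nia.
have hd : Z.divide y x.
  apply/Z.divide_abs_l/Z.divide_abs_r; rewrite -!Zabs2Nat.id_abs.
  apply/dvd_natP; rewrite -(dvdn_pexp2r _ _ (isT : 0 < 2)%N) -!mulnn; apply/dvd_natP.
  rewrite !Nat2Z.inj_mul !Zabs2Nat.id_abs -!Z.abs_mul.
  by apply/Z.divide_abs_l/Z.divide_abs_r; exists D; lia.
case: hd => k hk; apply: (hD k).
apply: (Z.mul_reg_r _ _ (y * y)); first nia.
by rewrite hk in h; lia.
Qed.

Lemma sqr_bound (x s n : Z) : (Z.abs x <= s)%Z -> (s * s <= n)%Z -> (x * x <= n)%Z.
Proof. nia. Qed.

Lemma form_bound (D x y m n : Z) : (0 < n)%Z -> (x * x <= n)%Z -> (y * y <= n)%Z ->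
  (x * x - D * (y * y) = m * n)%Z -> (Z.abs m <= Z.abs D + 1)%Z.
Proof.
move=> n0 xn yn h; apply: (Zmult_lt_0_le_reg_r _ _ n) => //.
have -> : (Z.abs m * n = Z.abs (x * x - D * (y * y)))%Z by rewrite h Z.abs_mul (Z.abs_eq n); lia.
have h1 : (Z.abs D * (y * y) <= Z.abs D * n)%Z by apply: Z.mul_le_mono_nonneg_l; lia.
have h2 : Z.abs (D * (y * y)) = (Z.abs D * (y * y))%Z by rewrite Z.abs_mul (Z.abs_eq (y * y)) //; nia.
have h3 : (0 <= x * x)%Z by nia.
lia.
Qed.

(** Suppose that D is not a square but that every prime p > B has a root
    [beta p] of X^2 = D.  Consider pairs (u, v) with u > B prime and v square-free,
    v = 1 modulo B!, u not dividing v.  Modulo n = u v there is a root a of D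
    with a = beta_p for p | v and a = - beta_u modulo u.  Thue's lemma gives
    x = a y modulo n with x, y of size sqrt n, so x^2 - D y^2 = m n with m
    bounded.  The triple (x, y, m) determines n and then, as a = x / y modulo n,
    the sign of a at each prime; hence it determines u and v.  So there are
    O(N^2) pairs with u v <= N^2.  On the other hand there are at least
    c N^2 sum (1/u) of them, up to O(N) for each u, and the sum of 1/u
    diverges. *)
Section AllResidues.
Variables (D : Z) (B : nat) (beta : nat -> Z).
Hypothesis D_nonsquare : forall m : Z, (m * m)%Z <> D.
Hypothesis B_ge : (3 < B)%N.
Hypothesis B_gtD : (Z.abs D + 1 < B%:Z)%Z.
Hypothesis beta_root : forall p : nat, prime p -> (B < p)%N ->
  Z.divide p%:Z (beta p * beta p - D).

Let rough (n : nat) := forall p : nat, prime p -> (p %| n)%N -> (B < p)%N.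

(** The triple (x, y, m) that is attached to the pair (u, v).  Since y is prime to
    u v, the root a can be recovered from it. *)
Let rep (u v : nat) (x y m : Z) :=
  exists a : Z,
  [/\ forall p : nat, prime p -> (p %| v)%N -> Z.divide p%:Z (a - beta p),
      Z.divide u%:Z (a + beta u),
      Z.divide (u * v)%:Z (x - a * y),
      forall p : nat, prime p -> (p %| u * v)%N -> ~ Z.divide p%:Z y &
      (x * x - D * (y * y) = m * (u * v)%:Z)%Z /\ m <> 0%Z].

Let dvd_small (p : nat) (z : Z) : Z.divide p%:Z z -> (Z.abs z < p%:Z)%Z -> z = 0%Z.
Proof. by case=> k -> h; case: (Z.eq_dec k 0) => [->|k0] //; nia. Qed.

Let dvd_mulP (p : nat) (z w : Z) : prime p ->
  Z.divide p%:Z (z * w) -> Z.divide p%:Z z \/ Z.divide p%:Z w.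
Proof.
move=> pp /Z.divide_abs_r; rewrite Z.abs_mul -!Zabs2Nat.id_abs -Nat2Z.inj_mul.
move/dvd_natP; rewrite Euclid_dvdM // => /orP[] /dvd_natP h; [left|right].
  by move: h; rewrite Zabs2Nat.id_abs => /Z.divide_abs_r.
by move: h; rewrite Zabs2Nat.id_abs => /Z.divide_abs_r.
Qed.

Let rep_exists (u v S : nat) : prime u -> (B < u)%N -> (0 < v)%N -> sqf v ->
  rough v -> ~~ (u %| v)%N -> (u * v <= S * S)%N ->
  exists x y m : Z, [/\ (Z.abs x <= S%:Z)%Z, (Z.abs y <= S%:Z)%Z,
    (Z.abs m <= Z.abs D + 1)%Z & rep u v x y m].
Proof.
move=> pu Bu v0 sv rv nuv uvS; set n := (u * v)%N.
have n0 : (0 < n)%N by rewrite muln_gt0 v0 prime_gt0.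
have sn : sqf n.
  apply/allP => p; rewrite mem_primes => /and3P[pp _ pn].
  apply/negP => ppn; move: ppn.
  have [e|pu'] := eqVneq p u.
    rewrite e dvdn_pmul2l ?prime_gt0 //; exact/negP.
  have cop : coprime p u by rewrite prime_coprime // dvdn_prime2.
  rewrite Gauss_dvdr; last by rewrite coprimeMl cop.
  apply/negP; apply: (allP sv); rewrite mem_primes pp v0 /=.
  by move: pn; rewrite Gauss_dvdr.
have rn : rough n.
  move=> p pp; rewrite Euclid_dvdM // => /orP[|]; last exact: rv.
  by rewrite dvdn_prime2 // => /eqP ->.
have uE : uniq (u :: primes v).
  by rewrite /= primes_uniq andbT mem_primes !negb_and nuv !orbT.
have aE : all prime (u :: primes v).
  by rewrite /= pu; apply/allP => p; rewrite mem_primes => /andP[].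
have [a ha'] := crt_primes (fun p => if p == u then (- beta u)%Z else beta p) uE aE.
have hv (p : nat) : prime p -> (p %| v)%N -> Z.divide p%:Z (a - beta p).
  move=> pp pv; have := ha' p; rewrite inE mem_primes pp v0 pv orbT => /(_ isT).
  by case: eqP => // e; rewrite -e pv in nuv.
have hu : Z.divide u%:Z (a + beta u).
  by have := ha' u; rewrite inE eqxx /= => /(_ isT); rewrite Z.sub_opp_r.
have hn : Z.divide n%:Z (a * a - D).
  apply: sqf_dvd => // p pp pn.
  (* Both beta_p and - beta_p are roots of D, so a is a root modulo each prime. *)
  have [k hk] := beta_root pp (rn p pp pn).
  case: (eqVneq p u) => [e|pu'].
    case: hu => l hl; rewrite -e in hl *.
    exists (l * (a - beta p) + k)%Z; lia.
  have [|l hl] := hv p pp.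
    by move: pn; rewrite Euclid_dvdM // dvdn_prime2 // (negbTE pu').
  exists (l * (a + beta p) + k)%Z; lia.
pose s := Nat.sqrt n.
have [s1 s2] := Nat.sqrt_spec n (Nat.le_0_l n).
rewrite -/s in s1 s2.
have sS : (s <= S)%N.
  rewrite -leq_sqr -!mulnn; apply: leq_trans uvS; exact/leP.
have [x [y [hx hy xy0 hxy]]] := @thue n s a n0 (introT ltP s2).
have [m hm] : Z.divide n%:Z (x * x - D * (y * y)).
  case: hxy => k hk; case: hn => l hl.
  exists (k * (x + a * y) + l * (y * y))%Z.
  have -> : x = (a * y + k * n%:Z)%Z by lia.
  have -> : D = (a * a - l * n%:Z)%Z by lia.
  ring.
have m0 : m <> 0%Z.
  by move=> e; apply: (not_square_neq D_nonsquare xy0); rewrite hm e.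
have mle : (Z.abs m <= Z.abs D + 1)%Z.
  apply: (form_bound (n := n%:Z) (x := x) (y := y)) => //; first lia.
    by apply: (sqr_bound hx); lia.
  by apply: (sqr_bound hy); lia.
exists x, y, m; split; [lia | lia | exact: mle |].
exists a; split=> //.
(* A common prime p of y and n divides x, so p^2 divides m n; but p does not
   divide m, which is smaller than p, and n is square-free. *)
move=> p pp pn [k hk].
have [l hl] : Z.divide p%:Z x.
  case: hxy => j hj; have /dvdnP[n' hn'] := pn.
  exists (j * n'%:Z + a * k)%Z.
  have hn2 : n%:Z = (n'%:Z * p%:Z)%Z by rewrite /n; move: hn'; clear; lia.
  have -> : x = (j * n%:Z + a * y)%Z by rewrite -hj; ring.
  by rewrite hk hn2; ring.
have /dvdnP[n' hn'] := pn.
have : Z.divide p%:Z (m * n'%:Z).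
  exists (l * l - D * (k * k))%Z.
  apply: (Z.mul_reg_r _ _ p%:Z); first by have := prime_gt0 pp; lia.
  have hn2 : n%:Z = (n'%:Z * p%:Z)%Z by rewrite /n; move: hn'; clear; lia.
  have -> : (m * n'%:Z * p%:Z = m * n%:Z)%Z by rewrite hn2; ring.
  by rewrite -hm hk hl; ring.
case/(dvd_mulP pp) => [pm|/dvd_natP pn'].
  by apply: m0; apply: dvd_small pm _; have := rn p pp pn; lia.
have psq : ~~ (p * p %| n)%N by apply: (allP sn); rewrite mem_primes pp n0.
case/negP: psq; have -> : n = (n' * p)%N by exact: hn'.
by rewrite dvdn_pmul2r ?prime_gt0.
Qed.

Let rep_inj (u v u' v' : nat) (x y m : Z) :
  prime u -> (B < u)%N -> prime u' -> (0 < v)%N -> (0 < v')%N ->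
  rep u v x y m -> rep u' v' x y m -> (u, v) = (u', v').
Proof.
move=> pu Bu pu' v0 v0' [a [_ hu hx hy [hm m0]]] [a' [hv' _ hx' _ [hm' _]]].
have en : (u * v = u' * v')%N.
  by apply: Nat2Z.inj; apply: (Z.mul_reg_l _ _ m) => //; rewrite -hm -hm'.
have [e|ne] := eqVneq u u'.
  by congr (_, _) => //; apply/eqP; rewrite -(eqn_pmul2l (prime_gt0 pu)) en e.
(* If u <> u', then u divides v', so a = - beta_u and a = beta_u modulo u, which
   forces u to divide 2 beta_u, hence D. *)
have uv' : (u %| v')%N.
  have : (u %| u' * v')%N by rewrite -en dvdn_mulr.
  by rewrite Euclid_dvdM // dvdn_prime2 // (negbTE ne).
have uD : Z.divide u%:Z ((a - a') * y).
  case: hx => k hk; case: hx' => k' hk'; rewrite -en in hk'.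
  exists ((k' - k) * v%:Z)%Z; rewrite !Nat2Z.inj_mul in hk hk'; lia.
case: (dvd_mulP pu uD) => [[k hk]|]; last by move/(hy u pu (dvdn_mulr _ (dvdnn u))).
case: hu => l hl; have [l' hl'] := hv' u pu uv'.
have : Z.divide u%:Z (2 * beta u) by exists (l - k - l')%Z; lia.
case/(dvd_mulP pu) => [h|[j hj]]; first by have := dvd_small h; lia.
have [i hi] := beta_root pu Bu.
have : Z.divide u%:Z D.
  exists (j * beta u - i)%Z.
  have -> : ((j * beta u - i) * u%:Z = (j * u%:Z) * beta u - i * u%:Z)%Z by ring.
  by rewrite -hj -hi; ring.
move/dvd_small => D0; case: (@D_nonsquare 0%Z); rewrite D0 //; lia.
Qed.

(** For v in [V N u] the product u v is at most N^2, and v is automatically free of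
    primes up to B. *)
Let P := B`!.
Let U (n : nat) := [seq p <- primes_upto n | (B < p)%N].
Let T (N u : nat) := (N * N %/ (u * P))%N.
Let V (N u : nat) :=
  [seq v <- [seq (1 + P * t)%N | t <- iota 0 (T N u)] | sqf v && ~~ (u %| v)%N].

Let P_gt0 : (0 < P)%N. Proof. exact: fact_gt0. Qed.

Let coprime_P (p : nat) : prime p -> (B < p)%N -> coprime p P.
Proof.
move=> pp Bp; rewrite prime_coprime //; apply/negP => h.
suff : (p <= B)%N by rewrite leqNgt Bp.
move: h; rewrite /P; elim: B => [|k IH].
  by rewrite fact0 dvdn1 => /eqP e; rewrite e in pp.
rewrite factS Euclid_dvdM // => /orP[/dvdn_leq -> //|/IH].
exact: leqW.
Qed.

Let UP (n u : nat) : u \in U n -> [/\ prime u, (B < u)%N & (u <= n)%N].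
Proof. by rewrite !mem_filter mem_iota ltnS => /and3P[-> -> /andP[_ ->]]. Qed.

Let V_rough (t : nat) : rough (1 + P * t).
Proof.
move=> p pp pd; rewrite ltnNge; apply/negP => pB.
move: pd; rewrite dvdn_addl; last by apply/dvdn_mulr/dvdn_fact; rewrite prime_gt0.
by rewrite dvdn1 => /eqP e; rewrite e in pp.
Qed.

Let count_andC (s : seq nat) (a b : pred nat) :
  (size s <= count (fun v => a v && b v) s + count (fun v => ~~ a v) s + count (fun v => ~~ b v) s)%N.
Proof. by elim: s => //= x s; case: (a x); case: (b x) => /=; lia. Qed.

(** The square-free condition removes at most (T / p^2 + 1) values for each prime
    p > B, and only p <= N matter. *)
Let bad_square (N u : nat) : (B < u)%N ->
  (count (fun t => ~~ sqf (1 + P * t)) (iota 0 (T N u)) <=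
   \sum_(p <- U N) (T N u %/ (p * p) + 1))%N.
Proof.
move=> Bu.
apply: (@leq_trans (\sum_(p <- U N) count (fun t => p * p %| 1 + P * t) (iota 0 (T N u)))%N).
  apply: leq_trans (count_has_le _ _ (fun p => [pred t | p * p %| 1 + P * t]%N)).
  rewrite -!size_filter; apply: uniq_leq_size; first by rewrite filter_uniq ?iota_uniq.
  move=> t; rewrite !mem_filter => /andP[/allPn[p]]; rewrite mem_primes => /and3P[pp v0 pv].
  rewrite negbK => ppv ht; rewrite ht andbT.
  apply/hasP; exists p => //.
  have Bp := V_rough pp pv.
  rewrite !mem_filter Bp pp mem_iota ltnS /=.
  rewrite -leq_sqr -!mulnn.
  have h1 := dvdn_leq v0 ppv.
  rewrite mem_iota /= add0n in ht.
  have h2 : (T N u * (u * P) <= N * N)%N by exact: leq_divM.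
  apply: (leq_trans h1); apply: leq_trans h2.
  apply: (@leq_trans (t.+1 * P)%N); first by rewrite mulSn mulnC leq_add2r.
  apply: leq_mul; first exact: ht.
  by rewrite -{1}[P]mul1n leq_mul2r; lia.
rewrite big_seq [X in (_ <= X)%N]big_seq.
apply: leq_sum => p /UP[pp Bp _].
apply: count_progression; first by rewrite muln_gt0 prime_gt0.
by rewrite coprimeMl andbb coprime_P.
Qed.

Let size_V (N u : nat) : prime u -> (B < u)%N ->
  (T N u <= size (V N u) + \sum_(p <- U N) (T N u %/ (p * p) + 1) + (T N u %/ u + 1))%N.
Proof.
move=> pu Bu.
rewrite size_filter count_map -{1}(size_iota 0 (T N u)).
apply: leq_trans (count_andC _ (fun t => sqf (1 + P * t)) (fun t => ~~ (u %| 1 + P * t))%N) _.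
apply: leq_add; first by rewrite leq_add2l; exact: bad_square.
rewrite (eq_count (a2 := fun t => u %| 1 + P * t)%N); last by move=> t /=; rewrite negbK.
by apply: count_progression; [exact: prime_gt0 | exact: coprime_P].
Qed.

(** The conditions on v remove at most the fraction sum_(p > B) 1/p^2 + 1/u <= 1/2
    of the T candidates, up to O(N). *)
Let size_V_ge (N u : nat) : prime u -> (B < u)%N ->
  INR (N * N) / (2 * INR P) * / INR u - (INR N + 3) <= INR (size (V N u)).
Proof.
move=> pu Bu.
have B4 : 4 <= INR B by rewrite (_ : 4 = INR 4); [apply: le_INR; lia | rewrite /=; ring].
have uB : INR B <= INR u by apply: le_INR; lia.
have P1 : 1 <= INR P by rewrite -[1]/(INR 1); apply: le_INR; have := P_gt0; lia.
have /leP /le_INR := size_V N pu Bu.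
rewrite !plus_INR [INR 1]/=.
have h1 : INR (N * N) / (2 * INR P) * / INR u - / 2 <= INR (T N u) / 2.
  have : (N * N <= (T N u + 1) * (u * P))%N.
    by apply/ltnW; rewrite addn1 -ltn_divLR // muln_gt0 P_gt0 prime_gt0.
  move/leP/le_INR; rewrite !mult_INR plus_INR [INR 1]/= => h.
  apply: (Rmult_le_reg_r (2 * INR P * INR u)); first nra.
  have -> : (INR N * INR N / (2 * INR P) * / INR u - / 2) * (2 * INR P * INR u) =
     INR N * INR N - INR P * INR u by field; lra.
  nra.
have h2 : INR (T N u %/ u) <= INR (T N u) / 4.
  have /leP /le_INR := leq_divM (T N u) u; rewrite mult_INR.
  have := pos_INR (T N u %/ u); nra.
have h3 : INR (\sum_(p <- U N) (T N u %/ (p * p) + 1)) <= INR (T N u) / 4 + (INR N + 1).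
  rewrite INR_sum.
  apply: Rle_trans (_ : \rsum_(p <- U N) (INR (T N u) * (/ (INR p * INR p)) + 1) <= _).
    apply: rsum_le => p /UP[pp Bp _].
    rewrite plus_INR [INR 1]/=; apply: Rplus_le_compat_r.
    have /leP /le_INR := leq_divM (T N u) (p * p); rewrite !mult_INR.
    have p0 : 0 < INR p by apply: lt_0_INR; have := prime_gt0 pp; lia.
    move=> h; apply: (Rmult_le_reg_r (INR p * INR p)); first nra.
    by rewrite Rmult_assoc Rinv_l; nra.
  rewrite rsum_plus rsum_const rsum_scal Rmult_1_l.
  apply: Rplus_le_compat.
    rewrite /Rdiv; apply: Rmult_le_compat_l; first exact: pos_INR.
    apply: Rle_trans (_ : / INR B - / INR (B + N) <= _).
      apply: Rle_trans (sum_inv_sqr_le N _); last lia.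
      have -> : U N = [seq p <- [seq p <- iota B.+1 N | (p <= N)%N] | prime p].
        rewrite /U /primes_upto -!filter_predI.
        have -> : iota B.+1 N = [seq p <- iota 0 (B.+1 + N) | (B < p)%N].
          rewrite iotaD filter_cat add0n (_ : filter _ _ = [::]) /=.
            by apply/esym/all_filterP/allP => p; rewrite mem_iota; lia.
          apply/eqP; rewrite -[_ == _]negbK -has_filter; apply/hasPn => p.
          by rewrite mem_iota; lia.
        rewrite -filter_predI (_ : (B.+1 + N = N.+1 + B)%N); last lia.
        rewrite [in RHS]iotaD filter_cat [X in _ ++ X](_ : _ = [::]) ?cats0.
          apply: eq_in_filter => p; rewrite mem_iota /= ltnS => ->.
          by rewrite andbT andbC.
        apply/eqP; rewrite -[_ == _]negbK -has_filter; apply/hasPn => p.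
        by rewrite mem_iota /=; lia.
      have pos i : i \in iota B.+1 N -> 0 <= / (INR i * INR i).
        rewrite mem_iota => hi; apply/Rlt_le/Rinv_0_lt_compat.
        have : 0 < INR i by apply: lt_0_INR; lia.
        nra.
      apply: Rle_trans (rsum_filter_le _ _) (rsum_filter_le _ pos).
      by move=> i; rewrite mem_filter => /andP[_]; exact: pos.
    have : 0 < / INR (B + N) by apply/Rinv_0_lt_compat/lt_0_INR; lia.
    have : / INR B <= / 4 by apply: Rinv_le_contravar; lra.
    lra.
  rewrite -S_INR; apply: le_INR; apply/leP.
  rewrite size_filter; apply: (leq_trans (count_size _ _)).
  by rewrite size_filter; apply: (leq_trans (count_size _ _)); rewrite size_iota.
lra.
Qed.

Let pairs (n N : nat) := [seq (u, v) | u <- U n, v <- V N u].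

Let M := Z.to_nat (Z.abs D + 1).

Let box (N : nat) : seq (Z * Z * Z) :=
  [seq (xy, m) | xy <- [seq (x, y) | x <- int_range N, y <- int_range N], m <- int_range M].

Let size_pairs_le (n N : nat) :
  (size (pairs n N) <= (2 * N + 1) * (2 * N + 1) * (2 * M + 1))%N.
Proof.
have inP w : w \in pairs n N ->
    [/\ prime w.1, (B < w.1)%N & exists2 t, (t < T N w.1)%N &
       [/\ w.2 = (1 + P * t)%N, sqf w.2 & ~~ (w.1 %| w.2)%N]].
  case/allpairsPdep => u [v [/UP[pu Bu _] hv ->]] /=; split=> //.
  move: hv; rewrite mem_filter => /andP[/andP[sv nuv] /mapP[t]].
  by rewrite mem_iota /= add0n => ht ev; exists t.
have ex (w : nat * nat) : exists t : Z * Z * Z, w \in pairs n N ->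
    t \in box N /\ rep w.1 w.2 t.1.1 t.1.2 t.2.
  case: (boolP (w \in pairs n N)) => [/inP|_]; last by exists (0%Z, 0%Z, 0%Z).
  case: w => u v /= [pu Bu [t ht [ev sv nuv]]].
  have rv : rough v by rewrite ev; exact: V_rough.
  have v0 : (0 < v)%N by rewrite ev.
  have uvN : (u * v <= N * N)%N.
    apply: (@leq_trans (T N u * (u * P))); last exact: leq_divM.
    rewrite mulnCA leq_mul2l ev; apply/orP; right.
    apply: (@leq_trans (t.+1 * P)%N); first by rewrite mulSn mulnC leq_add2r.
    by rewrite leq_mul2r ht orbT.
  have [x [y [m [hx hy hm r]]]] := rep_exists pu Bu v0 sv rv nuv uvN.
  exists (x, y, m) => _; split=> //.
  apply/allpairsP; exists ((x, y), m); split=> //=; last first.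
    by apply: mem_int_range; rewrite /M; lia.
  by apply/allpairsP; exists (x, y); split=> //=; apply: mem_int_range.
have [f fP] := functional_choice ex.
have -> : ((2 * N + 1) * (2 * N + 1) * (2 * M + 1))%N = size (box N).
  by rewrite !size_allpairs !size_map !size_iota.
rewrite -(size_map f); apply: uniq_leq_size; last first.
  by move=> t /mapP[w /fP[h _] ->].
rewrite map_inj_in_uniq.
  apply: allpairs_uniq_dep.
  - by rewrite !filter_uniq ?iota_uniq.
  - move=> u _; rewrite filter_uniq // map_inj_uniq ?iota_uniq // => t t' /eqP.
    by rewrite eqn_add2l eqn_pmul2l ?P_gt0 // => /eqP.
  - by move=> [u v] [u' v'] _ _ /= [-> ->].
move=> [u v] [u' v'] hw hw' e.
have [_ r] := fP _ hw; have [_ r'] := fP _ hw'; rewrite -e in r'.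
have [pu Bu [t _ [ev _ _]]] := inP _ hw.
have [pu' _ [t' _ [ev' _ _]]] := inP _ hw'.
apply: rep_inj r r' => //=; first by rewrite [v]ev.
by rewrite [v']ev'.
Qed.

Lemma all_residues_absurd : False.
Proof.
pose K := (9 * (2 * M + 1))%N.
have P1 : 1 <= INR P by rewrite -[1]/(INR 1); apply: le_INR; have := P_gt0; lia.
have [n hn] := sum_inv_primes_unbounded B (2 * INR P * (INR K + 1)).
pose N := (n + 5)%N.
have h1 : INR (size (pairs n N)) <= INR K * (INR N * INR N).
  rewrite -!mult_INR; apply: le_INR; apply/leP; apply: (leq_trans (size_pairs_le n N)).
  rewrite /K /N mulnAC -mulnA; nia.
have h2 : INR (N * N) / (2 * INR P) * (\rsum_(u <- U n) / INR u) - (INR N + 3) * INR (size (U n)) <=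
    INR (size (pairs n N)).
  have -> : INR (size (pairs n N)) = \rsum_(u <- U n) INR (size (V N u)).
    by rewrite size_allpairs_dep sumnE INR_sum big_map.
  rewrite -rsum_scal -rsum_const.
  suff : \rsum_(u <- U n) (INR (N * N) / (2 * INR P) * / INR u) <=
     \rsum_(u <- U n) INR (size (V N u)) + \rsum_(u <- U n) (INR N + 3) by lra.
  rewrite -rsum_plus; apply: rsum_le => u /UP[pu Bu _].
  have := size_V_ge N pu Bu; lra.
have h3 : INR (size (U n)) <= INR n + 1.
  rewrite -S_INR; apply: le_INR; apply/leP.
  rewrite size_filter; apply: (leq_trans (count_size _ _)).
  by rewrite size_filter; apply: (leq_trans (count_size _ _)); rewrite size_iota.
have h4 : INR N * INR N * (INR K + 1) <=
    INR (N * N) / (2 * INR P) * (\rsum_(u <- U n) / INR u).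
  have -> : INR N * INR N * (INR K + 1) = INR (N * N) / (2 * INR P) * (2 * INR P * (INR K + 1)).
    by rewrite (mult_INR N N); field; lra.
  apply: Rmult_le_compat_l; last exact: hn.
  apply: Rmult_le_pos; first exact: pos_INR.
  by apply/Rlt_le/Rinv_0_lt_compat; lra.
have h5 : INR N = INR n + 5 by rewrite plus_INR /=; ring.
have n0 := pos_INR n.
have h6 : (INR N + 3) * INR (size (U n)) <= (INR N + 3) * (INR n + 1).
  by apply: Rmult_le_compat_l; lra.
rewrite h5 in h1 h2 h4 h6; nra.
Qed.
End AllResidues.

Lemma nonresidue_exists (D : Z) (B : nat) : (forall m : Z, (m * m)%Z <> D) ->
  exists p : nat, [/\ prime p, (B < p)%N & chi p D = -1].
Proof.
move=> hD; apply: NNPP => h.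
pose B' := maxn (maxn 4 B) (Z.to_nat (Z.abs D + 2)).
have root (p : nat) : exists y : Z, prime p -> (B' < p)%N -> Z.divide p%:Z (y * y - D).
  have [[pp Bp]|np] := classic (prime p /\ (B' < p)%N); last first.
    by exists 0%Z => pp Bp; case: np.
  case: (chi_values p D) => -[hc hd].
  - case: hd => k hk; exists 0%Z => _ _; exists (- k)%Z; lia.
  - move: hc; rewrite /chi; case: excluded_middle_informative => d /=; first by case: (hd d).
    case: excluded_middle_informative => [[y hy] _|_ /= hc]; first by exists y.
    by exfalso; lra.
  - case: h; exists p; split=> //; move: Bp; rewrite /B'; lia.
have [beta betaP] := functional_choice root.
apply: (@all_residues_absurd D B' beta hD); rewrite /B' => //; lia.
Qed.
End Nonresidues.

(** * A Riemann sum over the positive integers *)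

Lemma sum_n_ge0 (f : nat -> R) (k : nat) : (forall n, 0 <= f n) -> 0 <= sum_n f k.
Proof.
  intros h; induction k as [|k IH].
  - rewrite sum_O; apply h.
  - rewrite sum_Sn; change (@plus _) with Rplus; specialize (h (S k)); lra.
Qed.

Lemma Series_ge0 (f : nat -> R) : (forall n, 0 <= f n) -> ex_series f -> 0 <= Series f.
Proof.
  intros h ex; apply Series_correct in ex.
  apply (is_lim_seq_le (fun _ => 0) (sum_n f) 0 (Series f)).
  - intros k; now apply sum_n_ge0.
  - apply is_lim_seq_const.
  - exact ex.
Qed.

Section Weights.
Variable delta : R.
Hypothesis delta_bounds : 0 < delta <= 1.

(** The coefficient of g((n+1)^2 x) in the series G. *)
Definition weight (n : nat) : R := / Rpower (INR (S n)) (1 + delta).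

Lemma Rpower_gt0 (x y : R) : 0 < Rpower x y.
Proof. apply exp_pos. Qed.

Lemma weight_gt0 (n : nat) : 0 < weight n.
Proof. apply Rinv_0_lt_compat, Rpower_gt0. Qed.

Lemma INR_S_gt0 (n : nat) : 0 < INR (S n).
Proof. apply lt_0_INR; lia. Qed.

(** The mean value theorem for x^(-delta), in the form that bounds the tails of the
    series of weights by telescoping. *)
Lemma Rpower_telescope (x : R) : 1 <= x ->
  delta / Rpower (x + 1) (1 + delta) <= / Rpower x delta - / Rpower (x + 1) delta.
Proof.
  intros hx.
  assert (h1 : Rpower (x + 1) (1 + delta) = (x + 1) * Rpower (x + 1) delta)
    by (rewrite Rpower_plus, Rpower_1; lra).
  rewrite h1.
  assert (h2 : 1 + delta / (x + 1) <= Rpower ((x + 1) / x) delta).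
  { unfold Rpower.
    apply Rle_trans with (exp (delta / (x + 1))).
    - left; apply exp_ineq1.
      apply Rgt_not_eq, Rdiv_lt_0_compat; lra.
    - assert (h : / (x + 1) <= ln ((x + 1) / x)).
      { assert (h3 : ln (x / (x + 1)) <= - / (x + 1)).
        { rewrite <- (ln_exp (- / (x + 1))).
          apply ln_le; [apply Rdiv_lt_0_compat; lra|].
          replace (x / (x + 1)) with (1 + - / (x + 1)) by (field; lra).
          left; apply exp_ineq1.
          apply Rlt_not_eq, Ropp_lt_gt_0_contravar, Rinv_0_lt_compat; lra. }
        replace ((x + 1) / x) with (/ (x / (x + 1))) by (field; lra).
        rewrite ln_Rinv; [lra | apply Rdiv_lt_0_compat; lra]. }
      assert (hle : delta / (x + 1) <= delta * ln ((x + 1) / x))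
        by (unfold Rdiv at 1; apply Rmult_le_compat_l; lra).
      destruct hle as [hl | ->]; [left; now apply exp_increasing | apply Rle_refl]. }
  assert (h3 : Rpower ((x + 1) / x) delta = Rpower (x + 1) delta / Rpower x delta).
  { unfold Rpower; rewrite ln_div by lra.
    rewrite Rmult_minus_distr_l; unfold Rminus; rewrite exp_plus, exp_Ropp; reflexivity. }
  rewrite h3 in h2.
  pose proof (Rpower_gt0 x delta) as hp; pose proof (Rpower_gt0 (x + 1) delta) as hp1.
  apply (Rmult_le_reg_r (Rpower (x + 1) delta)); [exact hp1|].
  replace (delta / ((x + 1) * Rpower (x + 1) delta) * Rpower (x + 1) delta)
    with (delta / (x + 1)) by (field; lra).
  replace ((/ Rpower x delta - / Rpower (x + 1) delta) * Rpower (x + 1) delta)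
    with (Rpower (x + 1) delta / Rpower x delta - 1) by (field; lra).
  lra.
Qed.

Lemma weight_tail (m k : nat) : (1 <= m)%nat ->
  sum_n (fun n => weight (m + n)) k <= / (delta * Rpower (INR m) delta).
Proof.
  intros hm.
  assert (h : delta * sum_n (fun n => weight (m + n)) k <=
     / Rpower (INR m) delta - / Rpower (INR (S (m + k))) delta).
  { assert (h1 : forall n, (1 <= n)%nat -> delta * weight n <=
       / Rpower (INR n) delta - / Rpower (INR (S n)) delta).
    { intros n hn; unfold weight; rewrite S_INR.
      apply Rpower_telescope; change 1 with (INR 1); apply le_INR; lia. }
    induction k as [|k IH].
    - rewrite sum_O, Nat.add_0_r; now apply h1.
    - rewrite sum_Sn; change (@plus _) with Rplus.
      specialize (h1 (m + S k)%nat ltac:(lia)).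
      replace (S (m + k)) with (m + S k)%nat in IH by lia.
      lra. }
  pose proof (Rinv_0_lt_compat _ (Rpower_gt0 (INR (S (m + k))) delta)).
  rewrite Rinv_mult.
  apply (Rmult_le_reg_l delta); [lra|].
  rewrite <- Rmult_assoc, Rinv_r, Rmult_1_l by lra.
  lra.
Qed.

Lemma ex_series_weight : ex_series weight.
Proof.
  apply (ex_series_incr_n _ 1).
  apply ex_series_Reals_1.
  destruct (growing_cv (fun k => sum_n (fun n => weight (1 + n)) k)) as [l hl].
  - intros k; rewrite sum_Sn; change (@plus _) with Rplus.
    pose proof (weight_gt0 (1 + S k)); lra.
  - exists (/ (delta * Rpower (INR 1) delta)).
    intros y [k ->]; apply weight_tail; lia.
  - exists l; intros eps heps; destruct (hl eps heps) as [N hN]; exists N; intros n hn.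
    rewrite <- sum_n_Reals; now apply hN.
Qed.

Lemma ex_series_le_weight (f : nat -> R) (c : R) :
  (forall n, Rabs (f n) <= c * weight n) -> ex_series f.
Proof.
  intros h.
  apply (ex_series_le (K := R_AbsRing) (V := R_CompleteNormedModule) f (fun n => c * weight n)).
  - exact h.
  - apply (ex_series_scal (K := R_AbsRing) (V := R_NormedModule) c weight), ex_series_weight.
Qed.

Lemma Series_shift_le (f : nat -> R) (c : R) (m : nat) : (1 <= m)%nat ->
  (forall n, 0 <= f n <= c * weight n) ->
  Series (fun n => f (m + n)%nat) <= c / (delta * Rpower (INR m) delta).
Proof.
  intros hm hf.
  assert (c0 : 0 <= c).
  { destruct (hf O) as [h1 h2]; pose proof (weight_gt0 0); nra. }
  assert (ex : ex_series (fun n => f (m + n)%nat)).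
  { apply (ex_series_incr_n f m), ex_series_le_weight with c.
    intros n; rewrite Rabs_pos_eq; apply hf. }
  apply Series_correct in ex.
  apply (is_lim_seq_le (sum_n (fun n => f (m + n)%nat)) (fun _ => c / (delta * Rpower (INR m) delta))
     (Series (fun n => f (m + n)%nat)) (c / (delta * Rpower (INR m) delta))).
  - intros k.
    apply Rle_trans with (c * sum_n (fun n => weight (m + n)) k).
    + rewrite <- (sum_n_mult_l (K := R_AbsRing)).
      apply sum_n_m_le; intros n; apply hf.
    + unfold Rdiv; apply Rmult_le_compat_l; [exact c0 | now apply weight_tail].
  - exact ex.
  - apply is_lim_seq_const.
Qed.

Lemma one_sub_cos_bounds (x : R) : 0 <= 1 - cos x <= 2.
Proof. pose proof (COS_bound x); lra. Qed.

Lemma one_sub_cos_le (x : R) : 1 - cos x <= x ^ 2 / 2.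
Proof.
  replace x with (2 * (x / 2)) at 1 by field.
  rewrite cos_2a_sin.
  assert (h : forall z, 0 <= z -> sin z ^ 2 <= z ^ 2).
  { intros z hz; destruct (Rle_dec z 1) as [h1|h1].
    - destruct hz as [hz|<-]; [|rewrite sin_0; lra].
      pose proof (sin_lt_x z hz); pose proof PI2_1.
      pose proof (sin_ge_0 z (Rlt_le _ _ hz) ltac:(lra)); nra.
    - pose proof (SIN_bound z); nra. }
  destruct (Rle_dec 0 (x / 2)) as [h0|h0]; [specialize (h _ h0); nra|].
  specialize (h (- (x / 2)) ltac:(lra)); rewrite sin_neg in h; nra.
Qed.

(** The function F with U(t) = t^(delta/2) times the Riemann sum of F of step
    sqrt t, where U is the unrestricted sum; see [profile_scale]. *)
Definition profile (u : R) : R :=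
  if Rle_dec u 0 then 0 else (1 - cos (2 * PI * u ^ 2)) / Rpower u (1 + delta).

Lemma profile_ge0 (u : R) : 0 <= profile u.
Proof.
  unfold profile; destruct (Rle_dec u 0); [lra|].
  apply Rmult_le_pos; [apply one_sub_cos_bounds | left; apply Rinv_0_lt_compat, Rpower_gt0].
Qed.

(** Near 0 the numerator is O(u^4) and the denominator is at least u^2. *)
Lemma profile_le_sqr (u : R) : u <= 1 -> profile u <= 2 * PI ^ 2 * u ^ 2.
Proof.
  intros hu; unfold profile; destruct (Rle_dec u 0) as [h|h].
  - apply Rmult_le_pos; [pose proof (pow2_ge_0 PI); lra | apply pow2_ge_0].
  - assert (h1 : u ^ 2 <= Rpower u (1 + delta)).
    { rewrite <- (Rpower_pow 2 u) by lra.
      assert (hl : ln u <= 0) by (rewrite <- ln_1; apply ln_le; lra).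
      unfold Rpower; simpl INR.
      assert (hle : (1 + 1) * ln u <= (1 + delta) * ln u) by nra.
      destruct hle as [hl' | ->]; [left; now apply exp_increasing | apply Rle_refl]. }
    pose proof (one_sub_cos_le (2 * PI * u ^ 2)) as h2.
    pose proof (Rpower_gt0 u (1 + delta)) as h3.
    assert (h4 : 0 < u ^ 2) by nra.
    apply (Rmult_le_reg_r (Rpower u (1 + delta))); [exact h3|].
    unfold Rdiv; rewrite Rmult_assoc, Rinv_l, Rmult_1_r by lra.
    apply Rle_trans with (2 * PI ^ 2 * u ^ 2 * u ^ 2); [nra|].
    apply Rmult_le_compat_l; [pose proof (pow2_ge_0 PI); nra | exact h1].
Qed.

Lemma profile_le (u : R) : profile u <= 2 * PI ^ 2 + 2.
Proof.
  destruct (Rle_dec u 1) as [h|h].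
  - unfold profile; destruct (Rle_dec u 0) as [h0|h0].
    + pose proof (pow2_ge_0 PI); lra.
    + pose proof (profile_le_sqr u h) as h1.
      unfold profile in h1; destruct (Rle_dec u 0); [lra|].
      pose proof (pow2_ge_0 PI); assert (u ^ 2 <= 1) by nra; nra.
  - unfold profile; destruct (Rle_dec u 0); [lra|].
    assert (h1 : 1 <= Rpower u (1 + delta)).
    { apply Rle_trans with (Rpower u 0); [rewrite Rpower_O; lra | apply Rle_Rpower; lra]. }
    pose proof (one_sub_cos_bounds (2 * PI * u ^ 2)).
    apply (Rmult_le_reg_r (Rpower u (1 + delta))); [lra|].
    unfold Rdiv; rewrite Rmult_assoc, Rinv_l, Rmult_1_r by lra.
    pose proof (pow2_ge_0 PI); nra.
Qed.

Lemma profile_continuous (u : R) : continuous profile u.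
Proof.
  destruct (Rtotal_order u 0) as [h|[h|h]].
  - apply continuous_ext_loc with (fun _ => 0); [|apply continuous_const].
    exists (mkposreal (- u) ltac:(lra)); intros y hy.
    unfold ball in hy; simpl in hy; unfold AbsRing_ball, abs, minus, plus, opp in hy; simpl in hy.
    apply Rabs_def2 in hy.
    unfold profile; destruct (Rle_dec y 0); lra.
  - subst u.
    apply filterlim_locally; intros eps.
    assert (hd : 0 < Rmin 1 (eps / (2 * PI ^ 2 + 1))).
    { apply Rmin_glb_lt; [lra|].
      apply Rdiv_lt_0_compat; [apply cond_pos | pose proof (pow2_ge_0 PI); lra]. }
    pose proof (Rmin_l 1 (eps / (2 * PI ^ 2 + 1))) as hr1.
    pose proof (Rmin_r 1 (eps / (2 * PI ^ 2 + 1))) as hr2.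
    set (r := Rmin 1 (eps / (2 * PI ^ 2 + 1))) in *.
    exists (mkposreal r hd); intros y hy.
    unfold ball in hy |- *; simpl in hy |- *; unfold AbsRing_ball, abs, minus, plus, opp in hy |- *; simpl in hy |- *.
    rewrite Ropp_0, Rplus_0_r in hy.
    assert (h0 : profile 0 = 0) by (unfold profile; destruct (Rle_dec 0 0); lra).
    rewrite h0, Ropp_0, Rplus_0_r, Rabs_pos_eq by apply profile_ge0.
    apply Rabs_def2 in hy.
    destruct (Rle_dec y 0) as [hy0|hy0].
    + unfold profile; destruct (Rle_dec y 0); [apply cond_pos | lra].
    + apply Rle_lt_trans with (2 * PI ^ 2 * y ^ 2).
      { apply profile_le_sqr; lra. }
      pose proof (pow2_ge_0 PI) as hp.
      assert (h1 : (2 * PI ^ 2 + 1) * y < eps).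
      { apply Rlt_le_trans with ((2 * PI ^ 2 + 1) * (eps / (2 * PI ^ 2 + 1))).
        - apply Rmult_lt_compat_l; lra.
        - right; field; lra. }
      nra.
  - apply continuous_ext_loc with
      (fun x => (1 - cos (2 * PI * x ^ 2)) * exp (- ((1 + delta) * ln x))).
    + exists (mkposreal u h); intros y hy.
      unfold ball in hy; simpl in hy; unfold AbsRing_ball, abs, minus, plus, opp in hy; simpl in hy.
      apply Rabs_def2 in hy.
      unfold profile; destruct (Rle_dec y 0); [lra|].
      unfold Rdiv, Rpower; now rewrite exp_Ropp.
    + apply (ex_derive_continuous (K := R_AbsRing) (V := R_NormedModule)).
      auto_derive; lra.
Qed.

Lemma profile_scale (eta : R) (n : nat) : 0 < eta ->
  eta * profile (eta * INR (S n)) =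
  Rpower eta (- delta) * ((1 - cos (2 * PI * (eta ^ 2 * INR (S n) ^ 2))) * weight n).
Proof.
  intros he; pose proof (INR_S_gt0 n) as hn.
  unfold profile; destruct (Rle_dec (eta * INR (S n)) 0) as [h|h]; [nra|].
  rewrite <- Rpower_mult_distr by assumption.
  rewrite (Rpower_plus 1 delta eta), Rpower_1, Rpower_Ropp by lra.
  rewrite Rpow_mult_distr; unfold weight.
  pose proof (Rpower_gt0 eta delta); pose proof (Rpower_gt0 (INR (S n)) (1 + delta)).
  field; lra.
Qed.

Lemma ex_RInt_profile (a b : R) : ex_RInt profile a b.
Proof.
  apply (ex_RInt_continuous (V := R_CompleteNormedModule)).
  intros z _; apply profile_continuous.
Qed.

Lemma riemann_piece (a eta eps : R) : 0 < eta ->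
  (forall t, a <= t <= a + eta -> Rabs (profile t - profile (a + eta)) <= eps) ->
  Rabs (eta * profile (a + eta) - RInt profile a (a + eta)) <= eps * eta.
Proof.
  intros he h.
  replace (eta * profile (a + eta)) with (RInt (fun _ => profile (a + eta)) a (a + eta))
    by (rewrite RInt_const; unfold scal; simpl; unfold mult; simpl; ring).
  rewrite Rabs_minus_sym.
  change (Rabs (minus (RInt profile a (a + eta)) (RInt (fun _ => profile (a + eta)) a (a + eta)))
     <= eps * eta).
  rewrite <- (RInt_minus (V := R_CompleteNormedModule));
    [|apply ex_RInt_profile | apply ex_RInt_const].
  replace (eps * eta) with ((a + eta - a) * eps) by ring.
  apply abs_RInt_le_const; [lra | | exact h].
  apply (ex_RInt_minus (V := R_NormedModule)); [apply ex_RInt_profile | apply ex_RInt_const].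
Qed.

Lemma riemann_sum_close (A eps : R) : 0 < eps ->
  exists d, 0 < d /\ forall eta k, 0 < eta < d -> eta * INR (S k) <= A ->
  Rabs (sum_n (fun n => eta * profile (eta * INR (S n))) k - RInt profile 0 (eta * INR (S k)))
    <= eps * (eta * INR (S k)).
Proof.
  intros heps.
  assert (hc : forall x, 0 <= x <= A -> continuity_pt profile x).
  { intros x _; apply continuity_pt_filterlim, profile_continuous. }
  destruct (Heine_cor2 hc (mkposreal eps heps)) as [d hd]; simpl in hd.
  exists d; split; [apply cond_pos|].
  intros eta k [he hed]; induction k as [|k IH]; intros hk.
  - rewrite sum_O; simpl INR in *; rewrite !Rmult_1_r in *.
    rewrite <- (Rplus_0_l eta) at 2 3.
    apply riemann_piece; [exact he|].
    intros t ht; left; apply hd; try lra.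
    apply Rabs_def1; lra.
  - rewrite sum_Sn; change (@plus _) with Rplus.
    assert (hs : eta * INR (S (S k)) = eta * INR (S k) + eta) by (rewrite (S_INR (S k)); ring).
    assert (hk0 : 0 <= eta * INR (S k)) by (pose proof (INR_S_gt0 k); nra).
    rewrite hs in *.
    specialize (IH ltac:(lra)).
    rewrite <- (RInt_Chasles (V := R_CompleteNormedModule) profile 0 (eta * INR (S k)) (eta * INR (S k) + eta))
      by apply ex_RInt_profile.
    change (@plus _) with Rplus.
    assert (h2 := riemann_piece (eta * INR (S k)) eta eps he).
    assert (h3 : Rabs (eta * profile (eta * INR (S k) + eta)
       - RInt profile (eta * INR (S k)) (eta * INR (S k) + eta)) <= eps * eta).
    { apply h2; intros t ht; left; apply hd; try lra; apply Rabs_def1; lra. }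
    apply Rabs_le_between in IH; apply Rabs_le_between in h3; apply Rabs_le_between.
    lra.
Qed.

Definition riemann_series (eta : R) : R := Series (fun n => eta * profile (eta * INR (S n))).

Lemma profile_scale_le (eta : R) (n : nat) : 0 < eta ->
  0 <= eta * profile (eta * INR (S n)) <= 2 * Rpower eta (- delta) * weight n.
Proof.
  intros he; rewrite profile_scale by exact he.
  pose proof (one_sub_cos_bounds (2 * PI * (eta ^ 2 * INR (S n) ^ 2))) as h1.
  pose proof (weight_gt0 n) as h2; pose proof (Rpower_gt0 eta (- delta)) as h3.
  set (x := 1 - cos _) in *; split.
  - apply Rmult_le_pos; [lra|]; apply Rmult_le_pos; lra.
  - rewrite (Rmult_comm 2), Rmult_assoc; apply Rmult_le_compat_l; [lra|].
    apply Rmult_le_compat_r; lra.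
Qed.

Lemma ex_series_profile (eta : R) : 0 < eta ->
  ex_series (fun n => eta * profile (eta * INR (S n))).
Proof.
  intros he; apply ex_series_le_weight with (2 * Rpower eta (- delta)).
  intros n; rewrite Rabs_pos_eq; now apply profile_scale_le.
Qed.

Lemma nat_floor (x : R) : 1 <= x -> exists k : nat, INR (S k) <= x < INR (S k) + 1.
Proof.
  intros hx.
  destruct (nfloor_ex x ltac:(lra)) as [n hn].
  destruct n as [|k].
  - simpl in hn; lra.
  - exists k; exact hn.
Qed.

(** For a fixed A the part of the series with sample points up to A is a Riemann
    sum, and the rest is O(A^(-delta)) uniformly in the step. *)
Lemma riemann_series_close (eps : R) : 0 < eps ->
  exists A0, 1 <= A0 /\ forall A, A0 <= A -> exists d, 0 < d /\ forall eta, 0 < eta < d ->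
  Rabs (riemann_series eta - RInt profile 0 A) <= eps.
Proof.
  intros heps.
  set (T := 6 / (delta * eps) + 1).
  assert (hT : 1 < T).
  { unfold T; assert (0 < 6 / (delta * eps)); [|lra]. apply Rdiv_lt_0_compat; [lra|nra]. }
  set (A0 := 2 * Rpower T (/ delta)).
  assert (hA0 : 2 <= A0).
  { unfold A0; assert (1 <= Rpower T (/ delta)); [|lra].
    apply Rle_trans with (Rpower T 0); [rewrite Rpower_O; lra | apply Rle_Rpower; [lra|]].
    left; apply Rinv_0_lt_compat; lra. }
  exists A0; split; [lra|]; intros A hA.
  set (M := 2 * PI ^ 2 + 2).
  assert (hM : 0 < M) by (unfold M; pose proof (pow2_ge_0 PI); lra).
  destruct (riemann_sum_close A (eps / (3 * A))) as [d [hd hsum]].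
  { apply Rdiv_lt_0_compat; lra. }
  set (d' := Rmin d (Rmin 1 (eps / (3 * M)))).
  assert (hd1 : d' <= d) by apply Rmin_l.
  assert (hd2 : d' <= 1) by (eapply Rle_trans; [apply Rmin_r | apply Rmin_l]).
  assert (hd3 : d' <= eps / (3 * M)) by (eapply Rle_trans; [apply Rmin_r | apply Rmin_r]).
  exists d'; split.
  { unfold d'; apply Rmin_glb_lt; [lra|]; apply Rmin_glb_lt; [lra|]; apply Rdiv_lt_0_compat; lra. }
  intros eta [he hed].
  destruct (nat_floor (A / eta)) as [k [hk1 hk2]].
  { apply (Rmult_le_reg_r eta); [exact he|].
    unfold Rdiv; rewrite Rmult_assoc, Rinv_l by lra; lra. }
  assert (hAe : A / eta * eta = A) by (field; lra).
  assert (hk3 : eta * INR (S k) <= A) by nra.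
  assert (hk4 : A < eta * INR (S k) + eta) by nra.
  (* The series is split after the last sample point in the interval [0, A]. *)
  assert (hsplit : riemann_series eta =
     sum_n (fun n => eta * profile (eta * INR (S n))) k +
     Series (fun n => eta * profile (eta * INR (S (S k + n))))).
  { unfold riemann_series.
    rewrite (Series_incr_n (fun n => eta * profile (eta * INR (S n))) (S k)); [|lia|now apply ex_series_profile].
    simpl pred; rewrite sum_n_Reals; reflexivity. }
  (* Beyond A the profile is at most 2 / u^(1+delta), so the tail of the Riemann
     series is O(A^(-delta)), uniformly in the step. *)
  assert (htail : 0 <= Series (fun n => eta * profile (eta * INR (S (S k + n)))) <= eps / 3).
  { split.
    - apply Series_ge0.
        * intros n; apply (profile_scale_le eta (S k + n) he).
        * apply (ex_series_incr_n (fun n => eta * profile (eta * INR (S n))) (S k)), ex_series_profile, he.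
    - eapply Rle_trans.
      { apply (Series_shift_le (fun n => eta * profile (eta * INR (S n))) (2 * Rpower eta (- delta)) (S k));
          [lia|]; intros n; now apply profile_scale_le. }
      rewrite Rpower_Ropp.
      pose proof (Rpower_gt0 eta delta) as hp1; pose proof (Rpower_gt0 (INR (S k)) delta) as hp2.
      assert (hT' : T <= Rpower eta delta * Rpower (INR (S k)) delta).
      { rewrite Rpower_mult_distr by (try apply INR_S_gt0; lra).
        assert (h1 : Rpower T (/ delta) <= eta * INR (S k)) by (unfold A0 in hA, hA0; lra).
        replace T with (Rpower (Rpower T (/ delta)) delta)
          by (rewrite Rpower_mult, Rinv_l, Rpower_1; lra).
        apply Rle_Rpower_l; [lra|]; split; [apply Rpower_gt0 | exact h1]. }
      replace (2 * / Rpower eta delta / (delta * Rpower (INR (S k)) delta))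
        with (2 / (delta * (Rpower eta delta * Rpower (INR (S k)) delta))) by (field; lra).
      apply (Rmult_le_reg_r (delta * (Rpower eta delta * Rpower (INR (S k)) delta))); [nra|].
      unfold Rdiv at 1; rewrite Rmult_assoc, Rinv_l, Rmult_1_r by nra.
      apply Rle_trans with (eps / 3 * (delta * T)).
      + unfold T; replace (eps / 3 * (delta * (6 / (delta * eps) + 1)))
          with (2 + eps / 3 * delta) by (field; lra); nra.
      + apply Rmult_le_compat_l; [lra|]; apply Rmult_le_compat_l; lra. }
  specialize (hsum eta k ltac:(lra) hk3).
  assert (hsum' : eps / (3 * A) * (eta * INR (S k)) <= eps / 3).
  { apply Rle_trans with (eps / (3 * A) * A).
    - apply Rmult_le_compat_l; [left; apply Rdiv_lt_0_compat; lra | exact hk3].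
    - right; field; lra. }
  assert (hint : Rabs (RInt profile (eta * INR (S k)) A) <= eps / 3).
  { eapply Rle_trans.
    - apply (abs_RInt_le_const profile (eta * INR (S k)) A M);
        [exact hk3 | apply ex_RInt_profile |].
      intros t _; rewrite Rabs_pos_eq by apply profile_ge0; apply profile_le.
    - apply Rle_trans with (eps / (3 * M) * M); [|right; field; lra].
      apply Rmult_le_compat_r; lra. }
  rewrite hsplit.
  rewrite <- (RInt_Chasles (V := R_CompleteNormedModule) profile 0 (eta * INR (S k)) A)
    by apply ex_RInt_profile.
  change (@plus _) with Rplus.
  apply Rabs_le_between in hint; apply Rabs_le_between in hsum; apply Rabs_le_between.
  lra.
Qed.

(** On [1/2, 4/5] the cosine is non-positive, so the profile is at least 1. *)
Lemma RInt_profile_ge (A : R) : 1 <= A -> 3 / 10 <= RInt profile 0 A.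
Proof.
  intros hA.
  rewrite <- (RInt_Chasles (V := R_CompleteNormedModule) profile 0 (1 / 2) A) by apply ex_RInt_profile.
  rewrite <- (RInt_Chasles (V := R_CompleteNormedModule) profile (1 / 2) (4 / 5) A) by apply ex_RInt_profile.
  change (@plus _) with Rplus.
  assert (h1 : 0 <= RInt profile 0 (1 / 2)) by
    (apply RInt_ge_0; [lra | apply ex_RInt_profile | intros; apply profile_ge0]).
  assert (h3 : 0 <= RInt profile (4 / 5) A) by
    (apply RInt_ge_0; [lra | apply ex_RInt_profile | intros; apply profile_ge0]).
  assert (h2 : RInt (fun _ => 1) (1 / 2) (4 / 5) <= RInt profile (1 / 2) (4 / 5)).
  { apply RInt_le; [lra | apply ex_RInt_const | apply ex_RInt_profile |].
    intros x hx; unfold profile; destruct (Rle_dec x 0); [lra|].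
    assert (hc : cos (2 * PI * x ^ 2) <= 0).
    { pose proof PI_RGT_0; assert (1 / 4 <= x ^ 2 <= 3 / 4) by nra; apply cos_le_0; nra. }
    assert (hp : Rpower x (1 + delta) <= 1).
    { rewrite <- (Rpower_O x) at 2 by lra.
      assert (hl : ln x <= 0) by (rewrite <- ln_1; apply ln_le; lra).
      unfold Rpower.
      assert (hle : (1 + delta) * ln x <= 0 * ln x) by nra.
      destruct hle as [hl' | ->]; [left; now apply exp_increasing | apply Rle_refl]. }
    pose proof (Rpower_gt0 x (1 + delta)).
    apply (Rmult_le_reg_r (Rpower x (1 + delta))); [lra|].
    unfold Rdiv; rewrite Rmult_assoc, Rinv_l, Rmult_1_r by lra; lra. }
  rewrite RInt_const in h2; unfold scal in h2; simpl in h2; unfold mult in h2; simpl in h2.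
  lra.
Qed.

(** The limit is the improper integral of the profile.  Its existence follows from
    the Cauchy criterion, as both the series at a small step and the limit are
    compared with the integral over one fixed interval. *)
Lemma riemann_series_limit : exists I, 0 < I /\ forall eps, 0 < eps ->
  exists d, 0 < d /\ forall eta, 0 < eta < d -> Rabs (riemann_series eta - I) <= eps.
Proof.
  assert (hex : exists I : R, filterlim riemann_series (at_right 0) (locally I)).
  { apply (filterlim_locally_cauchy (U := R_CompleteSpace)).
    intros eps.
    assert (he3 : 0 < eps / 3) by (pose proof (cond_pos eps); lra).
    destruct (riemann_series_close (eps / 3) he3) as [A [hA h]].
    destruct (h A ltac:(lra)) as [d [hd hclose]].
    exists (fun eta => 0 < eta < d); split.
    - exists (mkposreal d hd); intros y hy hy0.
      unfold ball in hy; simpl in hy; unfold AbsRing_ball, abs, minus, plus, opp in hy; simpl in hy.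
      apply Rabs_def2 in hy; lra.
    - intros u v hu hv.
      apply hclose in hu; apply hclose in hv.
      apply Rabs_le_between in hu; apply Rabs_le_between in hv.
      pose proof (cond_pos eps).
      unfold ball; simpl; unfold AbsRing_ball, abs, minus, plus, opp; simpl.
      apply Rabs_def1; lra. }
  destruct hex as [I hI].
  assert (hlim : forall eps, 0 < eps ->
    exists d, 0 < d /\ forall eta, 0 < eta < d -> Rabs (riemann_series eta - I) <= eps).
  { intros eps heps.
    destruct (proj1 (filterlim_locally _ _) hI (mkposreal eps heps)) as [d hd].
    exists d; split; [apply cond_pos|]; intros eta heta; left.
    apply hd; [|lra].
    unfold ball; simpl; unfold AbsRing_ball, abs, minus, plus, opp; simpl.
    apply Rabs_def1; lra. }
  exists I; split; [|exact hlim].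
  destruct (riemann_series_close (1 / 10) ltac:(lra)) as [A [hA h]].
  destruct (h A ltac:(lra)) as [d [hd hclose]].
  destruct (hlim (1 / 10) ltac:(lra)) as [d' [hd' hclose']].
  assert (hm : 0 < Rmin d d') by (apply Rmin_glb_lt; lra).
  pose proof (Rmin_l d d'); pose proof (Rmin_r d d').
  specialize (hclose (Rmin d d' / 2) ltac:(lra)).
  specialize (hclose' (Rmin d d' / 2) ltac:(lra)).
  apply Rabs_le_between in hclose; apply Rabs_le_between in hclose'.
  pose proof (RInt_profile_ge A hA); lra.
Qed.
End Weights.

(** * The sum over integers coprime to given primes *)

Section CoprimeSums.
Import all_boot zify SumNotations.
#[local] Set Implicit Arguments.
#[local] Unset Strict Implicit.
Variable delta : R.
Hypothesis delta_bounds : 0 < delta <= 1.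

Lemma sum_n_multiples (f : nat -> R) (p k : nat) : (0 < p)%N ->
  sum_n (fun n => if (p %| n.+1)%N then f n else 0) (p * k.+1).-1 =
  sum_n (fun m => f (p * m.+1).-1) k.
Proof.
case: p => // p _.
have block (j : nat) : sum_n_m (fun n => if (p.+1 %| n.+1)%N then f n else 0)
    (p.+1 * j) (p.+1 * j.+1).-1 = f (p.+1 * j.+1).-1.
  have -> : (p.+1 * j.+1).-1 = (p.+1 * j + p)%N by rewrite mulnS; lia.
  have last_term : (if (p.+1 %| (p.+1 * j + p).+1)%N then f (p.+1 * j + p)%N else 0) = f (p.+1 * j + p)%N.
    by rewrite -addnS dvdn_addr ?dvdn_mulr ?dvdnn.
  case: (posnP p) => [p0|p0].
    by move: last_term; rewrite p0 addn0 sum_n_n.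
  have e : (p.+1 * j + p)%N = (p.+1 * j + p.-1).+1 by lia.
  rewrite {1}e sum_n_Sm; last lia.
  rewrite -e last_term (sum_n_m_ext_loc _ (fun _ => 0)).
    by rewrite sum_n_m_const Rmult_0_r; exact: Rplus_0_l.
  move=> n /= hn; case: ifP => //.
  have -> : n.+1 = (p.+1 * j + (n.+1 - p.+1 * j))%N by lia.
  rewrite dvdn_addr ?dvdn_mulr // => /dvdn_leq; lia.
elim: k => [|k IH].
  by rewrite sum_O /sum_n -(block 0%N) muln0.
rewrite sum_Sn -IH /sum_n -[f (p.+1 * k.+2).-1](block k.+1).
rewrite (sum_n_m_Chasles _ 0 (p.+1 * k.+1).-1 (p.+1 * k.+2).-1); try lia.
congr plus; congr sum_n_m; lia.
Qed.

Lemma is_series_multiples (f : nat -> R) (p : nat) (l : R) : (0 < p)%N ->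
  is_series (fun n => if (p %| n.+1)%N then f n else 0) l ->
  is_series (fun m => f (p * m.+1).-1) l.
Proof.
move=> p0 h.
apply: (filterlim_ext (fun k => sum_n (fun n => if (p %| n.+1)%N then f n else 0) (p * k.+1).-1)).
  by move=> k; exact: sum_n_multiples.
apply: (filterlim_comp _ _ _ (fun k => (p * k.+1).-1) _ _ eventually) h.
move=> P [N hN]; exists N => k hk; apply: hN; nia.
Qed.

Definition coprime_to (E : seq nat) (m : nat) : bool := all (fun p => ~~ (p %| m)%N) E.

Definition coprime_term (E : seq nat) (t : R) (n : nat) : R :=
  (if coprime_to E n.+1 then 1 else 0) *
  ((1 - cos (2 * PI * (t * INR n.+1 ^ 2))) * weight delta n).

(** The function U_q of the introduction for q = prod E. *)
Definition coprime_sum (E : seq nat) (t : R) : R := Series (coprime_term E t).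

Definition kappa (E : seq nat) : R := foldr (fun p r => (1 - / INR p) * r) 1 E.

Lemma coprime_term_bounds (E : seq nat) (t : R) (n : nat) :
  0 <= coprime_term E t n <= 2 * weight delta n.
Proof.
rewrite /coprime_term; have w := weight_gt0 delta n.
have := one_sub_cos_bounds (2 * PI * (t * INR n.+1 ^ 2)).
by move: (1 - cos _) => x hx; case: coprime_to; split; nra.
Qed.

Lemma coprime_term_le_nil (E : seq nat) (t : R) (n : nat) : coprime_term E t n <= coprime_term [::] t n.
Proof.
have := coprime_term_bounds [::] t n; rewrite /coprime_term /=.
by move: (_ * weight _ _) => x hx; case: coprime_to; lra.
Qed.

Lemma ex_series_coprime_term (E : seq nat) (t : R) : ex_series (coprime_term E t).
Proof.
apply: (ex_series_le_weight delta delta_bounds _ 2) => n.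
by rewrite Rabs_pos_eq; apply coprime_term_bounds.
Qed.

Lemma coprime_sum_ge0 (E : seq nat) (t : R) : 0 <= coprime_sum E t.
Proof. by apply: Series_ge0; [move=> n; apply coprime_term_bounds | exact: ex_series_coprime_term]. Qed.

Lemma coprime_sum_le_nil (E : seq nat) (t : R) : coprime_sum E t <= coprime_sum [::] t.
Proof.
apply: Series_le; last exact: ex_series_coprime_term.
by move=> n; split; [apply coprime_term_bounds | exact: coprime_term_le_nil].
Qed.

Lemma coprime_sum_nil (t : R) : 0 < t ->
  coprime_sum [::] t = Rpower t (delta / 2) * riemann_series delta (sqrt t).
Proof.
move=> t0; have s0 : 0 < sqrt t by apply: sqrt_lt_R0.
have ht : Rpower t (delta / 2) = Rpower (sqrt t) delta.
  by rewrite -Rpower_sqrt // Rpower_mult; congr Rpower; field.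
rewrite ht /riemann_series -Series_scal_l; apply: Series_ext => n.
rewrite profile_scale // Rpower_Ropp /coprime_term [coprime_to _ _]/= Rmult_1_l pow2_sqrt; last lra.
by rewrite -[RHS]Rmult_assoc Rinv_r ?Rmult_1_l //; apply/Rgt_not_eq/Rpower_gt0.
Qed.

Lemma Rpower_sqr_mul (x t : R) : 0 < x -> 0 < t ->
  Rpower (x ^ 2 * t) (delta / 2) = Rpower x delta * Rpower t (delta / 2).
Proof.
move=> x0 t0; rewrite -Rpower_mult_distr //; last by apply: pow_lt.
by rewrite -(Rpower_pow 2 x x0) Rpower_mult; congr (Rpower _ _ * _); rewrite /=; field.
Qed.

(** Inclusion-exclusion in one prime: the terms with n = p m make up a rescaled copy
    of the sum. *)
Lemma coprime_sum_cons (p : nat) (E : seq nat) (t : R) : prime p -> all prime E -> p \notin E ->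
  coprime_sum (p :: E) t = coprime_sum E t - / Rpower (INR p) (1 + delta) * coprime_sum E (INR p ^ 2 * t).
Proof.
move=> pp aE pE; have p0 := prime_gt0 pp.
have ip : 0 < INR p by apply: lt_0_INR; lia.
have ex : ex_series (fun n => if (p %| n.+1)%N then coprime_term E t n else 0).
  apply: (ex_series_le_weight delta delta_bounds _ 2) => n.
  have h := coprime_term_bounds E t n; have := weight_gt0 delta n.
  by case: ifP => _ w; split_Rabs; lra.
have hs : Series (fun n => if (p %| n.+1)%N then coprime_term E t n else 0) =
    / Rpower (INR p) (1 + delta) * coprime_sum E (INR p ^ 2 * t).
  rewrite -[LHS](is_series_unique _ _ (is_series_multiples p0 (Series_correct _ ex))).
  rewrite -Series_scal_l; apply: Series_ext => m.
  have e : (p * m.+1).-1.+1 = (p * m.+1)%N by rewrite prednK ?muln_gt0 ?p0.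
  rewrite /coprime_term e /weight e mult_INR -Rpower_mult_distr //; last exact: INR_S_gt0.
  have -> : coprime_to E (p * m.+1) = coprime_to E m.+1.
    elim: E aE pE {ex} => //= r E IH /andP[rp aE]; rewrite inE negb_or => /andP[pr pE].
    by rewrite Euclid_dvdM // dvdn_prime2 // eq_sym (negbTE pr) IH.
  have -> : t * (INR p * INR m.+1) ^ 2 = INR p ^ 2 * t * INR m.+1 ^ 2 by ring.
  rewrite Rinv_mult; ring.
rewrite -hs -Series_minus //; last exact: ex_series_coprime_term.
apply: Series_ext => n; rewrite /coprime_term /=.
by case: (p %| n.+1)%N => /=; ring.
Qed.

(** The bound is uniform in the set of primes, because removing terms decreases the
    sum. *)
Lemma coprime_sum_bound : exists c, 0 < c /\
  forall E t, 0 < t -> coprime_sum E t <= c * Rpower t (delta / 2).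
Proof.
have [I [I0 hI]] := riemann_series_limit delta delta_bounds.
have [d [d0 hd]] := hI 1 Rlt_0_1.
have wS := ex_series_weight delta delta_bounds.
have w0 : 0 <= Series (weight delta).
  by apply: Series_ge0 => // n; apply/Rlt_le/weight_gt0.
pose c2 := 2 * Series (weight delta) / Rpower (d ^ 2) (delta / 2).
have c20 : 0 <= c2.
  apply: Rmult_le_pos; first lra.
  exact/Rlt_le/Rinv_0_lt_compat/Rpower_gt0.
exists (I + 1 + c2); split; first lra.
move=> E t t0; apply: (Rle_trans _ _ _ (coprime_sum_le_nil E t)).
have tp := Rpower_gt0 t (delta / 2).
case: (Rlt_le_dec (sqrt t) d) => h.
  rewrite coprime_sum_nil //.
  have := hd (sqrt t) (conj (sqrt_lt_R0 _ t0) h) => /Rabs_le_between hh.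
  nra.
have td : d ^ 2 <= t.
  rewrite -(sqrt_sqrt t); last lra.
  by rewrite /= Rmult_1_r; apply: Rmult_le_compat; lra.
have h1 : coprime_sum [::] t <= 2 * Series (weight delta).
  rewrite -Series_scal_l; apply: Series_le; first by move=> n; exact: coprime_term_bounds.
  by apply: (ex_series_scal_l 2 (weight delta)).
have h2 : Rpower (d ^ 2) (delta / 2) <= Rpower t (delta / 2).
  apply: Rle_Rpower_l; first lra.
  by split=> //; apply: pow_lt.
have dp := Rpower_gt0 (d ^ 2) (delta / 2).
have h3 : 2 * Series (weight delta) = c2 * Rpower (d ^ 2) (delta / 2).
  by rewrite /c2; field; lra.
nra.
Qed.

(** Each prime p turns the factor t^(delta/2) into
    t^(delta/2) - p^(-1-delta) (p^2 t)^(delta/2) = (1 - 1/p) t^(delta/2). *)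
Lemma coprime_sum_asymptotics : exists I, 0 < I /\
  forall E, uniq E -> all prime E -> forall eps, 0 < eps ->
  exists t0, 0 < t0 /\ forall t, 0 < t < t0 ->
    Rabs (coprime_sum E t - I * kappa E * Rpower t (delta / 2)) <= eps * Rpower t (delta / 2).
Proof.
have [I [I0 hI]] := riemann_series_limit delta delta_bounds.
exists I; split=> //.
elim=> [|p E IH] /=.
  move=> _ _ eps e0; have [d [d0 hd]] := hI eps e0.
  exists (d ^ 2); split; first exact: pow_lt.
  move=> t [t0 td]; rewrite coprime_sum_nil // Rmult_1_r.
  have sd : sqrt t < d.
    by rewrite -(sqrt_pow2 d); [apply: sqrt_lt_1; lra | lra].
  have := hd (sqrt t) (conj (sqrt_lt_R0 _ t0) sd) => /Rabs_le_between hh.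
  have tp := Rpower_gt0 t (delta / 2).
  apply/Rabs_le_between; nra.
case/andP=> pE uE /andP[pp aE] eps e0.
have ip : 1 <= INR p by rewrite -[1]/(INR 1); apply: le_INR; have := prime_gt0 pp; lia.
have e2 : 0 < eps / 2 by lra.
have [t1 [t10 h1]] := IH uE aE (eps / 2) e2.
have p2 : 1 <= INR p ^ 2 by rewrite /= Rmult_1_r; nra.
exists (t1 / INR p ^ 2); split; first by apply: Rdiv_lt_0_compat; lra.
move=> t [t0 tt].
have tt1 : INR p ^ 2 * t < t1.
  have -> : t1 = INR p ^ 2 * (t1 / INR p ^ 2) by field; lra.
  by apply: Rmult_lt_compat_l; lra.
have ha : Rabs (coprime_sum E t - I * kappa E * Rpower t (delta / 2)) <= eps / 2 * Rpower t (delta / 2).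
  by apply: h1; split=> //; nra.
have hb : Rabs (coprime_sum E (INR p ^ 2 * t) - I * kappa E * Rpower (INR p ^ 2 * t) (delta / 2)) <=
    eps / 2 * Rpower (INR p ^ 2 * t) (delta / 2).
  by apply: h1; split=> //; nra.
rewrite Rpower_sqr_mul // in hb; try lra.
rewrite coprime_sum_cons // Rpower_plus Rpower_1; last lra.
have q0 := Rpower_gt0 (INR p) delta.
move: (coprime_sum E (INR p ^ 2 * t)) (coprime_sum E t) (Rpower t (delta / 2)) (Rpower_gt0 t (delta / 2)) ha hb.
move=> u2 u1 T T0 ha hb.
have hc : Rabs (/ (INR p * Rpower (INR p) delta) * u2 - I * kappa E * T / INR p) <= eps / 2 * T.
  have -> : / (INR p * Rpower (INR p) delta) * u2 - I * kappa E * T / INR p =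
     / (INR p * Rpower (INR p) delta) * (u2 - I * kappa E * (Rpower (INR p) delta * T)).
    by field; lra.
  have i0 : 0 < / (INR p * Rpower (INR p) delta) by apply: Rinv_0_lt_compat; nra.
  rewrite Rabs_mult (Rabs_pos_eq (/ _)); last lra.
  apply: Rle_trans (Rmult_le_compat_l _ _ _ (Rlt_le _ _ i0) hb) _.
  have -> : / (INR p * Rpower (INR p) delta) * (eps / 2 * (Rpower (INR p) delta * T)) =
    eps / 2 * T * / INR p by field; lra.
  have : / INR p <= 1 by rewrite -Rinv_1; apply: Rinv_le_contravar; lra.
  have : 0 < eps / 2 * T by nra.
  nra.
have -> : I * ((1 - / INR p) * kappa E) * T = I * kappa E * T - I * kappa E * T / INR p.
  by field; lra.
move/Rabs_le_between: ha => ha; move/Rabs_le_between: hc => hc; apply/Rabs_le_between; lra.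
Qed.

(** A large prime hardly changes the sum, uniformly in t.  This allows the prime l
    to vary while t0 in [coprime_sum_asymptotics] depends on the fixed primes only. *)
Lemma coprime_sum_cons_close (c : R) (p : nat) (E : seq nat) (t : R) :
  (forall E t, 0 < t -> coprime_sum E t <= c * Rpower t (delta / 2)) ->
  prime p -> all prime E -> p \notin E -> 0 < t ->
  Rabs (coprime_sum (p :: E) t - coprime_sum E t) <= c / INR p * Rpower t (delta / 2).
Proof.
move=> hc pp aE pE t0; rewrite coprime_sum_cons //.
have ip : 0 < INR p by apply: lt_0_INR; have := prime_gt0 pp; lia.
have h0 := coprime_sum_ge0 E (INR p ^ 2 * t).
have h1 : coprime_sum E (INR p ^ 2 * t) <= c * Rpower (INR p ^ 2 * t) (delta / 2).
  by apply: hc; apply: Rmult_lt_0_compat => //; apply: pow_lt.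
rewrite Rpower_sqr_mul // in h1.
have q0 := Rpower_gt0 (INR p) delta.
have i0 : 0 < / Rpower (INR p) (1 + delta) by apply/Rinv_0_lt_compat/Rpower_gt0.
have -> : c / INR p * Rpower t (delta / 2) =
   / Rpower (INR p) (1 + delta) * (c * (Rpower (INR p) delta * Rpower t (delta / 2))).
  by rewrite Rpower_plus Rpower_1 //; field; lra.
set x := / Rpower _ _ * coprime_sum _ _.
have x0 : 0 <= x by apply: Rmult_le_pos => //; lra.
have xle : x <= / Rpower (INR p) (1 + delta) * (c * (Rpower (INR p) delta * Rpower t (delta / 2))).
  by apply: Rmult_le_compat_l; lra.
by apply/Rabs_le_between; lra.
Qed.
End CoprimeSums.

(** * Choosing the auxiliary primes *)

Section Selection.
Import all_boot zify SumNotations.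
#[local] Set Implicit Arguments.
#[local] Unset Strict Implicit.

(** All sublists of a duplicate-free list, that is, all subsets. *)
Fixpoint subs (R : seq nat) : seq (seq nat) :=
  if R is r :: R' then subs R' ++ [seq r :: E | E <- subs R'] else [:: [::]].

Lemma size_subs (R : seq nat) : size (subs R) = (2 ^ size R)%N.
Proof.
elim: R => //= r R IH; rewrite size_cat size_map IH expnS; lia.
Qed.

Lemma subs_subseq (R E : seq nat) : E \in subs R -> subseq E R.
Proof.
elim: R E => [|r R IH] E /=; first by rewrite inE.
rewrite mem_cat => /orP[/IH h|/mapP[E' /IH h ->]].
  exact: (subseq_trans h (subseq_cons _ _)).
by rewrite eqxx.
Qed.

Lemma subs_odd_primes (R E : seq nat) : odd_primes R -> E \in subs R -> odd_primes E.
Proof.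
case/andP=> uR aR /subs_subseq s; apply/andP; split; first exact: subseq_uniq s uR.
by apply/allP => p /(mem_subseq s); exact: (allP aR).
Qed.

Lemma subs_prodl (R E : seq nat) : E \in subs R -> (prodl E %| prodl R)%N.
Proof.
elim: R E => [|r R IH] E /=; first by rewrite inE => /eqP ->.
rewrite mem_cat => /orP[/IH h|/mapP[E' /IH h ->]]; first exact: dvdn_mull.
by rewrite /= dvdn_mul.
Qed.

Lemma sum_subs (R : seq nat) (z : Z) :
  \big[Rplus/0]_(E <- subs R) chiE E z = \big[Rmult/1]_(r <- R) (1 + chi r z).
Proof.
elim: R => [|r R IH]; first by rewrite /= big_cons !big_nil /= Rplus_0_r.
rewrite [subs _]/= big_cat big_map big_cons -IH [LHS]/=.
have -> : \big[Rplus/0]_(E <- subs R) chiE (r :: E) z =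
    chi r z * \big[Rplus/0]_(E <- subs R) chiE E z by rewrite big_distrr.
ring.
Qed.

(** The bound on the size keeps [kappa] of the chosen primes close to 1 once B is
    large. *)
Lemma select_primes (ks : seq Z) (d : Z) (B : nat) : exists R : seq nat,
  [/\ uniq R, all (fun r => prime r && (B < r)%N) R, (size R <= size ks)%N &
   forall k, k \in ks -> (forall m : Z, (m * m)%Z <> (d * k)%Z) ->
     exists2 r, r \in R & chi r (d * k) = -1].
Proof.
elim: ks => [|k ks [R [uR aR sR hR]]]; first by exists [::].
have [sq|nsq] := classic (exists m : Z, (m * m)%Z = (d * k)%Z).
  exists R; split=> //=; first exact: leqW.
  move=> k'; rewrite inE => /orP[/eqP -> h|]; last exact: hR.
  by case: sq => m hm; case: (h m).
have [r [pr Br hr]] : exists p, [/\ prime p, (B + \max_(r <- R) r < p)%N & chi p (d * k) = -1].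
  by apply: nonresidue_exists => m hm; apply: nsq; exists m.
exists (r :: R); split=> //=.
- rewrite uR andbT; apply/negP => rR.
  have : (r <= \max_(r <- R) r)%N by apply: leq_bigmax_seq.
  lia.
- by rewrite pr aR andbT; lia.
move=> k'; rewrite inE => /orP[/eqP -> _|kR hk]; first by exists r; rewrite ?inE ?eqxx.
by have [r' r'R h] := hR k' kR hk; exists r'; rewrite // inE r'R orbT.
Qed.

Definition is_square_mul (d k : Z) : bool :=
  is_left (excluded_middle_informative (exists m : Z, (m * m)%Z = (d * k)%Z)).

Lemma is_square_mulP (d k : Z) :
  reflect (exists m : Z, (m * m)%Z = (d * k)%Z) (is_square_mul d k).
Proof.
rewrite /is_square_mul; case: excluded_middle_informative => h /=; by constructor.
Qed.

Lemma Cmod_csum_le (T : Type) (s : seq T) (P : pred T) (F : T -> C) :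
  Cmod (\big[Cplus/RtoC 0]_(i <- s | P i) F i) <= \big[Rplus/0]_(i <- s | P i) Cmod (F i).
Proof.
elim/big_rec2: _ => [|i x y _ h]; first by rewrite Cmod_0; lra.
by apply: Rle_trans (Cmod_triangle _ _) _; lra.
Qed.

Lemma RtoC_rsum (T : Type) (s : seq T) (P : pred T) (F : T -> R) :
  RtoC (\big[Rplus/0]_(i <- s | P i) F i) = \big[Cplus/RtoC 0]_(i <- s | P i) RtoC (F i).
Proof. by elim/big_rec2: _ => // i x y _ <-; rewrite RtoC_plus. Qed.

(** The average of chi(d) times the right-hand sum over all E in [subs Ps] is the
    left-hand sum, because sum_E chi_E(d k) = prod_r (1 + chi_r(d k)) is 2^|Ps|
    or 0 according as d k is a square or not. *)
Lemma average_twist (Ps : seq nat) (ks : seq Z) (d : Z) (v : Z -> C) (chi0 : Z -> R) :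
  odd_primes Ps ->
  (forall k, chi0 (d * k)%Z = chi0 d * chi0 k) -> Rabs (chi0 d) <= 1 ->
  (forall r, r \in Ps -> ~ Z.divide r%:Z d) ->
  (forall k, k \in ks -> (forall m : Z, (m * m)%Z <> (d * k)%Z) ->
     exists2 r, r \in Ps & chi r (d * k) = -1) ->
  (forall k, k \in ks -> is_square_mul d k ->
     chi0 (d * k)%Z = 1 /\ forall r, r \in Ps -> chi r (d * k) = 1) ->
  exists2 E, E \in subs Ps &
    Cmod (\big[Cplus/RtoC 0]_(k <- ks | is_square_mul d k) v k) <=
    Cmod (\big[Cplus/RtoC 0]_(k <- ks) (v k * RtoC (chi0 k * chiE E k))%C).
Proof.
move=> oR mul0 abs0 Rd hnsq hsq; apply: NNPP => hno.
set A := Cmod _ in hno.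
pose b E := \big[Cplus/RtoC 0]_(k <- ks) (v k * RtoC (chi0 k * chiE E k))%C.
have lt E : E \in subs Ps -> Cmod (b E) < A.
  move=> hE; case: (Rlt_le_dec (Cmod (b E)) A) => // h.
  by case: hno; exists E => //; exact: h.
pose tot := \big[Cplus/RtoC 0]_(E <- subs Ps) (RtoC (chi0 d * chiE E d) * b E)%C.
have tot_eq : tot = (RtoC (2 ^ size Ps) * \big[Cplus/RtoC 0]_(k <- ks | is_square_mul d k) v k)%C.
  transitivity (\big[Cplus/RtoC 0]_(k <- ks) \big[Cplus/RtoC 0]_(E <- subs Ps)
      (v k * RtoC (chi0 (d * k)%Z * chiE E (d * k)%Z))%C).
    rewrite exchange_big /=; apply: eq_big_seq => E hE.
    rewrite big_distrr /=; apply: eq_bigr => k _.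
    rewrite mul0 chiE_mul ?(subs_odd_primes oR) // !RtoC_mult; ring.
  transitivity (\big[Cplus/RtoC 0]_(k <- ks)
      (if is_square_mul d k then RtoC (2 ^ size Ps) * v k else 0)%C); last first.
    by rewrite -big_mkcond big_distrr.
  apply: eq_big_seq => k hk.
  pose prod := \big[Rmult/1]_(r <- Ps) (1 + chi r (d * k)).
  have -> : \big[Cplus/RtoC 0]_(E <- subs Ps) (v k * RtoC (chi0 (d * k)%Z * chiE E (d * k)%Z))%C =
     (v k * RtoC (chi0 (d * k)%Z * prod))%C.
    rewrite /prod -sum_subs RtoC_mult RtoC_rsum !big_distrr /=.
    by apply: eq_bigr => E _; rewrite RtoC_mult.
  case: (boolP (is_square_mul d k)) => [sq|nsq].
    have [-> h1] := hsq k hk sq.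
    rewrite Rmult_1_l Cmult_comm; congr (RtoC _ * _)%C.
    rewrite /prod; elim: (Ps) h1 => [|r Ps' IH] h1; first by rewrite big_nil.
    rewrite big_cons h1 ?inE ?eqxx // IH /=; first by ring.
    by move=> r' hr'; rewrite h1 // inE hr' orbT.
  have [r rP hr] : exists2 r, r \in Ps & chi r (d * k) = -1.
    by apply: hnsq => // m hm; case/negP: nsq; apply/is_square_mulP; exists m.
  have -> : prod = 0; rewrite /prod.
    elim: (Ps) rP => //= r' Ps' IH; rewrite inE big_cons => /orP[/eqP <-|/IH ->].
      by rewrite hr Rplus_opp_r Rmult_0_l.
    by rewrite Rmult_0_r.
  by rewrite Rmult_0_r Cmult_0_r.
have h1 : Cmod tot = 2 ^ size Ps * A.
  rewrite tot_eq Cmod_mult Cmod_R Rabs_pos_eq //; apply: pow_le; lra.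
have h2 : Cmod tot <= \big[Rplus/0]_(E <- subs Ps) Cmod (b E).
  apply: Rle_trans (Cmod_csum_le _ _ _) _.
  apply: rsum_le => E hE; rewrite Cmod_mult Cmod_R Rabs_mult.
  have hc := chiE_abs E d.
  have := Cmod_ge_0 (b E); have := Rabs_pos (chi0 d); have := Rabs_pos (chiE E d).
  move=> p1 p2 p3.
  have : Rabs (chi0 d) * Rabs (chiE E d) <= 1 by nra.
  nra.
have [E0 hE0] : exists E0, E0 \in subs Ps.
  by elim: (Ps) => [|r Ps' [E0 h0]]; [exists [::] | exists E0; rewrite mem_cat h0].
pose mx := \big[Rmax/Cmod (b E0)]_(E <- subs Ps) Cmod (b E).
have mx_ge E : E \in subs Ps -> Cmod (b E) <= mx.
  rewrite /mx; elim: (subs Ps) => //= E' s IH; rewrite inE big_cons => /orP[/eqP ->|/IH h].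
    exact: Rmax_l.
  exact: Rle_trans h (Rmax_r _ _).
have mx_lt : mx < A.
  rewrite /mx big_seq; elim/big_ind: _ => [|x y hx hy|E hE]; try exact: lt.
  by apply: Rmax_lub_lt.
have h3 : \big[Rplus/0]_(E <- subs Ps) Cmod (b E) <= mx * INR (size (subs Ps)).
  exact: rsum_le_const.
have h4 : INR (size (subs Ps)) = 2 ^ size Ps.
  by rewrite size_subs INR_expn.
have h5 : 0 < 2 ^ size Ps by apply: pow_lt; lra.
rewrite h4 in h3; nra.
Qed.
End Selection.

(** * Twisted sums of second differences of partial sums *)

Lemma conj_coefficient (g : R -> R) (c : Z -> C) (k : Z) :
  is_fourier_expansion (fun x => RtoC (g x)) c -> c (- k)%Z = Cconj (c k).
Proof.
  intros [h _].
  assert (hf : forall j : Z,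
    is_RInt (fun x => g x * cos (2 * PI * (- IZR j * x))) 0 1 (fst (c j)) /\
    is_RInt (fun x => g x * sin (2 * PI * (- IZR j * x))) 0 1 (snd (c j))).
  { intros j; specialize (h j); split.
    - apply (is_RInt_ext (fun x => fst (Cmult (RtoC (g x)) (cis (- IZR j * x))))).
      + intros x _; unfold cis, Cmult, RtoC; simpl; ring.
      + now apply (is_RInt_fct_extend_fst (U := R_NormedModule) (V := R_NormedModule)).
    - apply (is_RInt_ext (fun x => snd (Cmult (RtoC (g x)) (cis (- IZR j * x))))).
      + intros x _; unfold cis, Cmult, RtoC; simpl; ring.
      + now apply (is_RInt_fct_extend_snd (U := R_NormedModule) (V := R_NormedModule)). }
  destruct (hf k) as [h1 h2]; destruct (hf (- k)%Z) as [h3 h4].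
  assert (e1 : fst (c (- k)%Z) = fst (c k)).
  { rewrite <- (is_RInt_unique _ _ _ _ h1), <- (is_RInt_unique _ _ _ _ h3).
    apply RInt_ext; intros x _; rewrite opp_IZR.
    replace (2 * PI * (- IZR k * x)) with (- (2 * PI * (- - IZR k * x))) by ring.
    now rewrite cos_neg. }
  assert (e2 : snd (c (- k)%Z) = - snd (c k)).
  { rewrite <- (is_RInt_unique _ _ _ _ h4).
    apply is_RInt_unique.
    apply (is_RInt_ext (fun x => opp (g x * sin (2 * PI * (- IZR k * x))))).
    - intros x _; rewrite opp_IZR.
      replace (2 * PI * (- - IZR k * x)) with (- (2 * PI * (- IZR k * x))) by ring.
      rewrite sin_neg; unfold opp; simpl; ring.
    - now apply (is_RInt_opp (V := R_NormedModule)). }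
  destruct (c (- k)%Z); simpl in *; unfold Cconj; congruence.
Qed.

Section Twisting.
Import all_boot zify SumNotations.
#[local] Set Implicit Arguments.
#[local] Unset Strict Implicit.

Lemma csum_recr (n : nat) (F : nat -> C) :
  \csum_(i < n.+1) F i = (\csum_(i < n) F i + F n)%C.
Proof. by rewrite big_ord_recr. Qed.

Lemma csum_lin (n : nat) (u X Y : nat -> C) (w c1 c2 : C) :
  \csum_(a < n) (u a * (w * (c1 * X a + c2 * Y a))) =
  (w * (c1 * (\csum_(a < n) (u a * X a)) + c2 * (\csum_(a < n) (u a * Y a))))%C.
Proof.
elim: n => [|n IH]; first by rewrite !big_ord0; ring.
rewrite (csum_recr n (fun a => u a * (w * (c1 * X a + c2 * Y a)))%C) IH.
by rewrite (csum_recr n (fun a => u a * X a)%C) (csum_recr n (fun a => u a * Y a)%C); ring.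
Qed.

Lemma sum_n_big (f : nat -> C) (n : nat) : sum_n f n = \csum_(i < n.+1) f i.
Proof.
elim: n => [|n IH]; first by rewrite sum_O big_ord_recl big_ord0 Cplus_0_r.
by rewrite sum_Sn IH [RHS]big_ord_recr.
Qed.

Lemma sum_n_bigR (f : nat -> R) (n : nat) : sum_n f n = \big[Rplus/0]_(i < n.+1) f i.
Proof.
elim: n => [|n IH]; first by rewrite sum_O big_ord_recl big_ord0 Rplus_0_r.
by rewrite sum_Sn IH [RHS]big_ord_recr.
Qed.

(** The frequencies k and -k are taken together, so that the symmetric partial sums
    become ordinary ones. *)
Definition pair_term (c : Z -> C) (x : R) (j : nat) : C :=
  (c j.+1%:Z * cis (IZR j.+1%:Z * x) + c (- j.+1%:Z)%Z * cis (IZR (- j.+1%:Z) * x))%C.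

Definition fourier_sum (c : Z -> C) (N : nat) (x : R) : C :=
  (c 0%Z + \csum_(j < N) pair_term c x j)%C.

Lemma symmetric_sum (f : Z -> C) (N : nat) :
  \csum_(i < (2 * N).+1) f (i%:Z - N%:Z)%Z =
  (f 0%Z + \csum_(j < N) (f j.+1%:Z + f (- j.+1%:Z)%Z))%C.
Proof.
rewrite -(big_mkord xpredT (fun i => f (i%:Z - N%:Z)%Z)).
rewrite -(big_mkord xpredT (fun j => f j.+1%:Z + f (- j.+1%:Z)%Z)%C).
elim: N => [|N IH]; first by rewrite big_nat1 big_geq // Cplus_0_r.
have -> : (2 * N.+1).+1 = (2 * N).+1.+2 by lia.
rewrite big_nat_recl // big_nat_recr // [in RHS]big_nat_recr //.
rewrite [RHS]Cplus_assoc -IH.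
rewrite (eq_bigr (fun i => f (i%:Z - N%:Z)%Z)); last by move=> i _; congr f; lia.
have -> : (0%N%:Z - N.+1%:Z)%Z = (- N.+1%:Z)%Z by lia.
have -> : ((2 * N).+2%:Z - N.+1%:Z)%Z = N.+1%:Z by lia.
set S := \big[Cplus/RtoC 0]_(_ <= _ < _) _.
rewrite [Monoid.Law.sort _ _]/=; ring.
Qed.

Lemma fourier_sumE (c : Z -> C) (N : nat) (x : R) :
  sum_n (fun j => let k := (j%:Z - N%:Z)%Z in Cmult (c k) (cis (IZR k * x))) (2 * N) =
  fourier_sum c N x.
Proof.
rewrite sum_n_big (symmetric_sum (fun k => c k * cis (IZR k * x))%C) /fourier_sum.
by rewrite Rmult_0_l (cis_int 0) Cmult_1_r.
Qed.

Definition second_diffC (f : R -> C) (x h : R) : C := (f (Rplus x h) + f (Rminus x h) - 2 * f x)%C.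

(** Second differences act diagonally on exponentials. *)
Lemma second_diffC_cis (s x h : R) :
  second_diffC (fun y => cis (s * y)) x h =
  (cis (s * x) * RtoC (- 2 * (1 - cos (2 * PI * (s * h)))))%C.
Proof.
rewrite /second_diffC.
have -> : s * (x + h) = s * x + s * h by ring.
have -> : s * (x - h) = s * x + - (s * h) by ring.
rewrite !cis_add cis_opp.
have -> : RtoC (- 2 * (1 - cos (2 * PI * (s * h)))) = (cis (s * h) + Cconj (cis (s * h)) - 2)%C.
  rewrite /cis /Cconj /RtoC /Cplus /Cminus /Copp /=; congr (_, _) => /=; ring.
ring.
Qed.

Lemma chiE_sqr (E : seq nat) (m : nat) : all prime E ->
  chiE E (m%:Z * m%:Z) = if coprime_to E m then 1 else 0.
Proof.
elim: E => //= p E IH /andP[pp aE]; rewrite IH // /coprime_to /=.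
case: (boolP (p %| m)%N) => [pm|npm] /=.
  case: (chi_values p (m%:Z * m%:Z)) => -[-> h]; first by rewrite Rmult_0_l.
    by case: h; apply: Z.divide_mul_l; apply/dvd_natP.
  by case: h; apply: Z.divide_mul_l; apply/dvd_natP.
rewrite chi_sqr ?Rmult_1_l // -Nat2Z.inj_mul => /dvd_natP.
by rewrite Euclid_dvdM // (negbTE npm).
Qed.

Definition mode_diff (k : Z) (m : nat) (x h : R) : C :=
  second_diffC (fun y => cis (IZR k * (INR m ^ 2 * y))) x h.

Section Identity.
Variables (delta : R) (c : Z -> C) (E : seq nat) (g0 : C).
Hypothesis oE : odd_primes E.
Hypothesis sep : separates (prodl E) (chiE E) g0.
Let q := prodl E.

Let point (a : nat) : R := INR a / INR q.

Let q_neq0 : INR q <> 0.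
Proof. by apply: not_0_INR; have := prodl_gt0 oE; rewrite -/q; lia. Qed.

(** The factor chi_E(k n^2) of the Gauss sum separates into chi_E(k) and the
    condition that n is coprime to q. *)
Lemma twisted_cis (k : Z) (m : nat) (h : R) :
  \csum_(a < q) (chiE E a%:Z * mode_diff k m (point a) h) =
  (- 2 * g0 * (RtoC (chiE E k) *
    RtoC ((if coprime_to E m then 1 else 0) * (1 - cos (2 * PI * (IZR k * (INR m ^ 2 * h)))))))%C.
Proof.
transitivity (\csum_(a < q) (chiE E a%:Z * e ((k * (m%:Z * m%:Z)) * a%:Z) q *
   RtoC (- 2 * (1 - cos (2 * PI * (IZR k * INR m ^ 2 * h)))))).
  apply: eq_bigr => a _.
  have -> : mode_diff k m (point a) h =
     second_diffC (fun y => cis (IZR k * INR m ^ 2 * y)) (point a) h.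
    by rewrite /mode_diff /second_diffC -!Rmult_assoc.
  rewrite second_diffC_cis Cmult_assoc; congr (_ * cis _ * _)%C.
  rewrite /point !mult_IZR -!INR_IZR_INZ; field; exact: q_neq0.
rewrite [LHS](csum_mulr _ _ (fun a => chiE E a%:Z * e (k * (m%:Z * m%:Z) * a%:Z) q)%C).
rewrite sep chiE_mul // chiE_sqr; last first.
  by case/andP: oE => _ /allP ap; apply/allP => p /ap /andP[].
have -> : IZR k * (INR m ^ 2 * h) = IZR k * INR m ^ 2 * h by ring.
rewrite !RtoC_mult; ring.
Qed.

Definition twisted_coef (j : nat) : C :=
  (c j.+1%:Z * RtoC (chiE E j.+1%:Z) + c (- j.+1%:Z)%Z * RtoC (chiE E (- j.+1%:Z)))%C.

Definition twisted_sum (M N : nat) (h : R) : C :=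
  \csum_(a < q) (chiE E a%:Z * \csum_(n < M.+1)
     (weight delta n * second_diffC (fun y => fourier_sum c N (INR n.+1 ^ 2 * y)) (point a) h)).

Lemma second_diffC_fourier_sum (N n : nat) (x h : R) :
  second_diffC (fun y => fourier_sum c N (INR n.+1 ^ 2 * y)) x h =
  \csum_(j < N) (c j.+1%:Z * mode_diff j.+1%:Z n.+1 x h +
     c (- j.+1%:Z)%Z * mode_diff (- j.+1%:Z) n.+1 x h).
Proof.
pose F (j : nat) := (c j.+1%:Z * mode_diff j.+1%:Z n.+1 x h +
  c (- j.+1%:Z)%Z * mode_diff (- j.+1%:Z) n.+1 x h)%C.
rewrite -[RHS]/(\csum_(j < N) F j) /second_diffC /fourier_sum; elim: N => [|N IH].
  have e2 : RtoC 2 = (1 + 1)%C by rewrite -RtoC_plus; congr RtoC; lra.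
  by rewrite !big_ord0 e2; ring.
rewrite [RHS]csum_recr -IH !(csum_recr N (pair_term _ _)) /F /mode_diff /second_diffC /pair_term; ring.
Qed.

(** For each frequency the sum over n is a partial sum of U_q, as the cosine is even
    in k. *)
Lemma twisted_sumE (M N : nat) (h : R) :
  twisted_sum M N h =
  (- 2 * g0 * \csum_(j < N) (twisted_coef j * RtoC (sum_n (coprime_term delta E (INR j.+1 * h)) M)))%C.
Proof.
rewrite /twisted_sum.
transitivity (\csum_(n < M.+1) \csum_(j < N) (weight delta n *
  (c j.+1%:Z * (\csum_(a < q) (chiE E a%:Z * mode_diff j.+1%:Z n.+1 (point a) h)) +
   c (- j.+1%:Z)%Z * (\csum_(a < q) (chiE E a%:Z * mode_diff (- j.+1%:Z) n.+1 (point a) h))))).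
  under eq_bigr => a _ do rewrite big_distrr /=.
  rewrite exchange_big /=; apply: eq_bigr => n _.
  under eq_bigr => a _ do rewrite second_diffC_fourier_sum !big_distrr /=.
  rewrite exchange_big /=; apply: eq_bigr => j _.
  exact: (csum_lin q (fun a => RtoC (chiE E a%:Z))
    (fun a => mode_diff j.+1%:Z n.+1 (point a) h) (fun a => mode_diff (- j.+1%:Z) n.+1 (point a) h)).
rewrite exchange_big big_distrr; apply: eq_bigr => j _.
rewrite sum_n_bigR RtoC_rsum !big_distrr; apply: eq_bigr => n _.
rewrite !twisted_cis /coprime_term /twisted_coef.
have -> : cos (2 * PI * (IZR (- j.+1%:Z) * (INR n.+1 ^ 2 * h))) =
    cos (2 * PI * (INR j.+1 * h * INR n.+1 ^ 2)).
  rewrite -cos_neg opp_IZR -INR_IZR_INZ; congr cos; ring.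
have -> : 2 * PI * (IZR j.+1%:Z * (INR n.+1 ^ 2 * h)) = 2 * PI * (INR j.+1 * h * INR n.+1 ^ 2).
  rewrite -INR_IZR_INZ; ring.
rewrite !RtoC_mult.
move: (RtoC (chiE E j.+1%:Z)) (RtoC (chiE E (- j.+1%:Z))) (c j.+1%:Z) (c (- j.+1%:Z)%Z).
move: (RtoC (1 - cos _)) (RtoC (weight delta n)) (RtoC (if coprime_to E n.+1 then 1 else 0)).
move=> x1 x2 x3 x4 x5 x6 x7 /=; ring.
Qed.
End Identity.
End Twisting.

(** * Twisted sums of second differences of the limit function *)

Lemma Clim_plus (u v : nat -> C) (x y : C) :
  filterlim u eventually (locally x) -> filterlim v eventually (locally y) ->
  filterlim (fun n => Cplus (u n) (v n)) eventually (locally (Cplus x y)).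
Proof.
  intros hu hv.
  apply (filterlim_comp_2 (F := eventually) u v Cplus hu hv).
  apply (filterlim_plus (K := C_AbsRing) (V := C_NormedModule) x y).
Qed.

Lemma Clim_mult_l (a : C) (u : nat -> C) (x : C) :
  filterlim u eventually (locally x) ->
  filterlim (fun n => Cmult a (u n)) eventually (locally (Cmult a x)).
Proof.
  intros hu.
  apply (filterlim_comp _ _ _ u (Cmult a) eventually (locally x) (locally (Cmult a x)) hu).
  apply (filterlim_scal_r (K := C_AbsRing) (V := C_NormedModule) a x).
Qed.

Lemma Clim_real (u : nat -> R) (l : R) :
  is_lim_seq u l -> filterlim (fun n => RtoC (u n)) eventually (locally (RtoC l)).
Proof.
  intros h.
  apply (filterlim_locally (U := C_UniformSpace)); intros eps.
  destruct (proj1 (filterlim_locally (U := R_UniformSpace) u l) h eps) as [N hN].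
  exists N; intros n hn; split; [now apply hN | apply (ball_center (M := R_UniformSpace))].
Qed.

Lemma is_lim_seq_scal_fin (u : nat -> R) (a l : R) :
  is_lim_seq u l -> is_lim_seq (fun n => a * u n) (a * l).
Proof. intros h; apply (is_lim_seq_scal_l u a (Finite l) h). Qed.

Lemma Clim_mod_le (u : nat -> C) (x : C) (b : R) :
  filterlim u eventually (locally x) -> (forall n, Cmod (u n) <= b) -> Cmod x <= b.
Proof.
  intros hu hb.
  apply (is_lim_seq_le (fun n => Cmod (u n)) (fun _ => b) (Cmod x) b hb); [|apply is_lim_seq_const].
  apply (filterlim_comp _ _ _ u Cmod eventually (locally x) (locally (Cmod x)) hu).
  exact (@filterlim_norm C_AbsRing C_NormedModule x).
Qed.

Section TwistedLimit.
Import all_boot zify SumNotations.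
#[local] Set Implicit Arguments.
#[local] Unset Strict Implicit.

Lemma Clim_csum (n : nat) (u : nat -> nat -> C) (l : nat -> C) :
  (forall i, filterlim (u i) eventually (locally (l i))) ->
  filterlim (fun k => \csum_(i < n) u i k) eventually (locally (\csum_(i < n) l i)).
Proof.
move=> h; elim: n => [|n IH].
  rewrite big_ord0; apply: (filterlim_ext (fun _ => RtoC 0)); last exact: filterlim_const.
  by move=> k; rewrite big_ord0.
rewrite big_ord_recr; apply: (filterlim_ext (fun k => Cplus (\csum_(i < n) u i k) (u n k))).
  by move=> k; rewrite big_ord_recr.
exact: Clim_plus.
Qed.

Lemma csum_split (m n : nat) (F : nat -> C) :
  \csum_(i < m + n) F i = (\csum_(i < m) F i + \csum_(i < n) F (m + i)%N)%C.
Proof. by rewrite big_split_ord. Qed.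

Lemma partial_sum_le_Series (f : nat -> R) (n : nat) : (forall k, 0 <= f k) -> ex_series f ->
  \big[Rplus/0]_(i < n) f i <= Series f.
Proof.
move=> h ex; case: n => [|n]; first by rewrite big_ord0; exact: Series_ge0.
rewrite -sum_n_bigR.
apply: (is_lim_seq_incr_compare (sum_n f) (Series f)); first exact: Series_correct.
by move=> k; rewrite sum_Sn; have := h k.+1; rewrite /plus /=; lra.
Qed.

Variables (delta : R) (g : R -> R) (c : Z -> C).
Hypothesis delta_bounds : 0 < delta <= 1.
Hypothesis c_conj : forall k, Cmod (c (- k)%Z) = Cmod (c k).
Hypothesis c_sum : ex_series (fun j => Cmod (c j.+1%:Z) * Rpower (INR j.+1) (delta / 2)).
Hypothesis g_lim : forall x, filterlim (fun N => fourier_sum c N x) eventually (locally (RtoC (g x))).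

Let wc (j : nat) := Cmod (c j.+1%:Z) * Rpower (INR j.+1) (delta / 2).

Let wc_ge0 (j : nat) : 0 <= wc j.
Proof. by apply: Rmult_le_pos; [exact: Cmod_ge_0 | exact/Rlt_le/Rpower_gt0]. Qed.

Let c_le_wc (j : nat) : Cmod (c j.+1%:Z) <= wc j.
Proof.
have h := Cmod_ge_0 (c j.+1%:Z); have : 1 <= Rpower (INR j.+1) (delta / 2).
  rewrite -(Rpower_O (INR j.+1)); last exact: INR_S_gt0.
  apply: Rle_Rpower; last lra.
  by rewrite -[1]/(INR 1); apply: le_INR; lia.
rewrite /wc; nra.
Qed.

Lemma g_bounded : exists b, 0 <= b /\ forall x, Rabs (g x) <= b.
Proof.
have w0 : 0 <= Series wc by apply: Series_ge0.
exists (Cmod (c 0%Z) + 2 * Series wc); split; first by have := Cmod_ge_0 (c 0%Z); lra.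
move=> x; rewrite -Cmod_R; apply: (Clim_mod_le _ _ _ (@g_lim x)) => N.
apply: Rle_trans (Cmod_triangle _ _) _; apply: Rplus_le_compat_l.
apply: Rle_trans (Cmod_csum_le _ _ _) _.
apply: Rle_trans (_ : \big[Rplus/0]_(j < N) (2 * wc j) <= _); last first.
  by rewrite -big_distrr /=; apply: Rmult_le_compat_l; [lra | exact: partial_sum_le_Series].
apply: rsum_le => j _; apply: Rle_trans (Cmod_triangle _ _) _.
rewrite !Cmod_mult !Cmod_cis !Rmult_1_r c_conj; have := c_le_wc j; lra.
Qed.

Definition second_diff (f : R -> R) (x h : R) : R := f (x + h) + f (x - h) - 2 * f x.

Let Gsum (M : nat) (x : R) : R := sum_n (fun n => weight delta n * g (INR n.+1 ^ 2 * x)) M.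

Let Gsum_lim (x : R) : is_lim_seq (fun M => Gsum M x) (G delta g x).
Proof.
have [b [b0 hb]] := g_bounded.
have ex : ex_series (fun n => weight delta n * g (INR n.+1 ^ 2 * x)).
  apply: (ex_series_le_weight delta delta_bounds _ b) => n.
  have w := weight_gt0 delta n.
  rewrite Rabs_mult (Rabs_pos_eq (weight _ _)); last lra.
  by rewrite Rmult_comm; apply: Rmult_le_compat_r; [lra | exact: hb].
have -> : G delta g x = Series (fun n => weight delta n * g (INR n.+1 ^ 2 * x)).
  by apply: Series_ext => n; rewrite /weight /Rdiv [LHS]Rmult_comm.
exact: Series_correct.
Qed.

Variables (E : seq nat) (g0 : C).
Hypothesis oE : odd_primes E.
Hypothesis sep : separates (prodl E) (chiE E) g0.

Definition twisted_G (h : R) : R :=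
  \big[Rplus/0]_(a < prodl E) (chiE E a%:Z * second_diff (G delta g) (INR a / INR (prodl E)) h).

Let twisted_Gsum (M : nat) (h : R) : R :=
  \big[Rplus/0]_(a < prodl E) (chiE E a%:Z * second_diff (Gsum M) (INR a / INR (prodl E)) h).

Let twisted_Gsum_lim (h : R) :
  filterlim (fun M => RtoC (twisted_Gsum M h)) eventually (locally (RtoC (twisted_G h))).
Proof.
rewrite /twisted_G RtoC_rsum.
apply: (filterlim_ext (fun M => \csum_(a < prodl E) RtoC (chiE E a%:Z * second_diff (Gsum M) (INR a / INR (prodl E)) h))).
  by move=> M; rewrite RtoC_rsum.
apply: (Clim_csum (u := fun a M => RtoC (chiE E a%:Z * second_diff (Gsum M) (INR a / INR (prodl E)) h))
   (l := fun a => RtoC (chiE E a%:Z * second_diff (G delta g) (INR a / INR (prodl E)) h))) => a.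
apply: Clim_real; apply: is_lim_seq_scal_fin.
apply: is_lim_seq_minus'; last exact: is_lim_seq_scal_fin.
exact: is_lim_seq_plus'.
Qed.

Let twisted_sum_lim (M : nat) (h : R) :
  filterlim (fun N => twisted_sum delta c E M N h) eventually (locally (RtoC (twisted_Gsum M h))).
Proof.
have -> : RtoC (twisted_Gsum M h) = \csum_(a < prodl E) (chiE E a%:Z * \csum_(n < M.+1)
     (weight delta n * second_diffC (fun y => RtoC (g (INR n.+1 ^ 2 * y))) (INR a / INR (prodl E)) h)).
  rewrite /twisted_Gsum RtoC_rsum; apply: eq_bigr => a _.
  rewrite RtoC_mult; congr (_ * _)%C.
  rewrite /second_diff /Gsum !sum_n_bigR; elim: (M.+1) => [|k IH].
    by rewrite !big_ord0; congr RtoC; ring.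
  rewrite [RHS]big_ord_recr -IH !big_ord_recr /second_diffC.
  move: (weight delta k) (g _) (g _) (g _) => w g1 g2 g3.
  rewrite [RHS]/= -!RtoC_plus -RtoC_mult -RtoC_minus -RtoC_mult -RtoC_plus; congr RtoC.
  by rewrite [LHS]/=; ring.
pose u n a N := (weight delta n *
  second_diffC (fun y => fourier_sum c N (INR n.+1 ^ 2 * y)) (INR a / INR (prodl E)) h)%C.
pose l n a := (weight delta n *
  second_diffC (fun y => RtoC (g (INR n.+1 ^ 2 * y))) (INR a / INR (prodl E)) h)%C.
apply: (Clim_csum (u := fun a N => (chiE E a%:Z * \csum_(n < M.+1) u n a N)%C)
   (l := fun a => (chiE E a%:Z * \csum_(n < M.+1) l n a)%C)) => a.
apply: Clim_mult_l; apply: (Clim_csum (u := fun n N => u n a N) (l := fun n => l n a)) => n.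
apply: Clim_mult_l; rewrite /second_diffC /Cminus.
apply: Clim_plus; first by apply: Clim_plus; exact: g_lim.
have e2 : RtoC (-2) = (- RtoC 2)%C by rewrite -RtoC_opp.
apply: (filterlim_ext (fun N => RtoC (-2) * fourier_sum c N (INR n.+1 ^ 2 * (INR a / INR (prodl E))))%C).
  by move=> N; rewrite e2; ring.
have -> : (- (2 * g (INR n.+1 ^ 2 * (INR a / INR (prodl E)))))%C =
    (RtoC (-2) * g (INR n.+1 ^ 2 * (INR a / INR (prodl E))))%C by rewrite e2; ring.
apply: Clim_mult_l; exact: g_lim.
Qed.

(** The identity [twisted_sumE] truncated at frequency K, with the remaining
    frequencies bounded by means of U_q(t) <= b t^(delta/2).  The bound is proved
    for partial sums and passes to the limit first in the Fourier series and then
    in the series G. *)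
Lemma twisted_G_close (b : R) (K : nat) (h : R) : 0 < h ->
  (forall t, 0 < t -> coprime_sum delta E t <= b * Rpower t (delta / 2)) -> 0 <= b ->
  Cmod (twisted_G h + 2 * g0 * \csum_(j < K) (twisted_coef c E j * RtoC (coprime_sum delta E (INR j.+1 * h))))%C <=
  4 * Cmod g0 * b * Rpower h (delta / 2) * Series (fun j => wc (K + j)).
Proof.
move=> h0 hb b0; set bnd := (X in _ <= X).
have ex : ex_series (fun j => wc (K + j)) by apply/(ex_series_incr_n wc K).
have partial_le (M : nat) (t : R) : 0 < t -> 0 <= sum_n (coprime_term delta E t) M <= b * Rpower t (delta / 2).
  move=> t0; split; first by apply: sum_n_ge0 => n; apply coprime_term_bounds.
  apply: Rle_trans (hb t t0); rewrite sum_n_bigR; apply: partial_sum_le_Series.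
    by move=> n; apply coprime_term_bounds.
  exact: ex_series_coprime_term.
have coef_le (j : nat) : Cmod (twisted_coef c E j) <= 2 * Cmod (c j.+1%:Z).
  apply: Rle_trans (Cmod_triangle _ _) _; rewrite !Cmod_mult !Cmod_R c_conj.
  have := Cmod_ge_0 (c j.+1%:Z); have := chiE_abs E j.+1%:Z; have := chiE_abs E (- j.+1%:Z)%Z; nra.
have level (M N : nat) : Cmod (twisted_sum delta c E M (K + N) h +
    2 * g0 * \csum_(j < K) (twisted_coef c E j * RtoC (sum_n (coprime_term delta E (INR j.+1 * h)) M)))%C <= bnd.
  rewrite (twisted_sumE delta c oE sep).
  rewrite (csum_split K N (fun j => twisted_coef c E j * RtoC (sum_n (coprime_term delta E (INR j.+1 * h)) M))%C).
  set S1 := \csum_(j < K) _; set S2 := \csum_(j < N) _.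
  have -> : (- 2 * g0 * (S1 + S2) + 2 * g0 * S1 = - 2 * g0 * S2)%C by ring.
  rewrite !Cmod_mult Cmod_R; have -> : Rabs (-2) = 2 by rewrite Rabs_left; lra.
  have -> : bnd = 2 * Cmod g0 * (2 * b * Rpower h (delta / 2) * Series (fun j => wc (K + j))).
    by rewrite /bnd; ring.
  apply: Rmult_le_compat_l; first by have := Cmod_ge_0 g0; lra.
  apply: Rle_trans (Cmod_csum_le _ _ _) _.
  apply: Rle_trans (_ : \big[Rplus/0]_(j < N) (2 * b * Rpower h (delta / 2) * wc (K + j)) <= _); last first.
    rewrite -big_distrr /=; apply: Rmult_le_compat_l.
      by have := Rpower_gt0 h (delta / 2); nra.
    exact: (partial_sum_le_Series (f := fun j => wc (K + j))).
  apply: rsum_le => j _; rewrite Cmod_mult Cmod_R.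
  have j0 := INR_S_gt0 (K + j).
  have [s0 s1] := partial_le M (INR (K + j).+1 * h) (Rmult_lt_0_compat _ _ j0 h0).
  rewrite -Rpower_mult_distr // in s1.
  rewrite Rabs_pos_eq //.
  apply: Rle_trans (Rmult_le_compat _ _ _ _ (Cmod_ge_0 _) s0 (coef_le _) s1) _.
  by rewrite /wc; apply: Req_le; ring.
have level2 (M : nat) : Cmod (twisted_Gsum M h +
    2 * g0 * \csum_(j < K) (twisted_coef c E j * RtoC (sum_n (coprime_term delta E (INR j.+1 * h)) M)))%C <= bnd.
  apply: (Clim_mod_le _ _ _ _ (level M)).
  apply: Clim_plus; last exact: filterlim_const.
  apply: (filterlim_comp _ _ _ (fun N => (K + N)%N) (fun N => twisted_sum delta c E M N h) eventually eventually); last exact: twisted_sum_lim.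
  by move=> P [N hN]; exists N => n hn; apply: hN; lia.
apply: (Clim_mod_le _ _ _ _ level2).
apply: Clim_plus; first exact: twisted_Gsum_lim.
apply: Clim_mult_l.
apply: (Clim_csum (u := fun j M => (twisted_coef c E j * RtoC (sum_n (coprime_term delta E (INR j.+1 * h)) M))%C)
  (l := fun j => (twisted_coef c E j * RtoC (coprime_sum delta E (INR j.+1 * h)))%C)) => j.
apply: Clim_mult_l; apply: Clim_real; apply: Series_correct; exact: ex_series_coprime_term.
Qed.
End TwistedLimit.

(** * Large second differences at rational points *)

Section LowerBound.
Import all_boot zify SumNotations.
#[local] Set Implicit Arguments.
#[local] Unset Strict Implicit.

Definition signed_range (K : nat) : seq Z :=
  [seq j.+1%:Z | j <- iota 0 K] ++ [seq (- j.+1%:Z)%Z | j <- iota 0 K].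

Lemma sum_signed_range (K : nat) (F : Z -> C) :
  \big[Cplus/RtoC 0]_(k <- signed_range K) F k =
  \csum_(j < K) (F j.+1%:Z + F (- j.+1%:Z)%Z).
Proof.
have e : iota 0 K = index_iota 0 K by rewrite /index_iota subn0.
by rewrite big_cat !big_map e !big_mkord [RHS]big_split.
Qed.

Lemma mem_signed_range (K : nat) (k : Z) :
  (k \in signed_range K) = (0 <? Z.abs k)%Z && (Z.abs k <=? K%:Z)%Z.
Proof.
apply/idP/idP.
  by rewrite mem_cat => /orP[] /mapP[j]; rewrite mem_iota => hj ->; lia.
move=> h; rewrite mem_cat; apply/orP.
have [k0|k0] := Z.le_gt_cases 0 k; [left|right]; apply/mapP; exists (Z.abs_nat k).-1; rewrite ?mem_iota; lia.
Qed.

Lemma square_free_sqf (d : nat) : (0 < d)%N -> square_free d -> sqf d.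
Proof.
move=> d0 h; apply/allP => p; rewrite mem_primes => /and3P[pp _ _].
apply/negP => /dvdnP[k hk].
have p1 : p = 1%N by apply: h; exists k.
by rewrite p1 in pp.
Qed.

(** For square-free d, the product d k is a square exactly when k is d times a
    square. *)
Lemma square_multiples_sum (d M : nat) (v : Z -> C) : (0 < d)%N -> square_free d ->
  \big[Cplus/RtoC 0]_(k <- signed_range (M * M * d) | is_square_mul d%:Z k) v k =
  \csum_(m < M) v (m.+1 * m.+1 * d)%N%:Z.
Proof.
move=> d0 /(square_free_sqf d0) sd.
rewrite -big_filter -(big_mkord xpredT (fun m => v (m.+1 * m.+1 * d)%N%:Z)).
rewrite /index_iota subn0 -(big_map (fun m => (m.+1 * m.+1 * d)%N%:Z) xpredT v).
apply: perm_big; apply: uniq_perm.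
- rewrite filter_uniq // /signed_range cat_uniq !map_inj_uniq ?iota_uniq /=.
  + rewrite andbT -all_predC; apply/allP => k /mapP[j _ ->] /=.
    by apply/negP => /mapP[i _]; lia.
  + by move=> i j; lia.
  + by move=> i j; lia.
- rewrite map_inj_uniq ?iota_uniq // => i j /Nat2Z.inj /eqP.
  rewrite eqn_pmul2r // !mulnn eqn_sqr => /eqP; lia.
move=> k; rewrite mem_filter mem_signed_range; apply/idP/idP; last first.
  case/mapP=> m; rewrite mem_iota /= add0n => hm ->; apply/andP; split.
    by apply/is_square_mulP; exists (m.+1 * d)%N%:Z; nia.
  have h : (m.+1 * m.+1 * d <= M * M * d)%N by rewrite leq_mul2r leq_mul ?orbT.
  have h' : (0 < m.+1 * m.+1 * d)%N by rewrite !muln_gt0 d0.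
  lia.
case/andP=> /is_square_mulP[m hm] hk.
have k0 : (0 < k)%Z by nia.
have [t ht] : Z.divide d%:Z m.
  apply: sqf_dvd => // p pp pd.
  have : Z.divide p%:Z (m * m).
    by rewrite hm; apply: Z.divide_mul_l; apply/dvd_natP.
  move/Z.divide_abs_r; rewrite Z.abs_mul -!Zabs2Nat.id_abs -Nat2Z.inj_mul => /dvd_natP.
  rewrite Euclid_dvdM // orbb => /dvd_natP; rewrite Zabs2Nat.id_abs.
  by move/Z.divide_abs_r.
have kt : k = (d%:Z * (t * t))%Z.
  by apply: (Z.mul_reg_l _ _ d%:Z); [lia | rewrite -hm ht; ring].
have t0 : (0 < Z.abs t)%Z by nia.
have tM : (Z.abs t <= M%:Z)%Z.
  apply/Z.nlt_ge => h.
  have : (M%:Z * M%:Z < t * t)%Z by rewrite -(Z.abs_square t); nia.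
  have : (Z.abs k <= M%:Z * M%:Z * d%:Z)%Z by lia.
  rewrite kt; nia.
apply/mapP; exists (Z.abs_nat t).-1; first by rewrite mem_iota; lia.
have -> : (Z.abs_nat t).-1.+1 = Z.abs_nat t by lia.
rewrite kt !Nat2Z.inj_mul Zabs2Nat.id_abs Z.abs_square.
exact: Z.mul_comm.
Qed.

Lemma kappa_ge (D : nat) (E : seq nat) : (0 < D)%N -> all (fun p => (D <= p)%N) E ->
  0 <= kappa E <= 1 /\ 1 - INR (size E) / INR D <= kappa E.
Proof.
move=> D0; elim: E => [|p E IH]; first by move=> _; rewrite /= /Rdiv Rmult_0_l; lra.
case/andP=> Dp /IH [h1 h2].
rewrite -[kappa (p :: E)]/((1 - / INR p) * kappa E) -[size (p :: E)]/(size E).+1.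
have iD : 1 <= INR D by rewrite -[1]/(INR 1); apply: le_INR; lia.
have ip : INR D <= INR p by apply: le_INR; lia.
have i1 : 0 < / INR p by apply: Rinv_0_lt_compat; lra.
have i2 : / INR p <= / INR D by apply: Rinv_le_contravar; lra.
have i3 : / INR D <= 1 by rewrite -Rinv_1; apply: Rinv_le_contravar; lra.
have -> : INR (size E).+1 / INR D = INR (size E) / INR D + / INR D.
  by rewrite S_INR; field; lra.
split; [split|]; nra.
Qed.

Lemma chiE_coprime (E : seq nat) (a : nat) : all prime E -> chiE E a%:Z <> 0 ->
  coprime a (prodl E).
Proof.
elim: E => [|p E IH] /=; first by rewrite coprimen1.
case/andP=> pp aE h; rewrite coprimeMr IH // ?andbT.
  rewrite coprime_sym prime_coprime //; apply/negP => /dvd_natP pa; apply: h.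
  by case: (chi_values p a%:Z) => -[-> //] _; rewrite Rmult_0_l.
by move=> e; apply: h; rewrite e Rmult_0_r.
Qed.

(** Finitely many thresholds have a positive minimum. *)
Lemma uniform_small (Es : seq (seq nat)) (P : seq nat -> R -> Prop) :
  (forall E, E \in Es -> exists t0, 0 < t0 /\ forall t, 0 < t < t0 -> P E t) ->
  exists t0, 0 < t0 /\ forall E, E \in Es -> forall t, 0 < t < t0 -> P E t.
Proof.
elim: Es => [|E Es IH] h; first by exists 1; split; [lra | move=> E; rewrite in_nil].
have [|t1 [t10 h1]] := IH; first by move=> E' hE'; apply: h; rewrite inE hE' orbT.
have [|t2 [t20 h2]] := h E; first by rewrite inE eqxx.
exists (Rmin t1 t2); split; first by apply: Rmin_glb_lt.
have m1 := Rmin_l t1 t2; have m2 := Rmin_r t1 t2.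
move=> E'; rewrite inE => /orP[/eqP -> t ht|/h1 hE' t ht]; [apply: h2; lra | apply: hE'; lra].
Qed.

Lemma series_tail_small (f : nat -> R) (eps : R) : ex_series f -> (forall n, 0 <= f n) -> 0 < eps ->
  exists N, forall K, (N < K)%N -> 0 <= Series (fun j => f (K + j)%N) <= eps.
Proof.
move=> ex f0 e0; have h := Series_correct _ ex.
have [N hN] := proj1 (filterlim_locally (U := R_UniformSpace) _ _) h (mkposreal eps e0).
exists N => K NK.
have e : Series f = sum_n f K.-1 + Series (fun j => f (K + j)%N).
  by rewrite sum_n_Reals -(Series_incr_n f K) //; lia.
split; first by apply: Series_ge0; [move=> n; exact: f0 | apply/(ex_series_incr_n f K)].
have NK' : (N <= K.-1)%coq_nat by lia.
have := hN K.-1 NK'.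
rewrite /ball /= /AbsRing_ball /abs /minus /plus /opp /= => /Rabs_def2 [_ h2].
have h3 : - eps < sum_n f K.-1 - Series f := h2.
lra.
Qed.

Section Main.
Variables (delta : R) (g : R -> R) (c : Z -> C) (d : nat) (s : C).
Hypothesis delta_bounds : 0 < delta <= 1.
Hypothesis c_conj : forall k, Cmod (c (- k)%Z) = Cmod (c k).
Hypothesis c_sum : ex_series (fun j => Cmod (c j.+1%:Z) * Rpower (INR j.+1) (delta / 2)).
Hypothesis g_lim : forall x, filterlim (fun N => fourier_sum c N x) eventually (locally (RtoC (g x))).
Hypothesis d_gt0 : (0 < d)%N.
Hypothesis d_sqf : square_free d.

Let wc (j : nat) := Cmod (c j.+1%:Z) * Rpower (INR j.+1) (delta / 2).
Let v (k : Z) : C := (c k * RtoC (Rpower (INR (Z.abs_nat k)) (delta / 2)))%C.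

Hypothesis v_series : is_series (fun n => v (n.+1 * n.+1 * d)%N%:Z) s.
Hypothesis s_neq0 : s <> RtoC 0.

Let wc_ge0 (j : nat) : 0 <= wc j.
Proof. by apply: Rmult_le_pos; [exact: Cmod_ge_0 | exact/Rlt_le/Rpower_gt0]. Qed.

Lemma partial_v_large : exists N, forall M, (N < M)%N ->
  Cmod s / 2 <= Cmod (\csum_(m < M) v (m.+1 * m.+1 * d)%N%:Z).
Proof.
have h := filterlim_comp _ _ _ _ _ _ _ _ v_series (@filterlim_norm C_AbsRing C_NormedModule s).
have s0 : 0 < Cmod s by apply/Cmod_gt_0.
have e0 : 0 < Cmod s / 2 by lra.
have [N hN] := proj1 (filterlim_locally (U := R_UniformSpace) _ _) h (mkposreal _ e0).
exists N => -[//|M] NM; have NM' : (N <= M)%coq_nat by lia.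
have hb := hN M NM'.
have h2 : Rabs (Cmod (sum_n (fun n => v (n.+1 * n.+1 * d)%N%:Z) M) - Cmod s) < Cmod s / 2 := hb.
rewrite sum_n_big in h2; move/Rabs_def2: h2 => [_ h3]; lra.
Qed.

Lemma twisted_coef_sum (l K : nat) (E : seq nat) :
  \big[Cplus/RtoC 0]_(k <- signed_range K) (v k * RtoC (chi l k * chiE E k))%C =
  \csum_(j < K) (twisted_coef c (l :: E) j * RtoC (Rpower (INR j.+1) (delta / 2))).
Proof.
rewrite sum_signed_range; apply: eq_bigr => j _.
rewrite /v /twisted_coef.
have -> : Z.abs_nat j.+1%:Z = j.+1 by lia.
have -> : Z.abs_nat (- j.+1%:Z) = j.+1 by lia.
rewrite -![chi l _ * _]/(chiE (l :: E) _); ring.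
Qed.

Lemma prime_factor_le (Rs : seq nat) (r : nat) : odd_primes Rs -> r \in Rs -> (r <= prodl Rs)%N.
Proof.
move=> oR rR; apply: dvdn_leq; first exact: prodl_gt0.
elim: Rs rR {oR} => //= p Rs IH; rewrite inE => /orP[/eqP ->|/IH h]; [exact: dvdn_mulr | exact: dvdn_mull].
Qed.

(** The constants are chosen in the order K (frequency cut-off), Rs (auxiliary
    primes for the frequencies up to K), h0 (from the asymptotics of U for subsets
    of Rs) and L0 (so that l does not affect U), each independent of l and h. *)
Lemma second_differences_large : exists (c1 : R) (Q L0 : nat) (h0 : R),
  [/\ 0 < c1, (0 < Q)%N, 0 < h0 &
   forall l, prime l -> (L0 < l)%N -> forall h, 0 < h < h0 ->
   exists q, [/\ (l %| q)%N, (q %| l * Q)%N &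
     c1 * sqrt (INR l) * Rpower h (delta / 2) <=
     \big[Rplus/0]_(a < q | coprime a q) Rabs (second_diff (G delta g) (INR a / INR q) h)]].
Proof.
have s0 : 0 < Cmod s by apply/Cmod_gt_0.
have [I [I0 asym]] := coprime_sum_asymptotics delta_bounds.
have [b [b0 hb]] := coprime_sum_bound delta_bounds.
have W0 : 0 <= Series wc by apply: Series_ge0.
set W := Series wc in W0.
(* A lower bound for I * kappa * |B|, as kappa >= 1/2 and |B| >= |s| / 2; every
   error term is kept below a fraction of it. *)
pose a0 := I * Cmod s / 4.
have a00 : 0 < a0 by rewrite /a0; nra.
have tail0 : 0 < a0 / (8 * b) by apply: Rdiv_lt_0_compat; lra.
have [N1 hN1] := partial_v_large.
have [N2 hN2] := series_tail_small c_sum wc_ge0 tail0.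
pose M := (N1 + N2).+1; pose K := (M * M * d)%N.
have MK : (M <= K)%N by rewrite /K -mulnA leq_pmulr // muln_gt0 d_gt0.
have K0 : (0 < K)%N by apply: leq_trans MK.
(* Primes above 4 K give kappa >= 1/2, and primes above d K cannot divide d k. *)
have [Rs [uR aR sR hR]] := select_primes (signed_range K) d%:Z (4 * K + d * K + 3).
have aR' r : r \in Rs -> prime r /\ (4 * K + d * K + 3 < r)%N by move/(allP aR)/andP.
have oR : odd_primes Rs.
  apply/andP; split=> //; apply/allP => r /aR' [-> h]; lia.
have size_range : size (signed_range K) = (2 * K)%N.
  by rewrite size_cat !size_map !size_iota mul2n addnn.
pose eps := a0 / (8 * (W + 1)).
have eps0 : 0 < eps by apply: Rdiv_lt_0_compat; lra.
have [t0 [t00 ht0]] : exists t0, 0 < t0 /\ forall E, E \in subs Rs -> forall t, 0 < t < t0 ->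
    Rabs (coprime_sum delta E t - I * kappa E * Rpower t (delta / 2)) <= eps * Rpower t (delta / 2).
  apply: (uniform_small (P := fun E t =>
     Rabs (coprime_sum delta E t - I * kappa E * Rpower t (delta / 2)) <= eps * Rpower t (delta / 2))).
  move=> E /(subs_odd_primes oR) /andP[uE aE]; apply: asym => //.
  by apply/allP => p /(allP aE)/andP[].
have [L1 hL1] := INR_unbounded (8 * b * (W + 1) / a0).
exists (a0 / 4), (prodl Rs), (L1 + prodl Rs + d * K + 2)%N, (t0 / INR K).
have iK : 0 < INR K by apply: lt_0_INR; lia.
split; [lra | exact: prodl_gt0 | exact: Rdiv_lt_0_compat |].
move=> l pl hl h [h0 hh0].
have l2 : (2 < l)%N by lia.
have small k : k \in signed_range K -> ~ Z.divide l%:Z (d%:Z * k).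
  rewrite mem_signed_range => hk hd.
  have : (l%:Z <= Z.abs (d%:Z * k))%Z.
    by apply: Z.divide_pos_le; [nia | apply/Z.divide_abs_r].
  have : (Z.abs (d%:Z * k) <= d%:Z * K%:Z)%Z by rewrite Z.abs_mul; nia.
  lia.
have [E ERs hE] : exists2 E, E \in subs Rs &
    Cmod (\big[Cplus/RtoC 0]_(k <- signed_range K | is_square_mul d%:Z k) v k) <=
    Cmod (\big[Cplus/RtoC 0]_(k <- signed_range K) (v k * RtoC (chi l k * chiE E k))%C).
  apply: (@average_twist Rs (signed_range K) d%:Z v (chi l)) => //.
  - by move=> k; apply: chi_mul.
  - exact: chi_abs.
  - move=> r /aR' [pr hr] /dvd_natP /dvdn_leq; nia.
  - move=> k kK /is_square_mulP [m hm]; rewrite -hm; split.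
      by apply: chi_sqr; rewrite hm; exact: small.
    move=> r /aR' [pr hr]; apply: chi_sqr; rewrite hm => hd.
    move: kK; rewrite mem_signed_range => hk.
    have : (r%:Z <= Z.abs (d%:Z * k))%Z.
      by apply: Z.divide_pos_le; [nia | apply/Z.divide_abs_r].
    have : (Z.abs (d%:Z * k) <= d%:Z * K%:Z)%Z by rewrite Z.abs_mul; nia.
    lia.
have oE := subs_odd_primes oR ERs.
have subE := mem_subseq (subs_subseq ERs).
have lE : l \notin E.
  by apply/negP => /subE /(prime_factor_le oR); lia.
have olE : odd_primes (l :: E).
  by case/andP: oE => uE aE; apply/andP; split; rewrite /= ?lE ?pl ?l2.
have [g0 [g0E sep]] := chiE_gauss olE.
exists (prodl (l :: E)); split; first exact: dvdn_mulr.
  by rewrite /= dvdn_pmul2l ?prime_gt0 // subs_prodl.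
set q := prodl (l :: E) in g0E sep *.
set P := Rpower h (delta / 2).
have P0 : 0 < P by exact: Rpower_gt0.
set B := \csum_(j < K) (twisted_coef c (l :: E) j * RtoC (Rpower (INR j.+1) (delta / 2))).
have B_ge : Cmod s / 2 <= Cmod B.
  rewrite /B -twisted_coef_sum; apply: Rle_trans hE.
  by rewrite (square_multiples_sum M v d_gt0 d_sqf); apply: hN1; rewrite /M; lia.
have kappa_half : 1 / 2 <= kappa E <= 1.
  have K4 : (0 < 4 * K)%N by rewrite muln_gt0.
  have aE4 : all (fun p => (4 * K <= p)%N) E.
    by apply/allP => p /subE /aR' [_ hp]; lia.
  have [[_ k1] k2] := kappa_ge K4 aE4.
  split=> //; apply: Rle_trans k2.
  have : INR (size E) <= 2 * INR K.
    rewrite -[2]/(INR 2) -mult_INR; apply: le_INR.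
    apply/leP; apply: (leq_trans (size_subseq (subs_subseq ERs))).
    by rewrite -[(2 * K)%coq_nat]/(2 * K)%N -size_range.
  have -> : INR (4 * K) = 4 * INR K by rewrite mult_INR /=; ring.
  move=> hs.
  have hq : forall x, x <= 1 / 2 -> 1 / 2 <= 1 - x by move=> x; lra.
  apply: hq.
  apply: (Rmult_le_reg_r (4 * INR K)); first lra.
  have -> : INR (size E) / (4 * INR K) * (4 * INR K) = INR (size E) by field; lra.
  lra.
have il : 0 < INR l by apply: lt_0_INR; lia.
have b_l : b / INR l <= eps.
  have h1 : 8 * b * (W + 1) / a0 <= INR l.
    by apply: (Rle_trans _ (INR L1)); [lra | apply: le_INR; lia].
  apply: (Rmult_le_reg_r (INR l * (8 * (W + 1)))); first nra.
  have -> : b / INR l * (INR l * (8 * (W + 1))) = 8 * b * (W + 1) / a0 * a0 by field; lra.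
  have -> : eps * (INR l * (8 * (W + 1))) = INR l * a0 by rewrite /eps; field; lra.
  by apply: Rmult_le_compat_r; lra.
pose err (j : nat) := coprime_sum delta (l :: E) (INR j.+1 * h) -
   I * kappa E * P * Rpower (INR j.+1) (delta / 2).
have err_le (j : nat) : (j < K)%N -> Rabs (err j) <= 2 * eps * P * Rpower (INR j.+1) (delta / 2).
  move=> jK; have j0 := INR_S_gt0 j.
  have t1 : 0 < INR j.+1 * h by nra.
  have t2 : INR j.+1 * h < t0.
    apply: (Rle_lt_trans _ (INR K * h)).
      by apply: Rmult_le_compat_r; [lra | apply: le_INR; lia].
    have -> : t0 = INR K * (t0 / INR K) by field; lra.
    by apply: Rmult_lt_compat_l.
  have h1 := ht0 E ERs _ (conj t1 t2).
  have h2 : Rabs (coprime_sum delta (l :: E) (INR j.+1 * h) - coprime_sum delta E (INR j.+1 * h)) <=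
      b / INR l * Rpower (INR j.+1 * h) (delta / 2).
    apply: coprime_sum_cons_close => //.
    by case/andP: oE => _ aE; apply/allP => p /(allP aE)/andP[].
  rewrite -Rpower_mult_distr // -/P in h1 h2.
  have p0 := Rpower_gt0 (INR j.+1) (delta / 2).
  rewrite /err; move: (coprime_sum _ _ _) (coprime_sum _ _ _) (Rpower (INR j.+1) _) p0 h1 h2 => u1 u2 p p0.
  move=> /Rabs_le_between h1 /Rabs_le_between h2.
  have h3 : b / INR l * (p * P) <= eps * (p * P) by apply: Rmult_le_compat_r; [nra | lra].
  by apply/Rabs_le_between; nra.
set S := \csum_(j < K) (twisted_coef c (l :: E) j * RtoC (coprime_sum delta (l :: E) (INR j.+1 * h))).
have S_eq : S = (RtoC (I * kappa E * P) * B + \csum_(j < K) (twisted_coef c (l :: E) j * RtoC (err j)))%C.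
  rewrite /S /B big_distrr -big_split; apply: eq_bigr => j _.
  have -> : RtoC (err j) = (RtoC (coprime_sum delta (l :: E) (INR j.+1 * h)) -
      RtoC (I * kappa E * P) * RtoC (Rpower (INR j.+1) (delta / 2)))%C.
    by rewrite /err RtoC_minus RtoC_mult.
  move: (twisted_coef _ _ _) (RtoC (coprime_sum _ _ _)) (RtoC (Rpower _ _)) (RtoC (I * _ * _)) => x1 x2 x3 x4 /=; ring.
have coef_le (j : nat) : Cmod (twisted_coef c (l :: E) j) <= 2 * Cmod (c j.+1%:Z).
  apply: Rle_trans (Cmod_triangle _ _) _; rewrite !Cmod_mult !Cmod_R c_conj.
  have := Cmod_ge_0 (c j.+1%:Z).
  have := chiE_abs (l :: E) j.+1%:Z; have := chiE_abs (l :: E) (- j.+1%:Z)%Z; nra.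
have err_sum : Cmod (\csum_(j < K) (twisted_coef c (l :: E) j * RtoC (err j))) <= a0 / 2 * P.
  apply: Rle_trans (Cmod_csum_le _ _ _) _.
  apply: Rle_trans (_ : \big[Rplus/0]_(j < K) (4 * eps * P * wc j) <= _).
    apply: rsum_le => j _; rewrite Cmod_mult Cmod_R.
    apply: Rle_trans (Rmult_le_compat _ _ _ _ (Cmod_ge_0 _) (Rabs_pos _) (coef_le _) (err_le _ (ltn_ord j))) _.
    by rewrite /wc; apply: Req_le; ring.
  rewrite -big_distrr [X in X <= _]/=.
  have h1 : \big[Rplus/0]_(j < K) wc j <= W by apply: partial_sum_le_Series.
  apply: (Rle_trans _ (4 * eps * P * (W + 1))); last first.
    by apply: Req_le; rewrite /eps; field; lra.
  have e4 : 0 <= 4 * eps * P by apply/Rlt_le/Rmult_lt_0_compat => //; lra.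
  apply: Rmult_le_compat_l e4 _; apply: (Rle_trans _ _ _ h1); lra.
have S_ge : a0 / 2 * P <= Cmod S.
  have h1 : Cmod (RtoC (I * kappa E * P) * B)%C <= Cmod S + Cmod (\csum_(j < K) (twisted_coef c (l :: E) j * RtoC (err j))).
    have -> : (RtoC (I * kappa E * P) * B = S + - (\csum_(j < K) (twisted_coef c (l :: E) j * RtoC (err j))))%C.
      by rewrite S_eq; ring.
    by rewrite -[X in _ <= _ + X]Cmod_opp; exact: Cmod_triangle.
  have h2 : a0 * P <= Cmod (RtoC (I * kappa E * P) * B)%C.
    rewrite Cmod_mult Cmod_R Rabs_pos_eq; last by apply: Rmult_le_pos; nra.
    have -> : a0 * P = (I * (1 / 2) * P) * (Cmod s / 2) by rewrite /a0; field.
    have hk0 : 0 <= I * (1 / 2) * P by apply: Rmult_le_pos; lra.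
    have hk : I * (1 / 2) * P <= I * kappa E * P.
      by apply: Rmult_le_compat_r; [lra | apply: Rmult_le_compat_l; lra].
    have hs : 0 <= Cmod s / 2 by lra.
    exact: Rmult_le_compat hk0 hs hk B_ge.
  lra.
have close := twisted_G_close delta_bounds c_conj c_sum g_lim olE sep K h0 (hb (l :: E)) (Rlt_le _ _ b0).
rewrite -/S -/P -/wc in close.
have tailK : Series (fun j => wc (K + j)%N) <= a0 / (8 * b).
  by apply hN2; rewrite /M in MK; lia.
have g00 : 0 <= Cmod g0 by exact: Cmod_ge_0.
have close2 : Cmod (twisted_G delta g (l :: E) h + 2 * g0 * S)%C <= Cmod g0 * (a0 / 2 * P).
  apply: (Rle_trans _ _ _ close).
  have -> : Cmod g0 * (a0 / 2 * P) = 4 * Cmod g0 * b * P * (a0 / (8 * b)) by field; lra.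
  apply: Rmult_le_compat_l tailK.
  by apply: Rmult_le_pos; [apply: Rmult_le_pos; lra | lra].
have T_ge : Cmod g0 * (a0 / 2 * P) <= Rabs (twisted_G delta g (l :: E) h).
  have h1 : Cmod (2 * g0 * S)%C <= Cmod (twisted_G delta g (l :: E) h + 2 * g0 * S)%C + Rabs (twisted_G delta g (l :: E) h).
    rewrite -Cmod_R -[Cmod (RtoC _)]Cmod_opp.
    apply: Rle_trans (Cmod_triangle _ _); apply: Req_le; congr Cmod; ring.
  rewrite !Cmod_mult Cmod_R Rabs_pos_eq in h1; last lra.
  have h2 : 2 * Cmod g0 * (a0 / 2 * P) <= 2 * Cmod g0 * Cmod S by apply: Rmult_le_compat_l; lra.
  lra.
(* The character vanishes at the residues that are not coprime to q. *)
have T_le : Rabs (twisted_G delta g (l :: E) h) <=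
    \big[Rplus/0]_(a < q | coprime a q) Rabs (second_diff (G delta g) (INR a / INR q) h).
  rewrite /twisted_G -Cmod_R RtoC_rsum.
  apply: Rle_trans (Cmod_csum_le _ _ _) _.
  rewrite -/q [X in _ <= X]big_mkcond; apply: rsum_le => a _.
  rewrite Cmod_R Rabs_mult.
  have chi1le := chiE_abs (l :: E) a%:Z.
  have := Rabs_pos (second_diff (G delta g) (INR a / INR q) h).
  case: ifP => [_|ncop] s1; first nra.
  have -> : chiE (l :: E) a%:Z = 0; last by rewrite Rabs_R0 Rmult_0_l; lra.
  apply: NNPP => ne; move: ncop; rewrite (chiE_coprime _ ne) //.
  by case/andP: olE => _ aE; apply/allP => p /(allP aE)/andP[].
apply: Rle_trans T_le; apply: Rle_trans T_ge.
have sq : sqrt (INR l) <= Cmod g0.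
  rewrite g0E; apply: sqrt_le_1_alt; apply: le_INR; apply/leP; apply: leq_pmulr.
  exact: prodl_gt0.
have -> : a0 / 4 * sqrt (INR l) * P = sqrt (INR l) * (a0 / 4 * P) by ring.
apply: Rmult_le_compat => //; try nra; exact: sqrt_pos.
Qed.
End Main.
End LowerBound.

(** * Counting grid squares by columns *)

Section BoxCounting.
Import List Ensembles Finite_sets.
Import all_boot zify SumNotations.
#[local] Set Implicit Arguments.
#[local] Unset Strict Implicit.

Lemma cardinal_of_seq (T : eqType) (A : Ensemble T) (s : seq T) :
  uniq s -> (forall x, x \in s <-> A x) -> cardinal T A (size s).
Proof.
elim: s A => [|x s IH] A /=.
  move=> _ h; have -> : A = Empty_set T.
    apply: functional_extensionality => x; apply: propositional_extensionality; split.
      by move/h; rewrite in_nil.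
    by case.
  exact: card_empty.
case/andP=> xs us h.
have -> : A = Add T (fun y => y \in s) x.
  apply: functional_extensionality => y; apply: propositional_extensionality; split.
    move/h; rewrite inE => /orP[/eqP ->|ys]; first by right.
    by left.
  case=> y' hy; apply/h; rewrite inE; first by rewrite [y' \in s]hy orbT.
  by case: hy; rewrite eqxx.
by apply: card_add; [exact: IH | move=> xs'; case/negP: xs].
Qed.

Lemma cardinal_seq (T : eqType) (A : Ensemble T) (n : nat) : cardinal T A n ->
  exists s : seq T, [/\ uniq s, size s = n & forall x, x \in s <-> A x].
Proof.
elim=> [|B k _ [s [us ss hs]] x xB].
  exists [::]; split=> // x; rewrite in_nil; split=> //; by case.
exists (x :: s); split=> /=; first by rewrite us andbT; apply/negP => /hs.
  by rewrite ss.
move=> y; rewrite inE; split.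
  by case/orP=> [/eqP ->|/hs yB]; [right | left].
by case=> z hz; [apply/orP; right; apply/hs | case: hz; rewrite eqxx].
Qed.

Lemma box_count_seq (A : Ensemble (R * R)) (N : nat) (box : seq (Z * Z)) :
  (forall ij, squares_meeting A N ij -> ij \in box) ->
  exists s : seq (Z * Z), [/\ uniq s, size s = box_count A N &
     forall ij, ij \in s <-> squares_meeting A N ij].
Proof.
move=> hbox.
have [n hn] : exists n, cardinal (Z * Z) (squares_meeting A N) n.
  exists (size [seq ij <- undup box | is_left (excluded_middle_informative (squares_meeting A N ij))]).
  apply: cardinal_of_seq; first by rewrite filter_uniq ?undup_uniq.
  move=> ij; rewrite mem_filter mem_undup.
  by case: excluded_middle_informative => h /=; split=> // _; apply: hbox.
apply: cardinal_seq; rewrite /box_count.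
exact: (epsilon_spec (inhabits 0%N) (cardinal (Z * Z) (squares_meeting A N)) (ex_intro _ n hn)).
Qed.

Lemma sum_columns_le (s : seq (Z * Z)) (ns : seq nat) : uniq ns ->
  (\sum_(i <- ns) count (fun ij => ij.1 == i%:Z) s <= size s)%N.
Proof.
move=> ui; elim: s => [|ij s IH] /=; first by rewrite big1.
rewrite big_split /= -addn1 addnC leq_add // .
have -> : (\sum_(i <- ns) (ij.1 == i%:Z) = count (fun i => ij.1 == i%:Z) ns)%N.
  by elim: (ns) => [|i ns' IH']; rewrite ?big_nil // big_cons IH'.
rewrite -size_filter -[1%N]/(size [:: Z.abs_nat ij.1]).
apply: uniq_leq_size; first by rewrite filter_uniq.
by move=> i; rewrite mem_filter inE => /andP[/eqP -> _]; lia.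
Qed.

Section Columns.
Variables (f : R -> R) (b : R) (N : nat).
Hypothesis f_cont : forall x, continuous f x.
Hypothesis f_bound : forall x, Rabs (f x) <= b.
Hypothesis N_gt0 : (0 < N)%N.

Let N0 : 0 < INR N. Proof. by apply: lt_0_INR; lia. Qed.

(** Finiteness is what makes [box_count] the cardinality it is meant to be. *)
Lemma graph_squares_bounded : exists box : seq (Z * Z),
  forall ij, squares_meeting (graph f) N ij -> ij \in box.
Proof.
pose K := (Z.to_nat (up (b * INR N)) + N + 2)%N.
exists [seq (i, j) | i <- int_range K, j <- int_range K] => -[i j] [_ [[x y] [[hx1 hx2] [hy1 hy2]] [hx hy]]].
move: hx1 hx2 hy1 hy2 hx hy => /= hx1 hx2 hy1 hy2 hx hy; subst y.
have := f_bound x => /Rabs_le_between hb.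
have [hu1 hu2] := archimed (b * INR N).
have scale1 u w : u / INR N <= w -> u <= w * INR N.
  by move=> h; have := Rmult_le_compat_r _ _ _ (Rlt_le _ _ N0) h; rewrite /Rdiv Rmult_assoc Rinv_l; lra.
have scale2 u w : w <= u / INR N -> w * INR N <= u.
  by move=> h; have := Rmult_le_compat_r _ _ _ (Rlt_le _ _ N0) h; rewrite /Rdiv Rmult_assoc Rinv_l; lra.
move/scale1: hx1 => hx1; move/scale2: hx2 => hx2; move/scale1: hy1 => hy1; move/scale2: hy2 => hy2.
have b0 : 0 <= b by lra.
have u0 : (0 <= up (b * INR N))%Z.
  by apply: le_IZR; have := Rmult_le_pos _ _ b0 (Rlt_le _ _ N0); lra.
have i1 : (-1 <= i)%Z by apply: le_IZR; nra.
have i2 : (i <= N%:Z)%Z by apply: le_IZR; rewrite -INR_IZR_INZ; nra.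
have j1 : (- up (b * INR N) - 1 <= j)%Z.
  by apply: le_IZR; rewrite minus_IZR opp_IZR; nra.
have j2 : (j <= up (b * INR N))%Z by apply: le_IZR; nra.
by apply/allpairsP; exists (i, j); split=> //=; apply: mem_int_range; rewrite /K; lia.
Qed.

(** By the intermediate value theorem the graph over a column meets every square
    between the heights of any two of its points. *)
Lemma column_oscillation (s : seq (Z * Z)) (i : nat) (x y : R) :
  (forall ij, ij \in s <-> squares_meeting (graph f) N ij) ->
  (i < N)%N ->
  INR i <= INR N * x <= INR i + 1 -> INR i <= INR N * y <= INR i + 1 ->
  Rabs (f x - f y) * INR N <= INR (count (fun ij => ij.1 == i%:Z) s).
Proof.
move=> hs iN; wlog fxy : x y / f x <= f y.
  move=> wl hx hy; case: (Rle_lt_dec (f x) (f y)) => h; first exact: wl.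
  by rewrite Rabs_minus_sym; apply: wl => //; lra.
move=> hx hy; rewrite Rabs_minus_sym Rabs_pos_eq; last lra.
have fc : Ranalysis1.continuity f by move=> z; apply/continuity_pt_filterlim; exact: f_cont.
have iN1 : INR i + 1 <= INR N by rewrite -S_INR; apply: le_INR; lia.
(* The floors of N f(x) and N f(y). *)
pose ja := (up (INR N * f x) - 1)%Z; pose jb := (up (INR N * f y) - 1)%Z.
have [a1 a2] := archimed (INR N * f x); have [b1 b2] := archimed (INR N * f y).
have eja : IZR ja = IZR (up (INR N * f x)) - 1 by rewrite minus_IZR.
have ejb : IZR jb = IZR (up (INR N * f y)) - 1 by rewrite minus_IZR.
have Nfxy : INR N * f x <= INR N * f y by apply: Rmult_le_compat_l; lra.
have jab : (ja <= jb)%Z by apply/Z.lt_succ_r; apply: lt_IZR; rewrite succ_IZR; lra.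
have meets (j : Z) : (ja <= j <= jb)%Z -> (i%:Z, j) \in s.
  case=> h1 h2; apply/hs.
  have [t [ht1 [ht2 ht3]]] : exists t, INR i <= INR N * t <= INR i + 1 /\
      IZR j <= INR N * f t <= IZR j + 1.
    have [e|ne] := Z.eq_dec j ja.
      by exists x; split=> //; rewrite e; lra.
    have hj1 : IZR ja + 1 <= IZR j by rewrite -succ_IZR; apply: IZR_le; lia.
    have hj2 : IZR j <= IZR jb by apply: IZR_le.
    have hj3 : INR N * f x <= IZR j <= INR N * f y by lra.
    have [t [[ht1 ht2] ft]] : {t | Rmin x y <= t <= Rmax x y /\ f t = IZR j / INR N}.
      apply: IVT_gen => //; rewrite Rmin_left // Rmax_right //.
      have e : IZR j = INR N * (IZR j / INR N) by field; lra.
      split; apply: (Rmult_le_reg_l (INR N)) => //; lra.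
    exists t; split; last first.
      by rewrite ft; have -> : INR N * (IZR j / INR N) = IZR j; [field; lra | lra].
    move: ht1 ht2; rewrite /Rmin /Rmax; case: Rle_dec => _ ht1 ht2; nra.
  exists (t, f t); split; last first.
    split=> //=; split; apply: (Rmult_le_reg_l (INR N)) => //; first by have := pos_INR i; lra.
    lra.
  rewrite /grid_square /In /= -INR_IZR_INZ.
  have sc u w : u <= INR N * w -> u / INR N <= w.
    by move=> h; apply: (Rmult_le_reg_l (INR N)) => //; have -> : INR N * (u / INR N) = u; [field; lra | lra].
  have sc' u w : INR N * w <= u -> w <= u / INR N.
    by move=> h; apply: (Rmult_le_reg_l (INR N)) => //; have -> : INR N * (u / INR N) = u; [field; lra | lra].
  by split; split; (apply: sc || apply: sc'); lra.
pose col := [seq (i%:Z, ja + t%:Z)%Z | t <- iota 0 (Z.to_nat (jb - ja + 1))].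
have : (size col <= count (fun ij => ij.1 == i%:Z) s)%N.
  rewrite -size_filter; apply: uniq_leq_size.
    by rewrite map_inj_uniq ?iota_uniq // => t t' [] ; lia.
  move=> ij /mapP[t]; rewrite mem_iota => ht ->; rewrite mem_filter /= eqxx /=.
  by apply: meets; lia.
rewrite size_map size_iota => /leP/le_INR.
rewrite INR_IZR_INZ Z2Nat.id; last lia.
rewrite plus_IZR minus_IZR; lra.
Qed.
End Columns.
End BoxCounting.

(** * Second differences bound the box count *)

Section PointsAndPrimes.
Import all_boot zify SumNotations.
#[local] Set Implicit Arguments.
#[local] Unset Strict Implicit.

(** Distinct reduced fractions with denominators at most sqrt N differ by at least
    1/N, so floor(N a/q) takes distinct values.  The three points of a second
    difference with step 1/N lie in three adjacent columns, and the values at the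
    two grid lines between them serve as intermediate points.  The middle column is
    used twice, whence the constant 4 = 2 + 1 + 1. *)
Lemma sum_second_differences_le (f : R -> R) (b : R) (N : nat) (pts : seq (nat * nat)) :
  (forall x, continuous f x) -> (forall x, Rabs (f x) <= b) -> (0 < N)%N -> uniq pts ->
  (forall p, p \in pts -> [/\ (1 < p.1)%N, (p.1 * p.1 <= N)%N, (p.2 < p.1)%N & coprime p.2 p.1]) ->
  \rsum_(p <- pts) (Rabs (second_diff f (INR p.2 / INR p.1) (/ INR N)) * INR N) <=
  4 * INR (box_count (graph f) N).
Proof.
move=> fc fb N0 upts hpts.
have iN : 0 < INR N by apply: lt_0_INR; lia.
have [box hbox] := graph_squares_bounded fb N0.
have [s [us <- hs]] := box_count_seq hbox.
pose idx (p : nat * nat) := (N * p.2 %/ p.1)%N.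
have idx_bounds p : p \in pts -> (0 < idx p)%N /\ ((idx p).+1 < N)%N.
  move=> /hpts [q1 qq ap cop].
  have a0 : (0 < p.2)%N.
    by case: (p.2) cop ap => //; rewrite /coprime gcd0n => /eqP e; rewrite e in q1.
  have q0 : (0 < p.1)%N by lia.
  split.
    rewrite divn_gt0 //; apply: leq_trans (leq_pmulr N a0).
    by apply: leq_trans qq; exact: leq_pmulr.
  have qN : (p.1 < N)%N by apply: leq_trans qq; rewrite -[X in (X < _)%N]muln1 ltn_pmul2l.
  rewrite -ltn_predRL ltn_divLR //.
  have h1 : (N * p.2 + N <= N * p.1)%N by rewrite -mulnSr leq_mul2l ap orbT.
  have h2 : (N.-1 * p.1 + p.1 = N * p.1)%N by rewrite -mulSnr prednK.
  move: h1 h2 qN; move: (N * p.2)%N (N.-1 * p.1)%N (N * p.1)%N => x y z.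
  clear; lia.
have idx_spec p : p \in pts -> INR (idx p) <= INR N * (INR p.2 / INR p.1) < INR (idx p) + 1.
  move=> /hpts [q1 qq ap cop].
  have iq : 0 < INR p.1 by apply: lt_0_INR; lia.
  have e : INR N * (INR p.2 / INR p.1) * INR p.1 = INR N * INR p.2 by field; lra.
  have h1 : INR (idx p) * INR p.1 <= INR N * INR p.2.
    by rewrite -!mult_INR; apply: le_INR; apply/leP; exact: leq_divM.
  have h2 : INR N * INR p.2 < (INR (idx p) + 1) * INR p.1.
    rewrite -S_INR -!mult_INR; apply: lt_INR; apply/ltP.
    rewrite -[Nat.mul _ _]/(N * p.2)%N -[Nat.mul _ _]/((idx p).+1 * p.1)%N.
    by rewrite -ltn_divLR //; lia.
  split; [apply: (Rmult_le_reg_r (INR p.1)) | apply: (Rmult_lt_reg_r (INR p.1))] => //; lra.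
have idx_inj : {in pts &, injective idx}.
  move=> [q a] [q' a'] hp hp' e.
  have s1 := idx_spec _ hp; have s2 := idx_spec _ hp'; rewrite -e /= in s1 s2.
  have [/= q1 qq ap cop] := hpts _ hp; have [/= q1' qq' ap' cop'] := hpts _ hp'.
  have iq : 0 < INR q by apply: lt_0_INR; lia.
  have iq' : 0 < INR q' by apply: lt_0_INR; lia.
  have qqN : INR q * INR q' <= INR N.
    have h1 : INR q * INR q <= INR N by rewrite -mult_INR; apply: le_INR; lia.
    have h2 : INR q' * INR q' <= INR N by rewrite -mult_INR; apply: le_INR; lia.
    nra.
  have cross : (a * q' = a' * q)%N.
    apply: INR_eq; rewrite !mult_INR.
    have h : Rabs (INR a * INR q' - INR a' * INR q) < 1.
      have e1 : (INR a * INR q' - INR a' * INR q) * INR N =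
          (INR N * (INR a / INR q) - INR N * (INR a' / INR q')) * (INR q * INR q').
        by field; lra.
      have h : Rabs (INR N * (INR a / INR q) - INR N * (INR a' / INR q')) < 1.
        by apply: Rabs_def1; lra.
      apply: (Rmult_lt_reg_r (INR N)) => //.
      rewrite -{1}(Rabs_pos_eq (INR N)); last lra.
      rewrite -Rabs_mult e1 Rabs_mult (Rabs_pos_eq (INR q * INR q')); last nra.
      have p0 : 0 < INR q * INR q' by nra.
      apply: Rlt_le_trans (_ : 1 * (INR q * INR q') <= _); last lra.
      exact: Rmult_lt_compat_r.
    have : (a%:Z * q'%:Z - a'%:Z * q%:Z = 0)%Z.
      have : (Z.abs (a%:Z * q'%:Z - a'%:Z * q%:Z) < 1)%Z.
        by apply: lt_IZR; rewrite abs_IZR minus_IZR !mult_IZR -!INR_IZR_INZ.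
      lia.
    by rewrite -!mult_INR => h0; congr INR; lia.
  have d1 : (q %| q')%N.
    by rewrite -(@Gauss_dvdr q a) 1?coprime_sym // cross dvdn_mull.
  have d2 : (q' %| q)%N.
    by rewrite -(@Gauss_dvdr q' a') 1?coprime_sym // -cross dvdn_mull.
  have eq : q = q' by apply/eqP; rewrite eqn_dvd d1 d2.
  congr (_, _) => //; apply/eqP; rewrite -(eqn_pmul2r (_ : 0 < q')%N); last lia.
  by rewrite cross eq.
pose M i := INR (count (fun ij => ij.1 == i%:Z) s).
have col (sh : nat -> nat) : {in pts &, injective (sh \o idx)} ->
    \rsum_(p <- pts) M (sh (idx p)) <= INR (size s).
  move=> inj.
  have -> : \rsum_(p <- pts) M (sh (idx p)) =
     INR (\sum_(i <- [seq sh (idx p) | p <- pts]) count (fun ij => ij.1 == i%:Z) s)%N.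
    by rewrite INR_sum big_map.
  by apply: le_INR; apply/leP; apply: sum_columns_le; rewrite map_inj_in_uniq.
have c1 : \rsum_(p <- pts) M (idx p) <= INR (size s) by apply: (col id).
have c2 : \rsum_(p <- pts) M (idx p).+1 <= INR (size s).
  by apply: (col succn) => p p' hp hp' [] /idx_inj; apply.
(* The predecessor is injective here because the index is positive. *)
have c3 : \rsum_(p <- pts) M (idx p).-1 <= INR (size s).
  apply: (col predn) => p p' hp hp' /= e; apply: idx_inj => //.
  have := idx_bounds _ hp; have := idx_bounds _ hp'; lia.
have term p : p \in pts -> Rabs (second_diff f (INR p.2 / INR p.1) (/ INR N)) * INR N <=
    2 * M (idx p) + M (idx p).+1 + M (idx p).-1.
  move=> hp; have [x1 x2] := idx_spec _ hp; have [i0 iN1] := idx_bounds _ hp.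
  set x := INR p.2 / INR p.1 in x1 x2 *.
  have eN : INR N * / INR N = 1 by field; lra.
  have e1 : INR N * (x + / INR N) = INR N * x + 1 by rewrite Rmult_plus_distr_l eN.
  have e2 : INR N * (x - / INR N) = INR N * x - 1 by rewrite Rmult_minus_distr_l eN.
  have p1 : INR (idx p).-1 = INR (idx p) - 1 by rewrite -{2}(prednK i0) S_INR; ring.
  have s1 : INR (idx p).+1 = INR (idx p) + 1 by rewrite S_INR.
  have osc i u w : (i < N)%N -> INR i <= INR N * u <= INR i + 1 -> INR i <= INR N * w <= INR i + 1 ->
      Rabs (f u - f w) * INR N <= M i.
    exact: column_oscillation.
  pose y := INR (idx p) / INR N; pose z := INR (idx p).+1 / INR N.
  have ey : INR N * y = INR (idx p) by rewrite /y; field; lra.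
  have ez : INR N * z = INR (idx p) + 1 by rewrite /z s1; field; lra.
  have o1 : Rabs (f (x + / INR N) - f z) * INR N <= M (idx p).+1.
    by apply: osc => //; rewrite ?e1 ?ez s1; lra.
  have o2 : Rabs (f z - f x) * INR N <= M (idx p) by apply: osc; [lia | rewrite ez; lra | lra].
  have o3 : Rabs (f (x - / INR N) - f y) * INR N <= M (idx p).-1.
    by apply: osc; [lia | rewrite e2 p1; lra | rewrite ey p1; lra].
  have o4 : Rabs (f y - f x) * INR N <= M (idx p) by apply: osc; [lia | rewrite ey; lra | lra].
  have tri : Rabs (second_diff f x (/ INR N)) <= Rabs (f (x + / INR N) - f z) + Rabs (f z - f x) +
     Rabs (f (x - / INR N) - f y) + Rabs (f y - f x).
    rewrite /second_diff; split_Rabs; lra.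
  have := Rmult_le_compat_r _ _ _ (Rlt_le _ _ iN) tri; lra.
have tot : \rsum_(p <- pts) (Rabs (second_diff f (INR p.2 / INR p.1) (/ INR N)) * INR N) <=
    2 * (\rsum_(p <- pts) M (idx p)) + \rsum_(p <- pts) M (idx p).+1 + \rsum_(p <- pts) M (idx p).-1.
  rewrite -rsum_scal -!rsum_plus; exact: rsum_le.
lra.
Qed.

(** At least a quarter of the m primes exceed m/2. *)
Lemma sum_sqrt_primes_ge (L Y : nat) : let m := size (primes_upto Y) in (4 * L.+2 <= m)%N ->
  INR m / 4 * sqrt (INR m / 4) <= \rsum_(l <- [seq l <- primes_upto Y | (L < l)%N]) sqrt (INR l).
Proof.
move=> m hm; pose t := (m %/ 2)%N.
have Lt : (L <= t)%N by rewrite /t; lia.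
apply: Rle_trans (_ : \rsum_(l <- [seq l <- primes_upto Y | (t < l)%N]) sqrt (INR l) <= _); last first.
  have -> : [seq l <- primes_upto Y | (t < l)%N] =
     [seq l <- [seq l <- primes_upto Y | (L < l)%N] | (t < l)%N].
    rewrite -filter_predI; apply: eq_filter => l /=.
    by case: (ltnP t l) => // h; rewrite (leq_ltn_trans Lt h).
  by apply: rsum_filter_le => l _; exact: sqrt_pos.
have tm : INR m / 4 <= INR t.
  have : INR m <= INR (4 * t) by apply: le_INR; rewrite /t; lia.
  rewrite mult_INR /=; lra.
have sz : INR m / 4 <= INR (size [seq l <- primes_upto Y | (t < l)%N]).
  have h : (m <= size [seq l <- primes_upto Y | (t < l)%N] + t.+1)%N.
    rewrite /m -(count_predC (fun l => t < l)%N) -!size_filter leq_add2l.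
    rewrite -[X in (_ <= X)%N](size_iota 0); apply: uniq_leq_size; first by rewrite !filter_uniq ?iota_uniq.
    by move=> l; rewrite mem_filter mem_iota => /andP[/= hl _]; lia.
  have : INR m <= INR (4 * size [seq l <- primes_upto Y | (t < l)%N]).
    by apply: le_INR; move: h; rewrite /t; lia.
  rewrite mult_INR /=; lra.
apply: Rle_trans (rsum_ge_const (c := sqrt (INR m / 4)) _).
  by rewrite Rmult_comm; apply: Rmult_le_compat_l; [exact: sqrt_pos | exact: sz].
move=> l; rewrite mem_filter => /andP[tl _]; apply: sqrt_le_1_alt.
by apply: Rle_trans tm _; apply: le_INR; lia.
Qed.

(** A logarithmic form of Chebyshev: the factor ln Y is absorbed by Y^eps. *)
Lemma primes_upto_log (eps : R) : 0 < eps -> exists C, forall Y, (4 <= Y)%N ->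
  (0 < size (primes_upto Y))%N /\
  (1 - eps) * ln (INR Y) - C <= ln (INR (size (primes_upto Y))).
Proof.
move=> e0; exists (ln 8 - 1 - ln eps) => Y Y4.
set m := size (primes_upto Y).
have m0 : (0 < m)%N.
  have : 2%N \in primes_upto Y by rewrite mem_filter mem_iota -[prime 2]/true; lia.
  by rewrite /m; case: (primes_upto Y).
split=> //.
have n0 : (0 < Y %/ 2)%N by lia.
have Y4' : 4 <= INR Y by rewrite (_ : 4 = INR 4); [apply: le_INR; lia | rewrite /=; ring].
have lnY : 1 < ln (INR Y).
  rewrite -(ln_exp 1); apply: ln_increasing; first exact: exp_pos.
  by have := exp_le_3; lra.
have key : INR Y / 8 <= INR m * ln (INR Y).
  have /leP/le_INR := chebyshev n0.
  rewrite !INR_expn => h.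
  have mm : (size (primes_upto (2 * (Y %/ 2))) <= m)%N.
    rewrite /m (@primes_upto_cat (2 * (Y %/ 2)) Y) ?size_cat ?leq_addr //; lia.
  have h2 : INR 2 ^ (Y %/ 2) <= INR Y ^ m.
    apply: Rle_trans h _.
    apply: Rle_trans (_ : INR Y ^ size (primes_upto (2 * (Y %/ 2))) <= _).
      apply: pow_incr; split; first exact: pos_INR.
      by apply: le_INR; lia.
    by apply: Rle_pow; [lra | lia].
  have h3 : INR (Y %/ 2) * ln 2 <= INR m * ln (INR Y).
    rewrite -!ln_pow; try lra.
    by apply: ln_le; [apply: pow_lt; lra | exact: h2].
  have l2 := ln_lt_2.
  have h4 : INR Y / 4 <= INR (Y %/ 2).
    have : INR Y <= INR (4 * (Y %/ 2)) by apply: le_INR; lia.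
    rewrite mult_INR /=; lra.
  nra.
have im : 0 < INR m by apply: lt_0_INR; lia.
have h5 : ln (INR Y) - ln 8 <= ln (INR m) + ln (ln (INR Y)).
  rewrite -ln_mult; try lra; rewrite -ln_div; try lra.
  by apply: ln_le; lra.
have h6 : ln (ln (INR Y)) <= eps * ln (INR Y) - 1 - ln eps.
  have : ln (eps * ln (INR Y)) <= eps * ln (INR Y) - 1.
    rewrite -[X in _ <= X]ln_exp; apply: ln_le; first nra.
    have := exp_ineq1_le (eps * ln (INR Y) - 1); lra.
  rewrite ln_mult; lra.
lra.
Qed.
End PointsAndPrimes.

(** * Growth of the box count *)

Section Regularity.
Variables (delta b : R) (g : R -> R).
Hypothesis delta_bounds : 0 < delta <= 1.
Hypothesis g_cont : forall x, continuous g x.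
Hypothesis g_bound : forall x, Rabs (g x) <= b.

Let term (x : R) (n : nat) : R := weight delta n * g (INR (S n) ^ 2 * x).

Let G_eq (x : R) : G delta g x = Series (term x).
Proof.
  apply Series_ext; intros n; unfold term, weight, Rdiv; apply Rmult_comm.
Qed.

Let term_le (x : R) (n : nat) : Rabs (term x n) <= b * weight delta n.
Proof.
  unfold term; pose proof (weight_gt0 delta n).
  rewrite Rabs_mult, (Rabs_pos_eq (weight _ _)), Rmult_comm by lra.
  apply Rmult_le_compat_r; [lra | apply g_bound].
Qed.

Let ex_series_abs_term (x : R) : ex_series (fun n => Rabs (term x n)).
Proof.
  apply (ex_series_le_weight delta delta_bounds _ b); intros n.
  rewrite Rabs_Rabsolu; apply term_le.
Qed.

Lemma G_bound (x : R) : Rabs (G delta g x) <= b * Series (weight delta).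
Proof.
  assert (ex : ex_series (fun n => b * weight delta n))
    by apply (ex_series_scal_l b (weight delta)), ex_series_weight, delta_bounds.
  rewrite G_eq, <- Series_scal_l.
  eapply Rle_trans; [apply Series_Rabs, ex_series_abs_term|].
  apply Series_le; [|exact ex].
  intros n; split; [apply Rabs_pos | apply term_le].
Qed.

Let term_cont (n : nat) (x : R) : continuous (fun y => term y n) x.
Proof.
  apply (continuous_scal_r (K := R_AbsRing) (V := R_NormedModule) (weight delta n)
    (fun y => g (INR (S n) ^ 2 * y)) x).
  apply (continuous_comp (fun y => INR (S n) ^ 2 * y) g x); [|apply g_cont].
  apply (ex_derive_continuous (K := R_AbsRing) (V := R_NormedModule)); auto_derive; auto.
Qed.

Let partial_cont (M : nat) (x : R) : continuous (fun y => sum_n (term y) M) x.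
Proof.
  induction M as [|M IH].
  - apply (continuous_ext (fun y => term y 0)); [intros y; now rewrite sum_O | apply term_cont].
  - apply (continuous_ext (fun y => plus (sum_n (term y) M) (term y (S M)))).
    + intros y; now rewrite sum_Sn.
    + apply (continuous_plus (K := R_AbsRing) (V := R_NormedModule)); [exact IH | apply term_cont].
Qed.

Lemma G_continuous (x : R) : continuous (G delta g) x.
Proof.
  assert (b0 : 0 <= b) by (eapply Rle_trans; [apply Rabs_pos | apply (g_bound 0)]).
  assert (exb : ex_series (fun n => b * weight delta n))
    by apply (ex_series_scal_l b (weight delta)), ex_series_weight, delta_bounds.
  assert (tb0 : forall n, 0 <= b * weight delta n).
  { intros n; pose proof (weight_gt0 delta n); nra. }
  apply (filterlim_locally (U := R_UniformSpace)); intros eps.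
  assert (e4 : 0 < eps / 4) by (pose proof (cond_pos eps); lra).
  destruct (series_tail_small exb tb0 e4) as [M hM].
  assert (close : forall y, Rabs (G delta g y - sum_n (term y) M) <= eps / 4).
  { intros y; rewrite G_eq.
    assert (exy : ex_series (term y)) by (apply (ex_series_le_weight delta delta_bounds _ b), term_le).
    rewrite (Series_incr_n (term y) (S M)); [|lia|exact exy].
    simpl pred; rewrite <- sum_n_Reals.
    replace (sum_n (term y) M + Series (fun k => term y (S M + k)) - sum_n (term y) M)
      with (Series (fun k => term y (S M + k))) by ring.
    assert (exs : ex_series (fun k => b * weight delta (S M + k)))
      by (apply (ex_series_incr_n (fun n => b * weight delta n) (S M)); exact exb).
    eapply Rle_trans.
    - apply Series_Rabs, (ex_series_incr_n (fun n => Rabs (term y n)) (S M)), ex_series_abs_term.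
    - eapply Rle_trans; [|apply (hM (S M)); apply (ssrnat.ltnSn M)].
      apply Series_le; [|exact exs].
      intros n; split; [apply Rabs_pos | apply (term_le y (S M + n))]. }
  pose proof (proj1 (filterlim_locally (U := R_UniformSpace) _ _) (partial_cont M x) (mkposreal _ e4)) as hc.
  revert hc; apply filter_imp; intros y hy.
  assert (h1 : Rabs (sum_n (term y) M - sum_n (term x) M) < eps / 4) by exact hy.
  assert (h2 : Rabs (G delta g y - G delta g x) < eps); [|exact h2].
  pose proof (close x) as cx; pose proof (close y) as cy.
  apply Rabs_le_between in cx; apply Rabs_le_between in cy; apply Rabs_def2 in h1.
  apply Rabs_def1; lra.
Qed.
End Regularity.

Section CountBound.
Import all_boot zify SumNotations.
#[local] Set Implicit Arguments.
#[local] Unset Strict Implicit.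

(** The prime l can be read off from q, because it is the only prime factor of q
    that exceeds Q; so the fractions a/q belonging to different primes l are
    distinct. *)
Lemma box_count_ge (f : R -> R) (b c1 h0 gamma : R) (Q L0 Y N : nat) :
  (forall x, continuous f x) -> (forall x, Rabs (f x) <= b) -> 0 < c1 -> (0 < Q)%N ->
  (forall l, prime l -> (L0 < l)%N -> forall h, 0 < h < h0 ->
   exists q, [/\ (l %| q)%N, (q %| l * Q)%N &
     c1 * sqrt (INR l) * Rpower h gamma <=
     \big[Rplus/0]_(a < q | coprime a q) Rabs (second_diff f (INR a / INR q) h)]) ->
  (0 < N)%N -> / INR N < h0 -> ((Y * Q) * (Y * Q) <= N)%N ->
  c1 * Rpower (/ INR N) gamma * INR N *
    (\rsum_(l <- [seq l <- primes_upto Y | (L0 + Q < l)%N]) sqrt (INR l)) <=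
  4 * INR (box_count (graph f) N).
Proof.
move=> fc fb c10 Q0 hl N0 Nh YQ.
have iN : 0 < INR N by apply: lt_0_INR; lia.
have hN : 0 < / INR N < h0 by split; first exact: Rinv_0_lt_compat.
have ex (l : nat) : exists q, prime l -> (L0 < l)%N -> [/\ (l %| q)%N, (q %| l * Q)%N &
     c1 * sqrt (INR l) * Rpower (/ INR N) gamma <=
     \big[Rplus/0]_(a < q | coprime a q) Rabs (second_diff f (INR a / INR q) (/ INR N))].
  have [[pl Ll]|np] := classic (prime l /\ (L0 < l)%N); last by exists 0%N => pl Ll; case: np.
  by have [q hq] := hl l pl Ll _ hN; exists q.
have [qf qfP] := functional_choice ex.
set Ls := [seq l <- primes_upto Y | (L0 + Q < l)%N].
have LsP l : l \in Ls -> [/\ prime l, (L0 < l)%N, (Q < l)%N & (l <= Y)%N].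
  rewrite !mem_filter mem_iota => /andP[h1 /andP[-> h2]]; split=> //; lia.
pose pts0 := [seq (l, a) | l <- Ls, a <- [seq a <- iota 0 (qf l) | coprime a (qf l)]].
pose pts := [seq (qf w.1, w.2) | w <- pts0].
have qf_inj l l' : l \in Ls -> l' \in Ls -> qf l = qf l' -> l = l'.
  move=> /LsP[pl Ll Ql _] /LsP[pl' Ll' _ _] e.
  have [d1 _ _] := qfP l pl Ll; have [_ d2 _] := qfP l' pl' Ll'.
  have : (l %| l' * Q)%N by apply: dvdn_trans d2; rewrite -e.
  rewrite Euclid_dvdM // => /orP[|/dvdn_leq]; last by lia.
  by rewrite dvdn_prime2 // => /eqP.
have pts0P w : w \in pts0 -> [/\ w.1 \in Ls, (w.2 < qf w.1)%N & coprime w.2 (qf w.1)].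
  case/allpairsPdep => l [a [hl' ha ->]] /=; split=> //; move: ha; rewrite mem_filter mem_iota => /andP[h1 h2] //.
have upts : uniq pts.
  rewrite map_inj_in_uniq.
    apply: allpairs_uniq_dep.
    - by rewrite !filter_uniq ?iota_uniq.
    - by move=> l _; rewrite filter_uniq ?iota_uniq.
    - by move=> [l a] [l' a'] _ _ /= [-> ->].
  move=> [l a] [l' a'] /pts0P[/= h1 _ _] /pts0P[/= h2 _ _] [e ->].
  by rewrite (qf_inj _ _ h1 h2 e).
have ptsP p : p \in pts -> [/\ (1 < p.1)%N, (p.1 * p.1 <= N)%N, (p.2 < p.1)%N & coprime p.2 p.1].
  case/mapP=> w /pts0P[/LsP[pl Ll Ql lY] h2 h3] ->; split=> //=.
    have [d1 d2 _] := qfP _ pl Ll.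
    apply: leq_trans (prime_gt1 pl) _; apply: dvdn_leq d1; lia.
  have [d1 d2 _] := qfP _ pl Ll.
  have h : (qf w.1 <= Y * Q)%N.
    apply: (@leq_trans (w.1 * Q)); last by rewrite leq_mul2r lY orbT.
    by apply: dvdn_leq d2; rewrite muln_gt0 prime_gt0.
  by apply: leq_trans YQ; apply: leq_mul.
apply: Rle_trans (sum_second_differences_le fc fb N0 upts ptsP).
rewrite -rsum_scal /pts big_map /pts0 big_allpairs_dep.
apply: rsum_le => l /LsP[pl Ll _ _].
have [_ _ h] := qfP l pl Ll.
have -> : c1 * Rpower (/ INR N) gamma * INR N * sqrt (INR l) =
   c1 * sqrt (INR l) * Rpower (/ INR N) gamma * INR N by ring.
apply: Rle_trans (Rmult_le_compat_r _ _ _ (Rlt_le _ _ iN) h) _.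
rewrite big_distrl /= big_filter; apply: Req_le.
by rewrite -(big_mkord (fun a => coprime a (qf l)) (fun a => Rabs (second_diff f (INR a / INR (qf l)) (/ INR N)) * INR N)) /index_iota subn0.
Qed.

(** With Y = floor(sqrt N / Q) the sum of sqrt l is about Y^(3/2 - o(1)), that is
    N^(3/4 - o(1)). *)
Lemma log_lower_bound (c1 gamma eps : R) (Q L : nat) (A : nat -> nat) :
  0 < c1 -> (0 < Q)%N -> 0 < eps ->
  (exists N0, forall Y N, (N0 <= N)%N -> ((Y * Q) * (Y * Q) <= N)%N ->
     c1 * Rpower (/ INR N) gamma * INR N *
     (\rsum_(l <- [seq l <- primes_upto Y | (L < l)%N]) sqrt (INR l)) <= 4 * INR (A N)) ->
  exists N1, forall N, (N1 <= N)%N -> 7 / 4 - gamma - eps <= ln (INR (A N)) / ln (INR N).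
Proof.
move=> c10 Q0 e0 [N0 hA].
pose e1 := Rmin (eps / 2) (1 / 2).
have e10 : 0 < e1 by apply: Rmin_glb_lt; lra.
have e1l : e1 <= eps / 2 by exact: Rmin_l.
have e1r : e1 <= 1 / 2 by exact: Rmin_r.
have [C hC] := primes_upto_log e10.
have iQ : 1 <= INR Q by rewrite -[1]/(INR 1); apply: le_INR; lia.
pose C3 := ln (2 * INR Q) + C.
pose C5 := 3 / 2 * (C3 + ln 4) - ln c1 + ln 4.
have iL : 0 < INR (4 * L.+2) by apply: lt_0_INR; lia.
(* A threshold for ln N beyond which every additive constant below is absorbed. *)
pose T := 2 * Rabs C5 / eps + 4 * (Rabs C3 + Rabs (ln (INR (4 * L.+2)))) +
   2 * Rabs (ln (8 * INR Q + 2)) + 1.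
have [N1 hN1] := INR_unbounded (exp T).
exists (N0 + N1)%N => N hN.
have iN : exp T <= INR N by apply: (Rle_trans _ (INR N1)); [lra | apply: le_INR; lia].
have N_pos : 0 < INR N by have := exp_pos T; lra.
set X := ln (INR N).
have XT : T <= X by rewrite -(ln_exp T); apply: ln_le => //; exact: exp_pos.
have t1 : 0 <= 2 * Rabs C5 / eps.
  by apply: Rmult_le_pos; [have := Rabs_pos C5; lra | apply/Rlt_le/Rinv_0_lt_compat].
have t2 := Rabs_pos C3; have t3 := Rabs_pos (ln (INR (4 * L.+2))).
have t4 := Rabs_pos (ln (8 * INR Q + 2)).
have X1 : 1 <= X by rewrite /T in XT; lra.
have sqX : ln (sqrt (INR N)) = X / 2.
  by rewrite -Rpower_sqrt // /Rpower ln_exp /X; field.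
have sqN : 8 * INR Q + 2 <= sqrt (INR N).
  have sp : 0 < sqrt (INR N) by exact: sqrt_lt_R0.
  rewrite -(exp_ln (8 * INR Q + 2)); last lra.
  rewrite -(exp_ln (sqrt (INR N))) // sqX.
  have : ln (8 * INR Q + 2) <= X / 2 by have := Rle_abs (ln (8 * INR Q + 2)); rewrite /T in XT; lra.
  by case=> [h | ->]; [left; exact: exp_increasing | right].
pose r := Nat.sqrt N; pose Y := (r %/ Q)%N.
have [r1 r2] := Nat.sqrt_spec N (Nat.le_0_l N); rewrite -/r in r1 r2.
have YQ : ((Y * Q) * (Y * Q) <= N)%N.
  by apply: (@leq_trans (r * r)); [apply: leq_mul; exact: leq_divM | exact/leP].
have Y_ge : sqrt (INR N) / (2 * INR Q) <= INR Y.
  have h1 : sqrt (INR N) <= INR r + 1.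
    rewrite -S_INR -(sqrt_square (INR r.+1)); last exact: pos_INR.
    by apply: sqrt_le_1_alt; rewrite -mult_INR; apply: le_INR; lia.
  have h2 : INR r <= (INR Y + 1) * INR Q.
    rewrite -S_INR -mult_INR; apply: le_INR; apply/leP/ltnW.
    by rewrite -[Nat.mul _ _]/(Y.+1 * Q)%N -ltn_divLR.
  apply: (Rmult_le_reg_r (2 * INR Q)); first lra.
  have -> : sqrt (INR N) / (2 * INR Q) * (2 * INR Q) = sqrt (INR N) by field; lra.
  nra.
have Y_pos : 4 <= INR Y.
  apply: Rle_trans Y_ge; apply: (Rmult_le_reg_r (2 * INR Q)); first lra.
  have -> : sqrt (INR N) / (2 * INR Q) * (2 * INR Q) = sqrt (INR N) by field; lra.
  lra.
have Y4 : (4 <= Y)%N.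
  by apply/leP; apply: INR_le; rewrite (_ : INR 4 = 4) // /=; ring.
have lnY : X / 2 - ln (2 * INR Q) <= ln (INR Y).
  rewrite -sqX -ln_div; try lra; apply: ln_le => //.
  by apply: Rdiv_lt_0_compat; lra.
have [m0 hm] := hC Y Y4; set m := size (primes_upto Y) in m0 hm.
have im : 0 < INR m by apply: lt_0_INR; lia.
have lQ : 0 <= ln (2 * INR Q) by rewrite -ln_1; apply: ln_le; lra.
have lnm : (1 - e1) * (X / 2) - C3 <= ln (INR m) by rewrite /C3; nra.
have m_large : (4 * L.+2 <= m)%N.
  apply/leP/INR_le; rewrite -(exp_ln (INR (4 * L.+2))) // -(exp_ln (INR m)) //.
  have : ln (INR (4 * L.+2)) <= ln (INR m).
    have := Rle_abs C3; have := Rle_abs (ln (INR (4 * L.+2))).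
    rewrite /T in XT; nra.
  by case=> [h | ->]; [left; exact: exp_increasing | right].
have S_ge := sum_sqrt_primes_ge m_large; rewrite -/m in S_ge.
have hN0 : (N0 <= N)%N by lia.
have main := hA Y N hN0 YQ.
have m4 : 0 < INR m / 4 by lra.
have sm : 0 < sqrt (INR m / 4) by exact: sqrt_lt_R0.
have Np := Rpower_gt0 (/ INR N) gamma.
have low : c1 * Rpower (/ INR N) gamma * INR N * (INR m / 4 * sqrt (INR m / 4)) <= 4 * INR (A N).
  apply: Rle_trans main; apply: Rmult_le_compat_l S_ge.
  by apply: Rmult_le_pos; [apply: Rmult_le_pos; lra | lra].
have cN : 0 < c1 * Rpower (/ INR N) gamma by exact: Rmult_lt_0_compat.
have cNN : 0 < c1 * Rpower (/ INR N) gamma * INR N by exact: Rmult_lt_0_compat.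
have mm : 0 < INR m / 4 * sqrt (INR m / 4) by exact: Rmult_lt_0_compat.
have lhs0 := Rmult_lt_0_compat _ _ cNN mm.
have A_pos : 0 < INR (A N) by lra.
have := ln_le _ _ lhs0 low.
have ln4A : ln (4 * INR (A N)) = ln 4 + ln (INR (A N)) by rewrite ln_mult //; lra.
have lnm4 : ln (INR m / 4 * sqrt (INR m / 4)) = 3 / 2 * (ln (INR m) - ln 4).
  rewrite ln_mult // -Rpower_sqrt // /Rpower ln_exp ln_div //; last lra.
  by field.
rewrite ln4A (ln_mult _ _ cNN mm) lnm4 (ln_mult _ _ cN N_pos) (ln_mult _ _ c10 Np).
have -> : ln (Rpower (/ INR N) gamma) = - gamma * X.
  by rewrite /Rpower ln_exp ln_Rinv // -/X; ring.
rewrite -/X => final.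
apply: (Rmult_le_reg_r X); first lra.
have -> : ln (INR (A N)) / X * X = ln (INR (A N)) by field; lra.
have C5X : C5 <= eps / 2 * X.
  have h1 : 2 * Rabs C5 / eps <= X by rewrite /T in XT; lra.
  have h2 : 2 * Rabs C5 / eps * (eps / 2) <= X * (eps / 2) by apply: Rmult_le_compat_r; lra.
  have e3 : 2 * Rabs C5 / eps * (eps / 2) = Rabs C5 by field; lra.
  have := Rle_abs C5; lra.
have e1X : e1 * X <= eps / 2 * X by apply: Rmult_le_compat_r; lra.
rewrite /C5 in C5X; nra.
Qed.
End CountBound.

(** * The lower box dimension *)

Lemma LimInf_ge (u : nat -> R) (l : R) :
  (forall eps, 0 < eps -> exists N, forall n, (N <= n)%nat -> l - eps <= u n) ->
  Rbar_le l (LimInf_seq u).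
Proof.
  intros h.
  assert (low : forall eps, 0 < eps -> Rbar_le (l - eps) (LimInf_seq u)).
  { intros eps he; destruct (h eps he) as [N hN].
    rewrite <- (LimInf_seq_const (l - eps)).
    apply LimInf_le; now exists N. }
  destruct (LimInf_seq u) as [x| |]; simpl in *; trivial.
  - apply Rle_plus_epsilon; intros eps he; specialize (low eps he); lra.
  - exact (low 1 Rlt_0_1).
Qed.

Lemma box_count_graph_G (delta : R) (g : R -> R) (c : Z -> C) (eps : R) (d0 : nat) (s : C) :
  0 < delta <= 1 -> (forall x, continuous g x) ->
  is_fourier_expansion (fun x => RtoC (g x)) c ->
  0 < eps ->
  ex_series (fun n : nat =>
    Cmod (c (Z.of_nat (S n))) * Rpower (INR (S n)) ((eps + delta) / 2)) ->
  (0 < d0)%nat -> square_free d0 ->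
  is_series (fun n : nat =>
    let k := (S n ^ 2 * d0)%nat in
    Cmult (c (Z.of_nat k)) (RtoC (Rpower (INR k) (delta / 2)))) s ->
  s <> RtoC 0 ->
  forall eta, 0 < eta -> exists N1, forall N, (N1 <= N)%nat ->
    7 / 4 - delta / 2 - eta <= ln (INR (box_count (graph (G delta g)) N)) / ln (INR N).
Proof.
  intros hdelta g_cont hg eps0 hc d0_pos d0_sqf hs s0 eta eta0.
  assert (c_conj : forall k, Cmod (c (- k)%Z) = Cmod (c k)).
  { intros k; rewrite (conj_coefficient g c k hg); apply Cmod_conj. }
  assert (c_sum : ex_series (fun j => Cmod (c (Z.of_nat (S j))) * Rpower (INR (S j)) (delta / 2))).
  { refine (ex_series_le (K := R_AbsRing) (V := R_CompleteNormedModule) _ _ _ hc).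
    intros n; unfold norm; simpl norm; unfold abs; simpl abs.
    pose proof (Rpower_gt0 (INR (S n)) (delta / 2)); pose proof (Cmod_ge_0 (c (Z.of_nat (S n)))).
    rewrite Rabs_pos_eq by (apply Rmult_le_pos; lra).
    apply Rmult_le_compat_l; [lra|]; apply Rle_Rpower; [|lra].
    change 1 with (INR 1); apply le_INR; lia. }
  assert (g_lim : forall x, filterlim (fun N => fourier_sum c N x) eventually (locally (RtoC (g x)))).
  { intros x; refine (filterlim_ext _ _ _ (proj2 hg x)); intros N; apply fourier_sumE. }
  assert (hs' : is_series (fun n => (c (Z.of_nat (S n * S n * d0)) *
       RtoC (Rpower (INR (Z.abs_nat (Z.of_nat (S n * S n * d0)))) (delta / 2)))%C) s).
  { refine (is_series_ext _ _ _ _ hs); intros n; cbv zeta.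
    rewrite Zabs2Nat.id, Nat.pow_2_r; reflexivity. }
  destruct (g_bounded hdelta c_conj c_sum g_lim) as [b [b0 g_bound]].
  pose proof (fun h1 => second_differences_large (s := s) hdelta c_conj c_sum g_lim h1 d0_sqf hs' s0) as large.
  destruct (large (ssrbool.introT ssrnat.leP d0_pos))
    as [c1 [Q [L0 [h0 [c10 Q0 h00 hl]]]]].
  destruct (INR_unbounded (/ h0)) as [N0 hN0].
  assert (count : exists N1, forall N, is_true (ssrnat.leq N1 N) ->
     7 / 4 - delta / 2 - eta <= ln (INR (box_count (graph (G delta g)) N)) / ln (INR N)).
  { apply (log_lower_bound (c1 := c1) (Q := Q) (L := L0 + Q)); trivial.
    exists N0; intros Y N hN YQ.
    assert (hN' : INR N0 <= INR N).
    { apply le_INR, (ssrbool.elimT ssrnat.leP), hN. }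
    pose proof (Rinv_0_lt_compat _ h00).
    refine (box_count_ge (f := G delta g) (b := b * Series (weight delta)) (h0 := h0) (L0 := L0) _ _ c10 Q0 hl _ _ YQ).
    - intros x; exact (G_continuous delta b g hdelta g_cont g_bound x).
    - intros x; exact (G_bound delta b g hdelta g_bound x).
    - apply (ssrbool.introT ssrnat.leP), INR_lt; simpl; lra.
    - rewrite <- (Rinv_inv h0); apply Rinv_lt_contravar; [apply Rmult_lt_0_compat|]; lra. }
  destruct count as [N1 hN1]; exists N1; intros N hN.
  apply hN1, (ssrbool.introT ssrnat.leP), hN.
Qed.

Theorem theorem1p1
  (delta : R) (hdelta : 0 < delta <= 1)
  (g : R -> R) (c : Z -> C)
  (g_cont : forall x : R, continuous g x)
  (g_per : forall x : R, g (x + 1) = g x)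
  (g_fourier : is_fourier_expansion (fun x => RtoC (g x)) c)
  (c_summable : exists eps : R, 0 < eps /\
     ex_series (fun n : nat =>
       Cmod (c (Z.of_nat (S n))) * Rpower (INR (S n)) ((eps + delta) / 2)))
  (c_nonzero : exists d0 : nat, (0 < d0)%nat /\ square_free d0 /\
     exists s : C,
       is_series (fun n : nat =>
         let k := (S n ^ 2 * d0)%nat in
         Cmult (c (Z.of_nat k)) (RtoC (Rpower (INR k) (delta / 2)))) s /\
       s <> RtoC 0) :
  Rbar_le (Finite (7 / 4 - delta / 2)) (lower_box_dim (graph (G delta g))).
Proof.
  destruct c_summable as [eps [eps0 hc]].
  destruct c_nonzero as [d0 [d0_pos [d0_sqf [s [hs s0]]]]].
  apply LimInf_ge.
  exact (box_count_graph_G delta g c eps d0 s hdelta g_cont g_fourier eps0 hc d0_pos d0_sqf hs s0).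
Qed.
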